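(* Let $n\ge1$, $Q:[0,\infty)\to\mathbb{C}^{n\times n}$ with $Q=Q^*$ and $\int_0^\infty(1+t)|Q(t)|\,dt<\infty$, $U$ an $n\times n$ unitary matrix, and $\mathcal{L}=-\frac{d^2}{dx^2}+Q$ the selfadjoint operator on $L^2([0,\infty);\mathbb{C}^n)$ with boundary condition $\frac{i}{2}(U^*-\mathbb{I})f(0)+\frac12(U^*+\mathbb{I})f'(0)=0$, assumed to have no virtual level at zero. Put $A=\frac12(U+\mathbb{I})$, $B=\frac{i}{2}(U-\mathbb{I})$ and for $\operatorname{Im}k>0$ $$M_-(k)=-\frac{1}{2ik}\Big[F(0,-\bar k)^*B-F_x(0,-\bar k)^*A\Big].$$ Then all poles of $M_-(k)^{-1}$ in the half-plane $\operatorname{Im}k>0$ are simple: at each such pole $k_l$, $M_-(k)^{-1}$ has a Laurent expansion in $k-k_l$ whose lowest-order term is $(k-k_l)^{-1}N_l$ for some matrix $N_l$.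
   Context: The Jost solution $F(x,k)$ ($\operatorname{Im}k\ge0$) is the matrix solution of $-F''+QF=k^2F$ with $F(x,k)-e^{ikx}\mathbb{I}\to0$ as $x\to\infty$; it is analytic in $k$ for $\operatorname{Im}k>0$, and $F_x$ is its $x$-derivative. ''No virtual level at zero'' is the paper's standing assumption that zero is not a virtual level (in particular not an eigenvalue) of $\mathcal{L}$. *)

(* Defs.v *)
From HB Require Import structures.
From mathcomp Require Import all_boot all_order all_algebra.
From mathcomp Require Import all_classical all_reals all_analysis.
From mathcomp Require Import complex.
Import Order.TTheory GRing.Theory Num.Theory.
Import numFieldNormedType.Exports.

Set Implicit Arguments.
Unset Strict Implicit.
Unset Printing Implicit Defensive.

Local Open Scope ring_scope.
Local Open Scope classical_set_scope.

(* Equip R[i] (a numClosedFieldType) with its norm topology / normed-module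
   structure, as mathcomp-analysis does generically for numFieldTypes. *)
#[warnings="-redundant-canonical-projection"]
HB.instance Definition _ (R : rcfType) :=
  PseudoPointedMetric.copy R[i] (R[i] : numFieldType).
#[warnings="-redundant-canonical-projection"]
HB.instance Definition _ (R : rcfType) :=
  NormedModule.copy R[i] (R[i] : numFieldType).

Section Defs.
Variable R : realType.
Local Notation C := R[i].

Definition RtoC (r : R) : C := Complex r 0.

(* e^{i k x} for k complex, x real *)
Definition cexpi (k : C) (x : R) : C :=
  Complex (expR (- complex.Im k * x) * cos (complex.Re k * x))
          (expR (- complex.Im k * x) * sin (complex.Re k * x)).

Definition adjmx (p q : nat) (A : 'M[C]_(p, q)) : 'M[C]_(q, p) :=
  (map_mx (@conjc R) A)^T.

(* |A| : a matrix norm (sum of the moduli of the entries; all matrix norms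
   are equivalent, so the integrability condition does not depend on it) *)
Definition cmxnorm (p q : nat) (A : 'M[C]_(p, q)) : R :=
  \sum_(i < p) \sum_(j < q) complex.Re `|A i j|.

Definition half_line_deriv (p q : nat) (g g' : R -> 'M[C]_(p, q)) : Prop :=
  forall x : R, 0 <= x ->
    (fun h : R => RtoC h^-1 *: (g (x + h) - g x))
      @ within [set h | 0 <= x + h] (0 : R)^' --> g' x.

Definition cint (a b : R) (f : R -> C) : C :=
  Complex (Rintegral lebesgue_measure `[a, b] (fun t => complex.Re (f t)))
          (Rintegral lebesgue_measure `[a, b] (fun t => complex.Im (f t))).

Definition mxint (p q : nat) (a b : R) (G : R -> 'M[C]_(p, q)) : 'M[C]_(p, q) :=
  \matrix_(i, j) cint a b (fun t => G t i j).

(* f (with x-derivative f') solves  -f'' + Q f = z f  on [0, +oo)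
   (in the Caratheodory sense: f' is absolutely continuous and
    f'' = (Q - z) f a.e.) *)
Definition solves_half (n q : nat) (Q : R -> 'M[C]_n) (z : C)
    (f f' : R -> 'M[C]_(n, q)) : Prop :=
  half_line_deriv f f' /\
  forall a b : R, 0 <= a -> a <= b ->
    f' b - f' a = mxint a b (fun t => (Q t - z%:M) *m f t).

Definition jost_solution (n : nat) (Q : R -> 'M[C]_n)
    (F Fx : R -> C -> 'M[C]_n) : Prop :=
  forall k : C, 0 < complex.Im k ->
    solves_half Q (k ^+ 2) (fun x => F x k) (fun x => Fx x k) /\
    (fun x => cexpi (- k) x *: F x k) @ +oo --> (1%:M : 'M[C]_n).

Definition bc_holds (n : nat) (U : 'M[C]_n) (f0 f0' : 'cV[C]_n) : Prop :=
  ((Complex 0 1) / 2%:R) *: (adjmx U - 1%:M) *m f0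
    + (2%:R^-1 : C) *: (adjmx U + 1%:M) *m f0' = 0.

(* zero is a virtual level of L (in particular this covers a zero
   eigenvalue): there is a nonzero bounded solution of -f'' + Q f = 0 on
   [0, +oo) satisfying the boundary condition. *)
Definition zero_virtual_level (n : nat) (Q : R -> 'M[C]_n) (U : 'M[C]_n) : Prop :=
  exists f f' : R -> 'cV[C]_n,
    solves_half Q 0 f f' /\
    (exists c : R, forall x : R, 0 <= x -> forall i, complex.Re `|f x i 0| <= c) /\
    (exists x : R, 0 <= x /\ f x != 0) /\
    bc_holds U (f 0) (f' 0).

Definition Amx (n : nat) (U : 'M[C]_n) : 'M[C]_n := (2%:R^-1 : C) *: (U + 1%:M).
Definition Bmx (n : nat) (U : 'M[C]_n) : 'M[C]_n :=
  ((Complex 0 1) / 2%:R) *: (U - 1%:M).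

Definition Mminus (n : nat) (U : 'M[C]_n) (F Fx : R -> C -> 'M[C]_n) (k : C)
  : 'M[C]_n :=
  (- (2%:R * Complex 0 1 * k)^-1) *:
    (adjmx (F 0 (- conjc k)) *m Bmx U - adjmx (Fx 0 (- conjc k)) *m Amx U).

(* kl is a pole of k |-> M(k)^{-1}: an isolated singularity (M(k) invertible
   in a punctured neighbourhood of kl) near which M(k)^{-1} is unbounded. *)
Definition pole_of_inv (n : nat) (M : C -> 'M[C]_n) (kl : C) : Prop :=
  (\forall k \near kl^', M k \in unitmx) /\
  ~ (exists c : R, \forall k \near kl^',
        forall i j, complex.Re `|invmx (M k) i j| <= c).

End Defs.

(* Main.v *)
(* Write k' = - conj k.  The rows of F(x, k')^* are solutions decaying like
   e^{ikx}, and M_-(k) is, up to a scalar factor, the boundary form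
   J(k) = F(0, k')^* B - F_x(0, k')^* A.  For k near a pole k_l the Wronskian
   identity reads
     F(0, k')^* F_x(0, k_l') - F_x(0, k')^* F(0, k_l')
       = (conj k_l ^ 2 - k ^ 2) G(k),   G(k) = \int_0^oo F(x, k')^* F(x, k_l') dx,
   where G is continuous at k_l and G(k_l) is positive definite.  If v J(k_l) = 0,
   the left-hand side applied to v^* is J(k) c for a fixed vector c.  When
   conj k_l ^ 2 <> k_l ^ 2 this forces v = 0, so there is no pole.  Otherwise
   J(k) c = (k - k_l) H(k), and the columns H(k_l), which G(k_l) > 0 pairs
   nondegenerately with the left kernel of J(k_l), complete J(k_l) to a matrix
   of full row rank; this inverts (k - k_l) J(k)^-1 in the limit.  Only the
   continuity in k of F, F_x and G is used, not their analyticity. *)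
Require Import Defs.
From HB Require Import structures.
From mathcomp Require Import all_boot all_order all_algebra.
From mathcomp Require Import all_classical all_reals all_analysis.
From mathcomp Require Import complex.
From mathcomp Require Import measurable_realfun ring lra.
Import Order.TTheory GRing.Theory Num.Theory.
Import numFieldNormedType.Exports.
Set Implicit Arguments.
Unset Strict Implicit.
Unset Printing Implicit Defensive.
Local Open Scope ring_scope.
Local Open Scope classical_set_scope.

(** [Q] is merely integrable, so [Fx] need not have a classical derivative, and [jost_solution]
    constrains each [k] separately: it gives no continuity in [k] and no asymptotics of [Fx].
    Everything is derived from increments over small intervals straddling a point, measured against
    a gauge that controls both length and potential; this yields a product rule and a mean value
    inequality. The asymptotics of [Fx] follow from the two first-order factors of the equation. The
    dependence on [k] comes from a Volterra contraction that compares two given solutions directly,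
    with constants depending only on the solution frozen at k_l'. G is never formed as an integral:
    it is the boundary Wronskian divided by conj k_l ^ 2 - k ^ 2. On the imaginary axis this
    quotient is 0/0 at k_l, so G(k_l) is obtained as the limit of a Cauchy family, and its
    definiteness from lower bounds at nearby k. The reflection k' = - conj k preserves the upper
    half-plane and satisfies conj k' ^ 2 = k ^ 2, so adjoints of solutions at k' solve the equation
    at k. *)

Local Notation cmod z := (complex.Re `|z|).

(** * Moduli and the entrywise matrix norm *)

Section ComplexModulus.
Variable R : realType.
Implicit Types z w : R[i].

Lemma cmodE z : (cmod z)%:C%C = `|z|.
Proof. by case: z. Qed.

Lemma cmod_ge0 z : 0 <= cmod z.
Proof. by rewrite -ler0c cmodE. Qed.

Lemma cmodM z w : cmod (z * w) = cmod z * cmod w.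
Proof. by apply: complexI; rewrite rmorphM /= !cmodE normrM. Qed.

Lemma cmodD z w : cmod (z + w) <= cmod z + cmod w.
Proof. by rewrite -lecR cmodE rmorphD /= !cmodE ler_normD. Qed.

Lemma cmodN z : cmod (- z) = cmod z.
Proof. by rewrite normrN. Qed.

Lemma cmod_eq0 z : cmod z = 0 -> z = 0.
Proof. by move=> h; apply/eqP; rewrite -normr_eq0 -cmodE h. Qed.

Lemma cmod_gt0 z : z != 0 -> 0 < cmod z.
Proof. by move=> h; rewrite -ltcR cmodE normr_gt0. Qed.

Lemma cmod_conj z : cmod (conjc z) = cmod z.
Proof. by case: z => a b; rewrite /= sqrrN. Qed.

Lemma cmod_real (r : R) : cmod (r%:C%C) = `|r|.
Proof. by rewrite /= expr0n addr0 sqrtr_sqr. Qed.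

Lemma cmod_sqr z : (cmod z) ^+ 2 = complex.Re z ^+ 2 + complex.Im z ^+ 2.
Proof. by case: z => a b; rewrite /= sqr_sqrtr // addr_ge0 // sqr_ge0. Qed.

Lemma Re_le_cmod z : `|complex.Re z| <= cmod z.
Proof.
by rewrite -ler_sqr ?nnegrE ?cmod_ge0 // cmod_sqr real_normK ?num_real// lerDl sqr_ge0.
Qed.

Lemma Im_le_cmod z : `|complex.Im z| <= cmod z.
Proof.
by rewrite -ler_sqr ?nnegrE ?cmod_ge0 // cmod_sqr real_normK ?num_real// lerDr sqr_ge0.
Qed.

Lemma cmod_le z : cmod z <= `|complex.Re z| + `|complex.Im z|.
Proof.
rewrite -ler_sqr ?nnegrE ?cmod_ge0 ?addr_ge0 // cmod_sqr sqrrD !real_normK ?num_real//.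
by rewrite addrAC lerDl mulrn_wge0 // mulr_ge0.
Qed.

End ComplexModulus.

Section MatrixNorm.
Variable R : realType.
Local Notation C := R[i].
Local Notation nrm := (@cmxnorm R _ _).

Lemma nrm_ge0 p q (A : 'M[C]_(p, q)) : 0 <= nrm A.
Proof. by do 2!apply: sumr_ge0 => ? _; apply: cmod_ge0. Qed.

Lemma nrmD p q (A B : 'M[C]_(p, q)) : nrm (A + B) <= nrm A + nrm B.
Proof.
rewrite -big_split /=; apply: ler_sum => i _; rewrite -big_split /=.
by apply: ler_sum => j _; rewrite !mxE; apply: cmodD.
Qed.

Lemma nrmN p q (A : 'M[C]_(p, q)) : nrm (- A) = nrm A.
Proof. by apply: eq_bigr => i _; apply: eq_bigr => j _; rewrite mxE cmodN. Qed.

Lemma nrmBC p q (A B : 'M[C]_(p, q)) : nrm (A - B) = nrm (B - A).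
Proof. by rewrite -nrmN opprB. Qed.

Lemma nrm0 p q : nrm (0 : 'M[C]_(p, q)) = 0.
Proof. by rewrite /cmxnorm big1// => i _; rewrite big1// => j _; rewrite mxE normr0. Qed.

Lemma nrmZ p q (a : C) (A : 'M[C]_(p, q)) : nrm (a *: A) = cmod a * nrm A.
Proof.
rewrite /cmxnorm mulr_sumr; apply: eq_bigr => i _; rewrite mulr_sumr.
by apply: eq_bigr => j _; rewrite mxE cmodM.
Qed.

Lemma nrm_entry p q (A : 'M[C]_(p, q)) i j : cmod (A i j) <= nrm A.
Proof.
rewrite /cmxnorm (bigD1 i)//= (bigD1 j)//= -addrA lerDl.
by rewrite addr_ge0// sumr_ge0// => *; rewrite ?sumr_ge0// => *; apply: cmod_ge0.
Qed.

Lemma nrm_eq0 p q (A : 'M[C]_(p, q)) : nrm A = 0 -> A = 0.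
Proof.
move=> h; apply/matrixP => i j; rewrite mxE; apply: cmod_eq0; apply/le_anti.
by rewrite cmod_ge0 andbT -h nrm_entry.
Qed.

Lemma nrmM p q r (A : 'M[C]_(p, q)) (B : 'M[C]_(q, r)) :
  nrm (A *m B) <= nrm A * nrm B.
Proof.
rewrite /cmxnorm mulr_suml; apply: ler_sum => i _.
apply: (@le_trans _ _ (\sum_(j < r) \sum_(l < q) cmod (A i l) * cmod (B l j))).
  apply: ler_sum => j _; rewrite mxE.
  apply: (big_ind2 (fun z (x : R) => cmod z <= x)); first by rewrite normr0.
    by move=> z x w y zx wy; apply: le_trans (cmodD _ _) _; apply: lerD.
  by move=> l _; rewrite cmodM.
rewrite exchange_big /= mulr_suml; apply: ler_sum => l _.
rewrite -mulr_sumr; apply: ler_wpM2l; first exact: cmod_ge0.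
rewrite (bigD1 l)//= lerDl; do 2!apply: sumr_ge0 => ? _; exact: cmod_ge0.
Qed.

Lemma nrm_adj p q (A : 'M[C]_(p, q)) : nrm (adjmx A) = nrm A.
Proof.
rewrite /cmxnorm exchange_big /=; apply: eq_bigr => i _; apply: eq_bigr => j _.
by rewrite !mxE; exact: cmod_conj.
Qed.

Lemma nrm_le_sum p q (A : 'M[C]_(p, q)) (e : R) :
  (forall i j, cmod (A i j) <= e) -> nrm A <= (p * q)%:R * e.
Proof.
move=> h; apply: (@le_trans _ _ (\sum_(i < p) \sum_(j < q) e)).
  by apply: ler_sum => i _; apply: ler_sum => j _.
by rewrite sumr_const sumr_const !card_ord -mulrnA mulr_natl mulnC.
Qed.

Lemma cvg_nrmP p q (T : Type) (Flt : set_system T) (FF : Filter Flt)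
    (f : T -> 'M[C]_(p, q)) (M : 'M[C]_(p, q)) :
  (f @ Flt --> M) <->
  (forall e : R, 0 < e -> \forall x \near Flt, nrm (f x - M) < e).
Proof.
split=> [fM e e0|fM].
- pose d : R := e / (p * q).+1%:R.
  have d0 : 0 < d by rewrite divr_gt0.
  have dC : (0 : C) < d%:C%C by rewrite ltcR.
  move/cvg_ballP: fM => /(_ _ dC); apply: filterS => x [_ fx].
  apply: (@le_lt_trans _ _ ((p * q)%:R * d)).
    apply: nrm_le_sum => i j; apply: ltW; rewrite -ltcR cmodE !mxE distrC.
    exact: fx.
  by rewrite /d mulrCA gtr_pMr// ltr_pdivrMr// mul1r ltr_nat.
- apply/cvg_ballP => e e0.
  have [er e0r] : e = (complex.Re e)%:C%C /\ 0 < complex.Re e.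
    by move: e0; rewrite ltcE; case: e => a b /= /andP[/eqP -> ].
  apply: filterS (fM _ e0r) => x fx; split=> // i j.
  rewrite er -ball_normE /= -cmodE ltcR; apply: le_lt_trans fx.
  by rewrite nrmBC; have := nrm_entry (M - f x) i j; rewrite !mxE.
Qed.
End MatrixNorm.

(** * Derivatives relative to a gauge *)

Section StraddleCalculus.
Variable R : realType.
Local Notation C := R[i].
Local Notation nrm := (@cmxnorm R _ _).

(* Pairs (s, t) with 0 <= s <= x <= t shrinking to x. *)
Definition straddles (x : R) : set_system (R * R) :=
  within [set p | 0 <= p.1 /\ p.1 <= x <= p.2] (nbhs (x, x)).

Global Instance straddles_filter x : Filter (straddles x).
Proof. exact: within_filter. Qed.

Lemma near_straddlesP x (P : R -> R -> Prop) :
  (\forall p \near straddles x, P p.1 p.2) <->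
  exists2 d : R, 0 < d & forall s t, 0 <= s -> s <= x -> x <= t ->
    x - d < s -> t < x + d -> P s t.
Proof.
split.
- rewrite /straddles /within /= => -[[A B] /= [/nbhs_ballP[d1 /= d10 h1] /nbhs_ballP[d2 /= d20 h2]] h].
  exists (Num.min d1 d2); first by rewrite lt_min d10 d20.
  move=> s t s0 sx xt; rewrite ltrBlDr -ltrBlDl lt_min => /andP[sd _].
  rewrite -ltrBlDl lt_min => /andP[_ td].
  apply: (h (s, t)); last by rewrite /= s0 sx xt.
  split; [apply: h1|apply: h2]; rewrite -ball_normE /=.
    by rewrite ger0_norm ?subr_ge0.
  by rewrite distrC ger0_norm ?subr_ge0.
- move=> [d d0 h]; exists (ball x d, ball x d) => /=; first by split; apply: nbhsx_ballx.
  move=> [s t] /= [sd td] [s0 /andP[sx xt]]; apply: h => //.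
    move: sd; rewrite -ball_normE /= ger0_norm ?subr_ge0// => ?; lra.
  move: td; rewrite -ball_normE /= distrC ger0_norm ?subr_ge0// => ?; lra.
Qed.

Lemma near_straddles_order (x : R) :
  \forall p \near straddles x, 0 <= p.1 /\ p.1 <= x <= p.2.
Proof. by apply/(near_straddlesP x (fun s t => 0 <= s /\ s <= x <= t)); exists 1 => // s t -> -> ->. Qed.

(** The degenerate pair (s, x) again straddles x, so two-sided estimates specialise to one-sided
    ones; continuity at x itself is read off in this way. *)
Lemma near_straddles_left (x : R) (P : R -> R -> Prop) : 0 <= x ->
  (\forall p \near straddles x, P p.1 p.2) ->
  \forall p \near straddles x, P p.1 x.
Proof.
move=> x0 /(near_straddlesP x P)[d d0 h]; apply/(@near_straddlesP _ (fun s _ => P s x)).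
by exists d => // s t s0 sx xt sd td; apply: h => //; lra.
Qed.

Lemma near_straddles_right (x : R) (P : R -> R -> Prop) : 0 <= x ->
  (\forall p \near straddles x, P p.1 p.2) ->
  \forall p \near straddles x, P x p.2.
Proof.
move=> x0 /(near_straddlesP x P)[d d0 h]; apply/(@near_straddlesP _ (fun _ t => P x t)).
by exists d => // s t s0 sx xt sd td; apply: h => //; lra.
Qed.

Variable nu : R -> R.

(* In the application nu x is x + C \int_0^x |Q|, so that errors o(nu t - nu s)
   accommodate both classical derivatives and L^1 densities. *)
Definition gauge := [/\ forall x, 0 <= x -> forall e, 0 < e ->
    \forall p \near straddles x, nu p.2 - nu p.1 < e &
  forall s t, 0 <= s -> s <= t -> t - s <= nu t - nu s].

Hypothesis nuP : gauge.

Lemma gauge_ge0 s t : 0 <= s -> s <= t -> 0 <= nu t - nu s.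
Proof. by case: nuP => _ h s0 st; apply: le_trans (h s t s0 st); rewrite subr_ge0. Qed.

(** Compactness by a supremum: the local estimate at the last reachable point c carries the
    inequality beyond c unless c = b, and the errors telescope to e * (nu b - nu a). *)
Lemma local_le_global (p : R -> R) a b : 0 <= a -> a <= b ->
  (forall x, a <= x <= b -> forall e, 0 < e ->
     \forall st \near straddles x, p st.2 - p st.1 <= e * (nu st.2 - nu st.1)) ->
  p b <= p a.
Proof.
move=> a0 ab loc; apply/ler_addgt0Pr => e' e'0.
pose e := e' / (nu b - nu a + 1).
have nn := gauge_ge0 a0 ab.
have e0 : 0 < e by rewrite divr_gt0//; lra.
suff : p b - p a <= e * (nu b - nu a).
  move=> h; have : e * (nu b - nu a) <= e'.
    by rewrite /e mulrAC ler_pdivrMr; [apply: ler_wpM2l; lra|lra].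
  lra.
pose A := [set x | a <= x <= b /\ p x - p a <= e * (nu x - nu a)].
have Aa : A a by split; [rewrite lexx ab|rewrite !subrr mulr0].
have supA : has_sup A by split; [exists a|exists b => x [/andP[]]].
pose c := sup A.
have ac : a <= c by apply: ub_le_sup => //; case: supA.
have cb : c <= b by apply: ge_sup; [exists a|move=> x [/andP[]]].
have [d d0 h] : exists2 d : R, 0 < d & forall s t, 0 <= s -> s <= c -> c <= t ->
    c - d < s -> t < c + d -> p t - p s <= e * (nu t - nu s).
  by apply/(@near_straddlesP c (fun s t => p t - p s <= e * (nu t - nu s)));
     apply: loc => //; rewrite ac cb.
have [y [/andP[ay yb] yA] cy] := sup_adherent d0 supA.
rewrite -/c in cy.
have yc : y <= c by apply: ub_le_sup; [case: supA|split; rewrite ?ay].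
(* This point lies past c unless it is cut off at b, so t <= c forces t = b. *)
pose t := Num.min b (c + d / 2).
have ct : c <= t by rewrite le_min cb; lra.
have tcd : t < c + d by rewrite gt_min; apply/orP; right; lra.
have At : A t.
  split; first by rewrite ge_min lexx/= andbT; lra.
  have := h y t ltac:(lra) yc ct cy tcd.
  move: yA; rewrite !mulrBr; lra.
have tc : t <= c by apply: ub_le_sup => //; case: supA.
have tb : t = b.
  move: tc; rewrite /t; case: (leP b (c + d / 2)) => // _ ?; lra.
by case: At => _; rewrite tb.
Qed.

(* The interval function L s t stands for the integral over [s, t] of the
   derivative of P, frozen at x.  This replaces absolute continuity: products
   can be differentiated and increments bounded without integrating. *)
Definition ider p q (P : R -> 'M[C]_(p, q)) (L : R -> R -> 'M[C]_(p, q)) (x : R) :=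
  (exists K, \forall st \near straddles x, nrm (L st.1 st.2) <= K * (nu st.2 - nu st.1)) /\
  (forall e, 0 < e -> \forall st \near straddles x,
     nrm (P st.2 - P st.1 - L st.1 st.2) <= e * (nu st.2 - nu st.1)).

(** The function nrm (P x - P a) - phi x decreases locally up to e. Here [phi] stands for an
    antiderivative of the bound on the derivative, so that no integral appears. *)
Lemma ider_mean_value p q (P : R -> 'M[C]_(p, q)) (phi : R -> R) a b :
  0 <= a -> a <= b ->
  (forall x, a <= x <= b -> exists2 L, ider P L x & forall e, 0 < e ->
     \forall st \near straddles x,
       nrm (L st.1 st.2) <= phi st.2 - phi st.1 + e * (nu st.2 - nu st.1)) ->
  nrm (P b - P a) <= phi b - phi a.
Proof.
move=> a0 ab H.
suff : nrm (P b - P a) - phi b <= nrm (P a - P a) - phi a.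
  by rewrite subrr nrm0; lra.
apply: (local_le_global (p := fun x => nrm (P x - P a) - phi x)) => // x xab e e0.
have [L [_ dP] hL] := H x xab.
have e20 : 0 < e / 2 by lra.
apply: filterS2 (dP _ e20) (hL _ e20) => -[s t] /= h1 h2.
have : nrm (P t - P a) <= nrm (P s - P a) + (nrm (P t - P s - L s t) + nrm (L s t)).
  apply: le_trans (lerD (lexx _) (nrmD _ _)); apply: le_trans (nrmD _ _).
  by rewrite subrK [in leRHS]addrC subrKA.
lra.
Qed.

Lemma ider_suff p q (P : R -> 'M[C]_(p, q)) (L : R -> R -> 'M[C]_(p, q)) x K :
  (exists K, \forall st \near straddles x, nrm (L st.1 st.2) <= K * (nu st.2 - nu st.1)) ->
  0 <= K ->
  (forall e, 0 < e -> \forall st \near straddles x,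
     nrm (P st.2 - P st.1 - L st.1 st.2) <= (K * e) * (nu st.2 - nu st.1)) ->
  ider P L x.
Proof.
move=> bL K0 h; split=> // e e0.
have e'0 : 0 < e / (K + 1) by rewrite divr_gt0//; lra.
apply: filterS2 (near_straddles_order x) (h _ e'0) => -[s t] /= [s0 /andP[sx xt]] /le_trans; apply.
apply: ler_wpM2r; first by apply: gauge_ge0 => //; lra.
by rewrite mulrCA ger_pMr// ler_pdivrMr ?mul1r; lra.
Qed.

Lemma ider_lipschitz p q (P : R -> 'M[C]_(p, q)) L (x : R) : ider P L x ->
  exists2 K, 0 <= K & \forall st \near straddles x,
    nrm (P st.2 - P st.1) <= K * (nu st.2 - nu st.1) /\
    nrm (L st.1 st.2) <= K * (nu st.2 - nu st.1).
Proof.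
move=> [[K bL] /(_ 1 ltr01) h]; exists (`|K| + 1); first by rewrite addr_ge0.
apply: filterS3 (near_straddles_order x) bL h => -[s t] /= [s0 /andP[sx xt]] h1 h2.
have n0 : 0 <= nu t - nu s by apply: gauge_ge0 => //; lra.
have h3 : K * (nu t - nu s) <= `|K| * (nu t - nu s) by apply: ler_wpM2r => //; exact: ler_norm.
have : nrm (P t - P s) <= nrm (P t - P s - L s t) + nrm (L s t).
  by apply: le_trans (nrmD _ _); rewrite subrK.
by rewrite mulrDl; split; lra.
Qed.

(** Each term on the right is negligible against the gauge: either a bounded factor meets a
    first-order error, or a factor small by continuity meets one of the order of the gauge
    increment. *)
Lemma mulmx_increment p q r (P1 P0 Px L : 'M[C]_(p, q)) (P1' P0' Px' L' : 'M[C]_(q, r)) :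
  P1 *m P1' - P0 *m P0' - (L *m Px' + Px *m L') =
  ((P1 - P0 - L) *m P1' + L *m (P1' - Px')) +
  (Px *m (P1' - P0' - L') - (Px - P0) *m (P1' - P0')).
Proof.
rewrite !mulmxBl !mulmxBr.
move: (P1 *m _) (P0 *m P1') (L *m P1') (L *m Px') (Px *m P1') (Px *m P0') (Px *m L') (P0 *m P0').
by move=> A1 A2 A3 A4 A5 A6 A7 A8; apply/matrixP => i j; rewrite !mxE; ring.
Qed.

Lemma iderM p q r (P : R -> 'M[C]_(p, q)) (P' : R -> 'M[C]_(q, r)) L L' (x : R) : 0 <= x ->
  ider P L x -> ider P' L' x ->
  ider (fun y => P y *m P' y) (fun s t => L s t *m P' x + P x *m L' s t) x.
Proof.
move=> x0 dP dP'.
have [K K0 lipP] := ider_lipschitz dP.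
have [K' K'0 lipP'] := ider_lipschitz dP'.
(* The constant has one contribution per term of [mulmx_increment]; nrm (P' x) + 1 bounds P' t near
   x. *)
apply: (@ider_suff _ _ _ _ _ (nrm (P' x) + 1 + K + K' + nrm (P x))).
- exists (K * nrm (P' x) + nrm (P x) * K').
  apply: filterS2 lipP lipP' => -[s t] /= [_ h1] [_ h2].
  apply: le_trans (nrmD _ _) _; rewrite mulrDl; apply: lerD; apply: le_trans (nrmM _ _) _.
    by rewrite mulrAC ler_wpM2r// nrm_ge0.
  by rewrite -mulrA ler_wpM2l// nrm_ge0.
- by rewrite !addr_ge0// nrm_ge0.
- move=> e e0.
  have small : forall K0, 0 <= K0 -> forall e, 0 < e ->
      \forall st \near straddles x, K0 * (nu st.2 - nu st.1) <= e.
    move=> K1 K10 e1 e10; have e2 : 0 < e1 / (K1 + 1) by rewrite divr_gt0//; lra.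
    case: nuP => /(_ x x0 _ e2) + _; apply: filterS => -[s t] /= /ltW h.
    apply: le_trans (ler_wpM2l K10 h) _.
    by rewrite mulrCA ger_pMr// ler_pdivrMr ?mul1r; lra.
  have e1 : 0 < Num.min e 1 by rewrite lt_min e0 ltr01.
  have lr := near_straddles_right (P := fun s t =>
    (nrm (P' t - P' s) <= K' * (nu t - nu s) /\ nrm (L' s t) <= K' * (nu t - nu s)) /\
    K' * (nu t - nu s) <= Num.min e 1) x0 (@filterI _ _ (straddles_filter x) _ _ lipP' (small _ K'0 _ e1)).
  have ll := near_straddles_left (P := fun s t =>
    (nrm (P t - P s) <= K * (nu t - nu s) /\ nrm (L s t) <= K * (nu t - nu s)) /\
    K * (nu t - nu s) <= e) x0 (@filterI _ _ (straddles_filter x) _ _ lipP (small _ K0 _ e0)).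
  have lr' : \forall st \near straddles x, nrm (P' st.2 - P' x) <= Num.min e 1.
    by apply: filterS lr => st /= [[+ _]]; exact: le_trans.
  have ll' : \forall st \near straddles x, nrm (P x - P st.1) <= e.
    by apply: filterS ll => st /= [[+ _]]; exact: le_trans.
  case: (dP) => _ /(_ _ e0) h1; case: (dP') => _ /(_ _ e0) h2.
  near=> st.
  have [s0 /andP[sx xt]] : 0 <= st.1 /\ st.1 <= x <= st.2
    by near: st; exact: near_straddles_order.
  have [h3 h4] : nrm (P st.2 - P st.1) <= K * (nu st.2 - nu st.1) /\
    nrm (L st.1 st.2) <= K * (nu st.2 - nu st.1) by near: st.
  have [h5 h6] : nrm (P' st.2 - P' st.1) <= K' * (nu st.2 - nu st.1) /\
    nrm (L' st.1 st.2) <= K' * (nu st.2 - nu st.1) by near: st.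
  have h7 : nrm (P st.2 - P st.1 - L st.1 st.2) <= e * (nu st.2 - nu st.1) by near: st.
  have h8 : nrm (P' st.2 - P' st.1 - L' st.1 st.2) <= e * (nu st.2 - nu st.1) by near: st.
  have h9 : nrm (P' st.2 - P' x) <= Num.min e 1.
    by near: st.
  have h10 : nrm (P x - P st.1) <= e.
    by near: st.
  move: h9; rewrite le_min => /andP[h9 h11].
  move: (st.1) (st.2) s0 sx xt h3 h4 h5 h6 h7 h8 h9 h10 h11 => s t s0 sx xt h3 h4 h5 h6 h7 h8 h9 h10 h11.
  have n0 : 0 <= nu t - nu s by apply: gauge_ge0 => //; lra.
  set D := nu t - nu s in h3 h4 h5 h6 h7 h8 n0 *.
  have -> : P t *m P' t - P s *m P' s - (L s t *m P' x + P x *m L' s t) =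
    ((P t - P s - L s t) *m P' t + L s t *m (P' t - P' x)) +
    (P x *m (P' t - P' s - L' s t) - (P x - P s) *m (P' t - P' s)).
    exact: mulmx_increment.
  apply: le_trans (nrmD _ _) _.
  have P't : nrm (P' t) <= nrm (P' x) + 1.
    rewrite addrC -[in leLHS](subrK (P' x) (P' t)); apply: le_trans (nrmD _ _) _.
    by rewrite lerD2r.
  have b1 : nrm ((P t - P s - L s t) *m P' t) <= e * D * (nrm (P' x) + 1).
    by apply: le_trans (nrmM _ _) _; apply: ler_pM => //; exact: nrm_ge0.
  have b2 : nrm (L s t *m (P' t - P' x)) <= K * D * e.
    by apply: le_trans (nrmM _ _) _; apply: ler_pM => //; exact: nrm_ge0.
  have b3 : nrm (P x *m (P' t - P' s - L' s t)) <= nrm (P x) * (e * D).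
    by apply: le_trans (nrmM _ _) _; apply: ler_pM => //; exact: nrm_ge0.
  have b4 : nrm ((P x - P s) *m (P' t - P' s)) <= e * (K' * D).
    by apply: le_trans (nrmM _ _) _; apply: ler_pM => //; exact: nrm_ge0.
  have := nrmD ((P t - P s - L s t) *m P' t) (L s t *m (P' t - P' x)).
  have := nrmD (P x *m (P' t - P' s - L' s t)) (- ((P x - P s) *m (P' t - P' s))).
  rewrite nrmN => c1 c2.
  apply: (le_trans (lerD (le_trans c2 (lerD b1 b2)) (le_trans c1 (lerD b3 b4)))).
  rewrite le_eqVlt; apply/orP; left; apply/eqP; ring.
Unshelve. all: by end_near.
Qed.

Lemma iderD p q (P P' : R -> 'M[C]_(p, q)) L L' (x : R) : ider P L x -> ider P' L' x ->
  ider (fun y => P y + P' y) (fun s t => L s t + L' s t) x.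
Proof.
move=> [[K bP] dP] [[K' bP'] dP']; split.
  exists (K + K'); apply: filterS2 bP bP' => st h1 h2.
  by rewrite mulrDl; apply: le_trans (nrmD _ _) _; exact: lerD.
move=> e e0; have e20 : 0 < e / 2 by lra.
apply: filterS2 (dP _ e20) (dP' _ e20) => -[s t] /= h1 h2.
rewrite (_ : P t + P' t - _ - _ = (P t - P s - L s t) + (P' t - P' s - L' s t)).
  by apply: le_trans (nrmD _ _) _; lra.
by rewrite !opprD !addrA; apply/matrixP => i j; rewrite !mxE; ring.
Qed.

Lemma ider_cst p q (A : 'M[C]_(p, q)) (x : R) : ider (fun=> A) (fun _ _ => 0) x.
Proof.
split; first by exists 0; apply: nearW => st; rewrite nrm0 mul0r.
move=> e e0; apply: filterS (near_straddles_order x) => -[s t] /= [s0 /andP[sx xt]].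
rewrite subrr subr0 nrm0; apply: mulr_ge0; first exact: ltW.
exact: gauge_ge0 (le_trans sx xt).
Qed.

Lemma ider_ext p q (P : R -> 'M[C]_(p, q)) L L' (x : R) : (forall s t, L s t = L' s t) ->
  ider P L x -> ider P L' x.
Proof.
by move=> h; rewrite (_ : L = L')//; apply/funext => s; apply/funext => t.
Qed.

Lemma iderMl p q r (A : 'M[C]_(p, q)) (P : R -> 'M[C]_(q, r)) L (x : R) : 0 <= x ->
  ider P L x -> ider (fun y => A *m P y) (fun s t => A *m L s t) x.
Proof.
move=> x0 dP; have := iderM x0 (ider_cst A x) dP.
by apply: ider_ext => s t; rewrite mul0mx add0r.
Qed.

Lemma iderMr p q r (P : R -> 'M[C]_(p, q)) (A : 'M[C]_(q, r)) L (x : R) : 0 <= x ->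
  ider P L x -> ider (fun y => P y *m A) (fun s t => L s t *m A) x.
Proof.
move=> x0 dP; have := iderM x0 dP (ider_cst A x).
by apply: ider_ext => s t; rewrite mulmx0 addr0.
Qed.

Lemma iderZ p q (a : C) (P : R -> 'M[C]_(p, q)) L (x : R) : 0 <= x ->
  ider P L x -> ider (fun y => a *: P y) (fun s t => a *: L s t) x.
Proof.
move=> x0 /(iderMl a%:M x0).
have -> : (fun y => a%:M *m P y) = (fun y => a *: P y).
  by apply/funext => y; rewrite mul_scalar_mx.
by apply: ider_ext => s t; rewrite mul_scalar_mx.
Qed.

Lemma iderB p q (P P' : R -> 'M[C]_(p, q)) L L' (x : R) : 0 <= x ->
  ider P L x -> ider P' L' x ->
  ider (fun y => P y - P' y) (fun s t => L s t - L' s t) x.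
Proof.
move=> x0 dP /(iderZ (-1) x0) /(iderD dP).
have -> : (fun y => P y + -1 *: P' y) = (fun y => P y - P' y).
  by apply/funext => y; rewrite scaleN1r.
by apply: ider_ext => s t; rewrite scaleN1r.
Qed.

Lemma ider_adj p q (P : R -> 'M[C]_(p, q)) L (x : R) : ider P L x ->
  ider (fun y => adjmx (P y)) (fun s t => adjmx (L s t)) x.
Proof.
move=> [[K bP] dP]; split.
  by exists K; apply: filterS bP => st; rewrite nrm_adj.
move=> e /dP; apply: filterS => -[s t] /=; rewrite -[nrm (_ - _ - _)]nrm_adj.
congr (nrm _ <= _); apply/matrixP => i j; rewrite !mxE.
by rewrite !rmorphB.
Qed.

(** The increment over [s, t] is cut at x; as s <= x <= t, the two errors e * (x - s) and e * (t -
    x) add up to e * (t - s), which the gauge dominates. *)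
Lemma ider_classical p q (P : R -> 'M[C]_(p, q)) (D : 'M[C]_(p, q)) x : 0 <= x ->
  (forall e, 0 < e -> exists2 d : R, 0 < d & forall y, 0 <= y -> `|y - x| < d ->
     nrm (P y - P x - (y - x)%:C%C *: D) <= e * `|y - x|) ->
  ider P (fun s t => (t - s)%:C%C *: D) x.
Proof.
move=> x0 h; split.
  exists (nrm D); apply: filterS (near_straddles_order x) => -[s t] /= [s0 /andP[sx xt]].
  have st := le_trans sx xt.
  rewrite nrmZ cmod_real mulrC ger0_norm ?subr_ge0// ler_wpM2l ?nrm_ge0//.
  by case: nuP => _; apply.
move=> e e0; apply/(@near_straddlesP x (fun s t => nrm (P t - P s - (t - s)%:C%C *: D) <= e * (nu t - nu s))).
have [d d0 hd] := h e e0; exists d => // s t s0 sx xt sd td.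
have h1 : `|s - x| = x - s by rewrite distrC ger0_norm ?subr_ge0.
have h2 : `|t - x| = t - x by rewrite ger0_norm ?subr_ge0.
have st := le_trans sx xt.
have h3 : nrm (P t - P x - (t - x)%:C%C *: D) <= e * (t - x).
  by have := hd t (le_trans x0 xt); rewrite h2; apply; rewrite ltrBlDl.
have h4 : nrm (P s - P x - (s - x)%:C%C *: D) <= e * (x - s).
  by have := hd s s0; rewrite h1; apply; rewrite ltrBlDr -ltrBlDl.
have -> : P t - P s - (t - s)%:C%C *: D =
   (P t - P x - (t - x)%:C%C *: D) - (P s - P x - (s - x)%:C%C *: D).
  by apply/matrixP => i j; rewrite !mxE !rmorphB /=; ring.
apply: le_trans (nrmD _ _) _; rewrite nrmN; apply: le_trans (lerD h3 h4) _.
by rewrite -mulrDr subrKA ler_pM2l//; case: nuP => _; apply.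
Qed.

End StraddleCalculus.

(** * Extracting the gauge and the increments of the potential *)

Section ComplexIntegral.
Variable R : realType.
Local Notation C := R[i].
Local Notation mu := (@lebesgue_measure R).
Implicit Types (D : set R) (h g : R -> C).

Definition cmeasurable D h :=
  measurable_fun D (fun t => complex.Re (h t)) /\
  measurable_fun D (fun t => complex.Im (h t)).

Definition cintegrable D h :=
  mu.-integrable D (EFin \o (fun t => complex.Re (h t))) /\
  mu.-integrable D (EFin \o (fun t => complex.Im (h t))).

Lemma ReM (z w : C) : complex.Re (z * w) =
  complex.Re z * complex.Re w - complex.Im z * complex.Im w.
Proof. by case: z w => a b [c d]. Qed.

Lemma ImM (z w : C) : complex.Im (z * w) =
  complex.Re z * complex.Im w + complex.Im z * complex.Re w.
Proof. by case: z w => a b [c d]. Qed.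

Lemma ReD (z w : C) : complex.Re (z + w) = complex.Re z + complex.Re w.
Proof. by case: z w => a b [c d]. Qed.

Lemma ImD (z w : C) : complex.Im (z + w) = complex.Im z + complex.Im w.
Proof. by case: z w => a b [c d]. Qed.

Lemma complex_ext (z w : C) : complex.Re z = complex.Re w -> complex.Im z = complex.Im w -> z = w.
Proof. by case: z w => a b [c d] /= -> ->. Qed.

Lemma cintegrableD D h g : measurable D -> cintegrable D h -> cintegrable D g ->
  cintegrable D (fun t => h t + g t).
Proof.
move=> mD [h1 h2] [g1 g2]; have mD' : @measurable _ (measurableTypeR R) D := mD; split.
  have := integrableD (mu := mu) mD' h1 g1; congr (mu.-integrable _ _).
  by apply/funext => t /=; rewrite ReD EFinD.
have := integrableD mD' h2 g2; congr (mu.-integrable _ _).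
by apply/funext => t /=; rewrite ImD EFinD.
Qed.

Lemma cintegrable_cst a b (c : C) : cintegrable `[a, b] (fun=> c).
Proof.
have lty : (mu `[a, b] < +oo)%E by rewrite lebesgue_measure_itv /=; case: ifP; rewrite ?ltry.
by split; apply: measurable_bounded_integrable => //; exact: bounded_cst.
Qed.

Lemma cintegrable_sum D (I : Type) (s : seq I) (h : I -> R -> C) : measurable D ->
  (forall i, cintegrable D (h i)) -> cintegrable D (fun t => \sum_(i <- s) h i t).
Proof.
move=> mD hi; elim: s => [|i s IH].
  under eq_fun do rewrite big_nil.
  by split; under [X in integrable _ _ X]eq_fun do rewrite /=; exact: integrable0.
by under eq_fun do rewrite big_cons; exact: cintegrableD.
Qed.

Lemma cintegrableM D h g (B : R) : measurable D -> cintegrable D h -> cmeasurable D g ->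
  (forall t, D t -> cmod (g t) <= B) -> cintegrable D (fun t => h t * g t).
Proof.
move=> mD [h1 h2] [g1 g2] gB; have mD' : @measurable _ (measurableTypeR R) D := mD.
have bRe : [bounded complex.Re (g t) | t in D].
  exists B; split; first exact: num_real.
  by move=> x Bx t /gB /= tB; apply/ltW; apply: le_lt_trans Bx; apply: le_trans tB; exact: Re_le_cmod.
have bIm : [bounded complex.Im (g t) | t in D].
  exists B; split; first exact: num_real.
  by move=> x Bx t /gB /= tB; apply/ltW; apply: le_lt_trans Bx; apply: le_trans tB; exact: Im_le_cmod.
split.
  have := integrableB mD' (integrableMl mD' h1 g1 bRe) (integrableMl mD' h2 g2 bIm).
  by congr (mu.-integrable _ _); apply/funext => t /=; rewrite ReM EFinB !EFinM.
have := integrableD mD' (integrableMl mD' h1 g2 bIm) (integrableMl mD' h2 g1 bRe).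
by congr (mu.-integrable _ _); apply/funext => t /=; rewrite ImM EFinD !EFinM.
Qed.

Lemma cintD a b h g : cintegrable `[a, b] h -> cintegrable `[a, b] g ->
  cint a b (fun t => h t + g t) = cint a b h + cint a b g.
Proof.
move=> [h1 h2] [g1 g2]; apply: complex_ext; rewrite ?ReD ?ImD /=.
  by rewrite -RintegralD//; apply: eq_Rintegral => t _; rewrite ReD.
by rewrite -RintegralD//; apply: eq_Rintegral => t _; rewrite ImD.
Qed.

Lemma cintMr a b h (c : C) : cintegrable `[a, b] h ->
  cint a b (fun t => h t * c) = cint a b h * c.
Proof.
move=> [h1 h2].
have iZ (f : R -> R) (r : R) : mu.-integrable `[a, b] (EFin \o f) ->
    mu.-integrable `[a, b] (EFin \o (fun t => f t * r)).
  have mD : @measurable _ (measurableTypeR R) `[a, b] := measurable_itv _.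
  move=> fi; have := integrableZl mD r fi.
  by congr (mu.-integrable _ _); apply/funext => t /=; rewrite mulrC EFinM.
apply: complex_ext; rewrite ?ReM ?ImM /=.
  rewrite -!RintegralZr// -RintegralB//; try exact: iZ.
  by apply: eq_Rintegral => t _; rewrite ReM.
rewrite -!RintegralZr// -RintegralD//; try exact: iZ.
by apply: eq_Rintegral => t _; rewrite ImM.
Qed.

Lemma cint0 (a b : R) : cint a b (fun=> 0 : C) = 0.
Proof. by apply: complex_ext => /=; rewrite Rintegral_cst// mul0r. Qed.

Lemma cint_sum (a b : R) (I : Type) (s : seq I) (h : I -> R -> C) :
  (forall i, cintegrable `[a, b] (h i)) ->
  cint a b (fun t => \sum_(i <- s) h i t) = \sum_(i <- s) cint a b (h i).
Proof.
move=> hi; elim: s => [|i s IH].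
  by rewrite big_nil; under eq_fun do rewrite big_nil; exact: cint0.
rewrite big_cons -IH -cintD//; last exact: cintegrable_sum.
by under eq_fun do rewrite big_cons.
Qed.

Lemma cint_cst (a b : R) (c : C) : a <= b -> cint a b (fun=> c) = (b - a)%:C%C * c.
Proof.
move=> ab; have len : fine (mu `[a, b]) = b - a.
  rewrite lebesgue_measure_itv /= lte_fin; case: ltP => //= ba.
  have -> : a = b by apply/le_anti; rewrite ab ba.
  by rewrite subrr.
apply: complex_ext; rewrite ?ReM ?ImM /= ?mul0r ?subr0 ?addr0 Rintegral_cst// len mulrC //.
Qed.

(** Real and imaginary parts are bounded separately, hence the factor 2. *)
Lemma cmod_cint a b h (f : R -> R) : cintegrable `[a, b] h ->
  mu.-integrable `[a, b] (EFin \o f) ->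
  (forall t, a <= t <= b -> cmod (h t) <= f t) ->
  cmod (cint a b h) <= 2 * Rintegral mu `[a, b] f.
Proof.
move=> [h1 h2] fi hf; apply: le_trans (cmod_le _) _ => /=.
rewrite mulr_natl mulr2n; apply: lerD.
  apply: le_trans (le_normr_Rintegral _ h1) _ => //; apply: le_Rintegral => //.
    exact: integrable_norm.
  move=> t /= tab; apply: le_trans (Re_le_cmod _) _; apply: hf.
  by move: tab; rewrite in_itv.
apply: le_trans (le_normr_Rintegral _ h2) _ => //; apply: le_Rintegral => //.
  exact: integrable_norm.
move=> t /= tab; apply: le_trans (Im_le_cmod _) _; apply: hf.
by move: tab; rewrite in_itv.
Qed.

Lemma cint_conj (a b : R) h : cintegrable `[a, b] h ->
  cint a b (fun t => conjc (h t)) = conjc (cint a b h).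
Proof.
move=> [h1 h2]; apply: complex_ext => /=.
  by apply: eq_Rintegral => t _; case: (h t).
rewrite -mulN1r -RintegralZl//; apply: eq_Rintegral => t _.
by case: (h t) => x y /=; rewrite mulN1r.
Qed.

Lemma eq_cint a b h g : (forall t, a <= t <= b -> h t = g t) -> cint a b h = cint a b g.
Proof.
move=> hg; apply: complex_ext; apply: eq_Rintegral => t /=; rewrite inE /= in_itv /= => /hg -> //.
Qed.

End ComplexIntegral.

(** * Differentiability and measurability on the closed half-line *)

Section HalfLineDerivative.
Variable R : realType.
Local Notation C := R[i].
Local Notation nrm := (@cmxnorm R _ _).
Local Notation mu := (@lebesgue_measure R).

Lemma half_line_deriv_approx p q (g g' : R -> 'M[C]_(p, q)) : half_line_deriv g g' ->
  forall x, 0 <= x -> forall e, 0 < e -> exists2 d : R, 0 < d &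
    forall y, 0 <= y -> `|y - x| < d ->
      nrm (g y - g x - (y - x)%:C%C *: g' x) <= e * `|y - x|.
Proof.
move=> dg x x0 e e0.
have /cvg_nrmP/(_ _ e0) := dg x x0.
rewrite /within /= => -[d /= d0 h]; exists d => // y y0 yxd.
have [->|yx] := eqVneq y x.
  by rewrite !subrr normr0 mulr0 /= scale0r subr0 nrm0.
have yx0 : y - x != 0 by rewrite subr_eq0.
have := h (y - x); rewrite /= sub0r normrN => /(_ yxd yx0).
rewrite addrC subrK => /(_ y0) /ltW h1.
have -> : g y - g x - (y - x)%:C%C *: g' x =
    (y - x)%:C%C *: (RtoC (y - x)^-1 *: (g y - g x) - g' x).
  rewrite scalerBr scalerA -[RtoC _]/((y - x)^-1)%:C%C -rmorphM /= mulfV//.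
  by rewrite scale1r.
by rewrite nrmZ cmod_real mulrC ler_wpM2r.
Qed.

Lemma half_line_deriv_cont p q (g g' : R -> 'M[C]_(p, q)) : half_line_deriv g g' ->
  forall x, 0 <= x -> forall e, 0 < e -> exists2 d : R, 0 < d &
    forall y, 0 <= y -> `|y - x| < d -> nrm (g y - g x) <= e.
Proof.
move=> dg x x0 e e0.
have [d d0 h] := half_line_deriv_approx dg x0 ltr01.
have N0 := nrm_ge0 (g' x); set N := nrm _ in N0.
exists (Num.min d (e / (N + 1))); first by rewrite lt_min d0 divr_gt0//; lra.
move=> y y0; rewrite lt_min => /andP[/(h y y0) + yd2].
rewrite mul1r => h1.
rewrite -[g y - g x](subrK ((y - x)%:C%C *: g' x)).
apply: le_trans (nrmD _ _) _; rewrite nrmZ cmod_real.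
apply: le_trans (lerD h1 (lexx _)) _; rewrite -/N.
have : `|y - x| * (N + 1) <= e by rewrite -ler_pdivlMr ?ltW//; lra.
by rewrite mulrDr mulr1 addrC.
Qed.

Lemma continuous_cmeasurable p q (g : R -> 'M[C]_(p, q)) :
  (forall x, 0 <= x -> forall e, 0 < e -> exists2 d : R, 0 < d &
    forall y, 0 <= y -> `|y - x| < d -> nrm (g y - g x) <= e) ->
  forall s t : R, 0 <= s -> forall i j, cmeasurable `[s, t] (fun y => g y i j).
Proof.
move=> cg s t s0 i j.
suff H (P : C -> R) : (forall z w, P z - P w = P (z - w)) -> (forall z, `|P z| <= cmod z) ->
    measurable_fun (`[s, t] : set R) (fun y => P (g y i j)).
  by split; apply: H; [by case=> a b [c d]|exact: Re_le_cmod|by case=> a b [c d]|exact: Im_le_cmod].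
move=> PB Ple.
(* Continuity is known on the half-line only; composing with [Num.max 0] extends the function
   continuously to the whole line. *)
have cP : continuous (fun y : R => P (g (Num.max 0 y) i j) : R).
  move=> x; apply/cvgrPdist_lt => e e0.
  have x0 : 0 <= Num.max 0 x by rewrite le_max lexx.
  have e20 : 0 < e / 2 by lra.
  have [d d0 h] := cg _ x0 _ e20.
  apply/nbhs_ballP; exists d => // y; rewrite /ball /= distrC => yx.
  have y0 : 0 <= Num.max 0 y by rewrite le_max lexx.
  have yxd : `|Num.max 0 y - Num.max 0 x| < d.
    apply: le_lt_trans yx; case: (leP 0 x); case: (leP 0 y) => h1 h2 //.
    - by rewrite !ler0_norm; lra.
    - by rewrite !ger0_norm; lra.
    - by rewrite subrr normr0.
  have := h _ y0 yxd; have := nrm_entry (g (Num.max 0 y) - g (Num.max 0 x)) i j.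
  rewrite distrC PB !mxE => h1 h2; apply: le_lt_trans (Ple _) _.
  apply: le_lt_trans h1 _; apply: le_lt_trans h2 _; lra.
have := continuous_measurable_fun cP.
move/(measurable_funS measurableT (@subsetT _ `[s, t])).
apply: eq_measurable_fun => y; rewrite inE /= in_itv /= => /andP[sy _].
by rewrite max_r// (le_trans s0).
Qed.

End HalfLineDerivative.

(** * The potential as an interval function *)

Section Potential.
Variables (R : realType) (n : nat) (Q : R -> 'M[R[i]]_n).
Local Notation C := R[i].
Local Notation nrm := (@cmxnorm R _ _).
Local Notation mu := (@lebesgue_measure R).

Hypothesis Qherm : forall t : R, 0 <= t -> adjmx (Q t) = Q t.
Hypothesis QRe : forall i j,
  measurable_fun (`[0%R, +oo[ : set R) (fun t : R => complex.Re (Q t i j)).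
Hypothesis QIm : forall i j,
  measurable_fun (`[0%R, +oo[ : set R) (fun t : R => complex.Im (Q t i j)).
Hypothesis Qint :
  (\int[lebesgue_measure]_(t in `[0%R, +oo[) ((1 + t) * cmxnorm (Q t))%:E < +oo)%E.

Lemma measurable_cmxnorm : measurable_fun (`[0%R, +oo[ : set R) (fun t : R => nrm (Q t)).
Proof.
apply: measurable_sum => i; apply: measurable_sum => j.
have : measurable_fun (`[0%R, +oo[ : set R)
    (Num.sqrt \o (fun t => complex.Re (Q t i j) ^+ 2 + complex.Im (Q t i j) ^+ 2)).
  apply: measurableT_comp; first by apply: continuous_measurable_fun; exact: sqrt_continuous.
  by apply: measurable_funD; apply: measurable_funX.
by apply: eq_measurable_fun => t _ /=; case: (Q t i j).
Qed.

Lemma integrable_cmxnorm : mu.-integrable `[0%R, +oo[ (EFin \o (fun t => nrm (Q t))).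
Proof.
have mD : @measurable _ (measurableTypeR R) `[0%R, +oo[ := measurable_itv _.
have mw : measurable_fun (`[0%R, +oo[ : set R) (fun t : R => (1 + t) * nrm (Q t)).
  apply: measurable_funM; last exact: measurable_cmxnorm.
  by apply: measurable_funD => //; exact: measurable_cst.
apply: (@le_integrable _ _ _ mu _ mD _ (EFin \o (fun t => (1 + t) * nrm (Q t)))).
- by apply/measurable_EFinP; exact: measurable_cmxnorm.
- move=> t /=; rewrite in_itv /= andbT => t0.
  rewrite lee_fin !ger0_norm ?mulr_ge0 ?nrm_ge0 ?addr_ge0//.
  by rewrite ler_peMl ?nrm_ge0// lerDl.
- apply/integrableP; split; first exact/measurable_EFinP.
  apply: le_lt_trans Qint; rewrite le_eqVlt; apply/orP; left; apply/eqP.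
  apply: eq_integral => t; rewrite inE /= in_itv /= andbT => t0.
  by rewrite ger0_norm ?mulr_ge0 ?nrm_ge0 ?addr_ge0//.
Qed.

(* The factor absorbs the constants comparing the entrywise norm of an
   integral with the integral of the norm. *)
Definition qmass (x : R) : R := (2 * (n * n)%:R + 1) * Rintegral mu `[0, x] (fun t => nrm (Q t)).
Definition qmassoo : R := (2 * (n * n)%:R + 1) * Rintegral mu `[0, +oo[ (fun t => nrm (Q t)).

Let kn_ge1 : 1 <= 2 * (n * n)%:R + 1 :> R.
Proof. by rewrite lerDr mulr_ge0. Qed.

Lemma integrable_cmxnorm_itv (s t : R) : 0 <= s ->
  mu.-integrable `[s, t] (EFin \o (fun t => nrm (Q t))).
Proof.
move=> s0; apply: integrableS integrable_cmxnorm; [exact: measurable_itv|exact: measurable_itv|].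
by apply: subset_itv; rewrite bnd_simp.
Qed.

Lemma qmassB s t : 0 <= s -> s <= t ->
  qmass t - qmass s = (2 * (n * n)%:R + 1) * Rintegral mu `[s, t] (fun t => nrm (Q t)).
Proof.
move=> s0 st; rewrite /qmass -mulrBr Rintegral_itvB ?bnd_simp//; last exact: integrable_cmxnorm_itv.
rewrite Rintegral_itv_obnd_cbnd//.
apply: integrableS (integrable_cmxnorm_itv t s0); [exact: measurable_itv|exact: measurable_itv|].
by apply: subset_itv; rewrite bnd_simp.
Qed.

Lemma qmass_le s t : 0 <= s -> s <= t -> qmass s <= qmass t.
Proof.
move=> s0 st; rewrite -subr_ge0 qmassB// mulr_ge0 ?(le_trans _ kn_ge1)//.
by apply: Rintegral_ge0 => x _; exact: nrm_ge0.
Qed.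

Lemma qmass_ge0 x : 0 <= qmass x.
Proof.
rewrite /qmass mulr_ge0 ?(le_trans _ kn_ge1)//.
by apply: Rintegral_ge0 => y _; exact: nrm_ge0.
Qed.

Lemma qmass_leoo x : 0 <= x -> qmass x <= qmassoo.
Proof.
move=> x0; rewrite /qmass /qmassoo ler_wpM2l ?(le_trans _ kn_ge1)//.
rewrite -subr_ge0 Rintegral_itvB ?bnd_simp//; last exact: integrable_cmxnorm.
by apply: Rintegral_ge0 => y _; exact: nrm_ge0.
Qed.

(** This is absolute continuity of the integral of |Q|, applied to the extension of |Q| by zero. *)
Lemma qmass_cont x e : 0 <= x -> 0 < e ->
  \forall p \near straddles x, qmass p.2 - qmass p.1 < e.
Proof.
move=> x0 e0.
pose f := (fun t => nrm (Q t)) \_ `[0, +oo[.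
have fi : mu.-integrable setT (EFin \o f).
  have := integrable_cmxnorm; rewrite integrable_mkcond//.
  by rewrite restrict_EFin.
have k0 : 0 < 2 * (n * n)%:R + 1 :> R by apply: lt_le_trans kn_ge1.
have e'0 : 0 < e / (2 * (n * n)%:R + 1) by rewrite divr_gt0.
have [d [d0 h]] := integral_normr_continuous fi e'0.
apply/(@near_straddlesP _ x (fun s t => qmass t - qmass s < e)); exists (d / 2); first lra.
move=> s t s0 sx xt sd td; have st := le_trans sx xt.
rewrite qmassB// mulrC -ltr_pdivlMr//.
apply: le_lt_trans (h `[s, t] _ _).
- rewrite le_eqVlt; apply/orP; left; apply/eqP; apply: eq_Rintegral => y.
  rewrite inE /= in_itv /= => /andP[sy _].
  by rewrite /f patchE mem_set /= ?in_itv /= ?andbT ?(le_trans s0)// ger0_norm ?nrm_ge0.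
- exact: measurable_itv.
- rewrite [X in (X < _)%E]lebesgue_measure_itv /=; case: ifP => _; rewrite lte_fin; lra.
Qed.

Definition qgauge (x : R) : R := x + qmass x.

Lemma qgaugeP : gauge qgauge.
Proof.
split=> [x x0 e e0|s t s0 st]; last by have := qmass_le s0 st; rewrite /qgauge; lra.
have e20 : 0 < e / 2 by lra.
have near_len : \forall p \near straddles x, p.2 - p.1 < e / 2.
  apply/(@near_straddlesP _ x (fun s t => t - s < e / 2)); exists (e / 4); first lra.
  by move=> s t *; lra.
by apply: filterS2 near_len (qmass_cont x0 e20) => -[s t] /=; rewrite /qgauge; lra.
Qed.

Definition qinc (s t : R) : 'M[C]_n := mxint s t Q.

Lemma cintegrable_entry (s t : R) i j : 0 <= s -> cintegrable `[s, t] (fun t => Q t i j).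
Proof.
move=> s0; have mD : @measurable _ (measurableTypeR R) `[s, t] := measurable_itv _.
have sub : (`[s, t] : set R) `<=` `[0, +oo[ by apply: subset_itv; rewrite bnd_simp.
split; apply: (le_integrable mD _ _ (integrable_cmxnorm_itv t s0)).
- apply/measurable_EFinP; apply: measurable_funS sub (QRe i j); exact: measurable_itv.
- move=> y _ /=; rewrite lee_fin [leRHS]ger0_norm ?nrm_ge0//.
  by apply: le_trans (Re_le_cmod _) (nrm_entry _ _ _).
- apply/measurable_EFinP; apply: measurable_funS sub (QIm i j); exact: measurable_itv.
- move=> y _ /=; rewrite lee_fin [leRHS]ger0_norm ?nrm_ge0//.
  by apply: le_trans (Im_le_cmod _) (nrm_entry _ _ _).
Qed.

Lemma qinc_adj s t : 0 <= s -> adjmx (qinc s t) = qinc s t.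
Proof.
move=> s0; apply/matrixP => i j; rewrite !mxE; symmetry.
rewrite -[RHS](cint_conj (cintegrable_entry t j i s0)); apply: eq_cint => y /andP[sy _].
by rewrite -[in LHS]Qherm ?(le_trans s0)// !mxE.
Qed.

Lemma nrm_qinc s t : 0 <= s -> s <= t -> nrm (qinc s t) <= qmass t - qmass s.
Proof.
move=> s0 st; rewrite qmassB//.
have I0 : 0 <= Rintegral mu `[s, t] (fun t => nrm (Q t)).
  by apply: Rintegral_ge0 => x _; exact: nrm_ge0.
apply: (@le_trans _ _ ((n * n)%:R * (2 * Rintegral mu `[s, t] (fun t => nrm (Q t))))).
  apply: nrm_le_sum => i j; rewrite mxE; apply: cmod_cint.
  - exact: cintegrable_entry.
  - exact: integrable_cmxnorm_itv.
  - by move=> y _; exact: nrm_entry.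
rewrite mulrA; apply: ler_wpM2r => //; rewrite mulrC; lra.
Qed.

(** The increment of f' is the integral of (Q - z) f. Freezing f at x costs the oscillation of f, at
    most e near x, times the integral of |Q| + |z|, which is of the order of the gauge increment. *)
Lemma solves_half_ider q (z : C) (f f' : R -> 'M[C]_(n, q)) x :
  solves_half Q z f f' -> 0 <= x ->
  ider qgauge f (fun s t => (t - s)%:C%C *: f' x) x /\
  ider qgauge f' (fun s t => qinc s t *m f x - (t - s)%:C%C *: (z *: f x)) x.
Proof.
move=> [df f'E] x0; split.
  by apply: (ider_classical qgaugeP) => //; exact: half_line_deriv_approx.
have cf := half_line_deriv_cont df.
pose Z := nrm (z%:M : 'M[C]_n).
have Z0 : 0 <= Z by exact: nrm_ge0.
have gauge_bounds s t : 0 <= s -> s <= t ->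
    t - s <= qgauge t - qgauge s /\ qmass t - qmass s <= qgauge t - qgauge s.
  by move=> s0 st; have := qmass_le s0 st; rewrite /qgauge; lra.
(* The factor n * q counts entries, 2 comes from [cmod_cint], and 1 + Z bounds the integral of |Q| +
   Z by the gauge increment. *)
apply: (@ider_suff _ _ qgaugeP _ _ _ _ _ ((n * q)%:R * (2 * (1 + Z)))).
- exists ((1 + cmod z) * nrm (f x)).
  apply: filterS (near_straddles_order x) => -[s t] /= [s0 /andP[sx xt]].
  have st := le_trans sx xt; have [g1 g2] := gauge_bounds s t s0 st.
  apply: le_trans (nrmD _ _) _; rewrite nrmN !nrmZ cmod_real ger0_norm ?subr_ge0//.
  have N0 := nrm_ge0 (f x).
  rewrite [leRHS](_ : _ = (qgauge t - qgauge s) * nrm (f x) +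
      (qgauge t - qgauge s) * (cmod z * nrm (f x))); last first.
    by rewrite mulrC -mulrDr; congr (_ * _); rewrite mulrDl mul1r.
  apply: lerD.
    apply: le_trans (nrmM _ _) _; apply: ler_wpM2r => //.
    exact: le_trans (nrm_qinc s0 st) g2.
  by apply: ler_wpM2r => //; rewrite mulr_ge0// cmod_ge0.
- by rewrite !mulr_ge0// addr_ge0.
move=> e e0; have [d d0 h] := cf x x0 e e0.
apply/(@near_straddlesP _ x (fun s t => nrm (f' t - f' s -
   (qinc s t *m f x - (t - s)%:C%C *: (z *: f x))) <=
   (n * q)%:R * (2 * (1 + Z)) * e * (qgauge t - qgauge s))); exists d => //.
move=> s t s0 sx xt sd td; have st := le_trans sx xt.
have [g1 g2] := gauge_bounds s t s0 st.
have mD : @measurable _ (measurableTypeR R) `[s, t] := measurable_itv _.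
rewrite f'E// -!mulrA; apply: nrm_le_sum => i j.
pose A (y : R) := Q y - z%:M.
have Ai l : cintegrable `[s, t] (fun y => A y i l).
  rewrite (_ : (fun y => A y i l) = fun y => Q y i l + (- (z%:M i l))).
    apply: cintegrableD => //; [exact: cintegrable_entry|exact: cintegrable_cst].
  by apply/funext => y; rewrite /A !mxE.
have near_x y : s <= y <= t -> nrm (f y - f x) <= e.
  move=> /andP[sy yt]; apply: h; first exact: le_trans sy.
  by rewrite ltr_norml; apply/andP; split; lra.
have gl_meas l : cmeasurable `[s, t] (fun y => (f y - f x) l j).
  apply: (@continuous_cmeasurable _ _ _ (fun y => f y - f x)) => // x1 x10 e1 e10.
  have [d1 d10 h1] := cf x1 x10 e1 e10; exists d1 => // y y0 yd.
  rewrite (_ : f y - f x - (f x1 - f x) = f y - f x1); first exact: h1.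
  by rewrite opprB addrA subrK.
have Di l : cintegrable `[s, t] (fun y => A y i l * (f y - f x) l j).
  apply: (@cintegrableM _ _ _ _ e) => // y; rewrite /= in_itv /= => /near_x.
  exact: le_trans (nrm_entry _ _ _).
have Ki l : cintegrable `[s, t] (fun y => A y i l * f x l j).
  apply: (@cintegrableM _ _ _ _ (cmod (f x l j))) => //.
have -> : (mxint s t (fun t0 => (Q t0 - z%:M) *m f t0) -
     (qinc s t *m f x - (t - s)%:C%C *: (z *: f x))) i j =
   cint s t (fun y => \sum_l A y i l * (f y - f x) l j).
  rewrite !mxE.
  have -> : cint s t (fun y => ((Q y - z%:M) *m f y) i j) =
      cint s t (fun y => (\sum_l A y i l * f x l j) + (\sum_l A y i l * (f y - f x) l j)).
    apply: eq_cint => y _; rewrite mxE -big_split; apply: eq_bigr => l _ /=.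
    by rewrite -mulrDr; congr (_ * _); rewrite ![in RHS]mxE [RHS]addrC subrK.
  rewrite cintD; [|exact: cintegrable_sum..].
  rewrite cint_sum//.
  rewrite (eq_bigr (fun l => qinc s t i l * f x l j - (t - s)%:C%C * (z%:M i l * f x l j))).
    rewrite sumrB -mulr_sumr.
    have -> : \sum_l z%:M i l * f x l j = z * f x i j.
      have := congr1 (fun M : 'M[C]_(n, q) => M i j) (mul_scalar_mx z (f x)).
      by rewrite !mxE.
    by rewrite addrAC subrr add0r.
  move=> l _; rewrite cintMr//.
  rewrite (_ : (fun y => A y i l) = fun y => Q y i l + (- (z%:M i l))); last first.
    by apply/funext => y; rewrite /A !mxE.
  rewrite cintD; [|exact: cintegrable_entry|exact: cintegrable_cst].
  by rewrite cint_cst// mulrDl mulrN mulNr !mulrA [in RHS]mxE.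
have Bi : mu.-integrable `[s, t] (EFin \o (fun y => (nrm (Q y) + Z) * e)).
  have mZ : mu.-integrable `[s, t] (EFin \o cst Z) by case: (cintegrable_cst s t (Z%:C%C)).
  have := integrableZl mD e (integrableD mD (integrable_cmxnorm_itv t s0) mZ).
  congr (mu.-integrable _ _); apply/funext => y /=.
  by rewrite -EFinD -EFinM mulrC.
apply: le_trans (cmod_cint (cintegrable_sum _ _ Di) Bi _) _ => //.
  move=> y yst.
  have -> : \sum_l A y i l * (f y - f x) l j = (A y *m (f y - f x)) i j by rewrite mxE.
  apply: le_trans (nrm_entry _ _ _) _; apply: le_trans (nrmM _ _) _.
  apply: ler_pM; rewrite ?nrm_ge0//; last exact: near_x.
  by apply: le_trans (nrmD _ _) _; rewrite nrmN.
rewrite ler_wpM2l//.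
have mZ : mu.-integrable `[s, t] (EFin \o cst Z) by case: (cintegrable_cst s t (Z%:C%C)).
have Bi' : mu.-integrable `[s, t] (EFin \o (fun y => nrm (Q y) + Z)).
  have := integrableD mD (integrable_cmxnorm_itv t s0) mZ.
  by congr (mu.-integrable _ _); apply/funext => y /=; rewrite EFinD.
rewrite RintegralZr// RintegralD//; last exact: integrable_cmxnorm_itv.
rewrite Rintegral_cst//.
have -> : fine (mu `[s, t]) = t - s.
  rewrite lebesgue_measure_itv /= lte_fin; case: ltP => //= ts.
  have -> : s = t by apply/le_anti; rewrite st ts.
  by rewrite subrr.
rewrite [leRHS]mulrCA mulrC; apply: ler_wpM2l; first exact: ltW.
rewrite mulrDl mul1r; apply: lerD; last exact: ler_wpM2l.
apply: le_trans g2; rewrite qmassB//; rewrite ler_peMl//.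
by apply: Rintegral_ge0 => y _; exact: nrm_ge0.
Qed.

End Potential.

(** * Complex exponentials *)

Section ComplexExponential.
Variable R : realType.
Local Notation C := R[i].
Local Notation nrm := (@cmxnorm R _ _).

Lemma cexpiD (k l : C) (x : R) : cexpi (k + l) x = cexpi k x * cexpi l x.
Proof.
apply: complex_ext; rewrite ?ReM ?ImM /= !(ReD, ImD) opprD !mulrDl expRD ?cosD ?sinD; ring.
Qed.

Lemma cexpi0 (x : R) : cexpi 0 x = 1.
Proof. by apply: complex_ext; rewrite /= oppr0 !mul0r expR0 ?cos0 ?sin0 ?mulr1 ?mulr0. Qed.

Lemma cexpix0 (k : C) : cexpi k 0 = 1.
Proof. by apply: complex_ext; rewrite /= !mulr0 expR0 ?cos0 ?sin0 ?mulr1 ?mulr0. Qed.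

Lemma cexpixD (k : C) (x y : R) : cexpi k (x + y) = cexpi k x * cexpi k y.
Proof.
by apply: complex_ext; rewrite ?ReM ?ImM /= !mulrDr expRD ?cosD ?sinD; ring.
Qed.

Lemma cexpiNx (k : C) (x : R) : cexpi k (- x) = cexpi (- k) x.
Proof. by apply: complex_ext; case: k => a b /=; rewrite !(mulrN, mulNr). Qed.

Lemma cexpi2 (k : C) (x : R) : cexpi (2 * k) x = cexpi k (2 * x).
Proof. by rewrite !mulr_natl !mulr2n cexpiD cexpixD. Qed.

Lemma cmod_cexpi (k : C) (x : R) : cmod (cexpi k x) = expR (- complex.Im k * x).
Proof.
rewrite /= !exprMn -mulrDr cos2Dsin2 mulr1 sqrtr_sqr ger0_norm//.

Qed.

Variable nu : R -> R.
Hypothesis nuP : gauge nu.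

(** The increment is cut at x as in [ider_classical]; the scalar form lets explicit functions serve
    as bounds in mean value arguments. *)
Lemma is_derive_straddle (phi : R -> R) (x dphi : R) : 0 <= x ->
  is_derive x (1 : R) phi dphi -> forall e, 0 < e ->
  \forall st \near straddles x,
    `|phi st.2 - phi st.1 - (st.2 - st.1) * dphi| <= e * (nu st.2 - nu st.1).
Proof.
move=> x0 [dx <-] e e0.
have /cvgrPdist_le/(_ _ e0) : h^-1 *: ((phi \o shift x) (h *: (1 : R)) - phi x) @[h --> 0^'] -->
  'D_1 phi x by exact: dx.
rewrite /within /= => /nbhs_ballP[d /= d0 h].
have approx y : `|y - x| < d -> `|phi y - phi x - (y - x) * 'D_1 phi x| <= e * `|y - x|.
  move=> yx; have [->|yx0] := eqVneq y x.
    by rewrite !subrr mul0r subrr normr0 mulr0.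
  have yx1 : y - x != 0 by rewrite subr_eq0.
  have := h (y - x); rewrite /ball /= sub0r normrN => /(_ yx yx1).
  rewrite /GRing.scale /= mulr1 subrK distrC => h1.
  rewrite (_ : _ - _ - _ = (y - x) * ((y - x)^-1 * (phi y - phi x) - 'D_1 phi x)).
    by rewrite normrM mulrC ler_wpM2r.
  by rewrite mulrBr mulVKf.
apply/(@near_straddlesP _ x (fun s t => `|phi t - phi s - (t - s) * 'D_1 phi x| <= e * (nu t - nu s))).
exists d => // s t s0 sx xt sd td.
have h1 : `|s - x| = x - s by rewrite distrC ger0_norm ?subr_ge0.
have h2 : `|t - x| = t - x by rewrite ger0_norm ?subr_ge0.
have h3 : `|phi t - phi x - (t - x) * 'D_1 phi x| <= e * (t - x).
  by have := approx t; rewrite h2; apply; rewrite ltrBlDl.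
have h4 : `|phi s - phi x - (s - x) * 'D_1 phi x| <= e * (x - s).
  by have := approx s; rewrite h1; apply; rewrite ltrBlDr -ltrBlDl.
have -> : phi t - phi s - (t - s) * 'D_1 phi x =
   (phi t - phi x - (t - x) * 'D_1 phi x) - (phi s - phi x - (s - x) * 'D_1 phi x).
  by ring.
apply: le_trans (ler_normB _ _) _; apply: le_trans (lerD h3 h4) _.
by rewrite -mulrDr subrKA ler_pM2l//; case: nuP => _; apply => //; exact: le_trans xt.
Qed.

Lemma is_derive_expRM (a x : R) :
  is_derive x (1 : R) (fun y : R => expR (a * y)) (a * expR (a * x)).
Proof.
have h : is_derive x (1 : R) (fun y : R => a * y) a.
  by apply: is_derive_eq; rewrite /GRing.scale /= mulr1.
have := is_derive1_comp (is_derive_expR (a * x)) h.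
by rewrite mulrC.
Qed.

Lemma ider_cexpi n (k : C) x : 0 <= x ->
  ider nu (fun y => (cexpi k y)%:M : 'M[C]_n)
    (fun s t => (t - s)%:C%C *: ('i%C * k * cexpi k x)%:M) x.
Proof.
move=> x0.
set a := - complex.Im k; set b := complex.Re k.
pose re (y : R) := expR (a * y) * cos (b * y).
pose im (y : R) := expR (a * y) * sin (b * y).
have dlin (c : R) : is_derive x (1 : R) (fun y : R => c * y) c.
  by apply: is_derive_eq; rewrite /GRing.scale /= mulr1.
have dcos : is_derive x (1 : R) (fun y : R => cos (b * y)) (- (sin (b * x)) * b).
  exact: is_derive1_comp (is_derive_cos (b * x)) (dlin b).
have dsin : is_derive x (1 : R) (fun y : R => sin (b * y)) (cos (b * x) * b).
  exact: is_derive1_comp (is_derive_sin (b * x)) (dlin b).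
have dexp := is_derive_expRM a x.
have dre : is_derive x (1 : R) re (a * re x - b * im x).
  apply: (is_derive_eq (is_deriveM dexp dcos)).
  by rewrite /GRing.scale /= /re /im; ring.
have dim : is_derive x (1 : R) im (a * im x + b * re x).
  apply: (is_derive_eq (is_deriveM dexp dsin)).
  by rewrite /GRing.scale /= /re /im; ring.
(* The 2 stands for the real and imaginary parts of each entry. *)
apply: (@ider_suff _ _ nuP _ _ _ _ _ (2 * (n * n)%:R)).
- exists (nrm (('i%C * k * cexpi k x)%:M : 'M[C]_n)).
  apply: filterS (near_straddles_order x) => -[s t] /= [s0 /andP[sx xt]].
  have st := le_trans sx xt; rewrite nrmZ cmod_real ger0_norm ?subr_ge0// mulrC.
  by apply: ler_wpM2l; [exact: nrm_ge0|case: nuP => _; apply].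
- by rewrite mulr_ge0.
move=> e e0.
apply: filterS3 (near_straddles_order x) (is_derive_straddle x0 dre e0)
  (is_derive_straddle x0 dim e0) => -[s t] /= [s0 /andP[sx xt]] h1 h2.
have D0 : 0 <= nu t - nu s by apply: gauge_ge0 => //; exact: le_trans xt.
rewrite [2 * _]mulrC -!mulrA; apply: nrm_le_sum => i j; rewrite !mxE.
case: eqP => _; last first.
  by rewrite mulr0 !mulr0n !subr0 /= !expr0n addr0 sqrtr0 !mulr_ge0// ltW.
rewrite !mulr1n mulrDl mul1r; apply: le_trans (cmod_le _) _; apply: lerD.
  apply: le_trans h1; rewrite le_eqVlt; apply/orP; left; apply/eqP; congr (`|_|).
  by rewrite /re /im /a /b; case: (k) => u v /=; ring.
apply: le_trans h2; rewrite le_eqVlt; apply/orP; left; apply/eqP; congr (`|_|).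
by rewrite /re /im /a /b; case: (k) => u v /=; ring.
Qed.

End ComplexExponential.

Section ExponentialDifference.
Variable R : realType.
Local Notation C := R[i].
Local Notation nrm := (@cmxnorm R _ _).

Lemma gauge_id : gauge (fun x : R => x).
Proof.
split=> // x x0 e e0; apply/(@near_straddlesP _ x (fun s t => t - s < e)).
by exists (e / 2); [lra|move=> s t *; lra].
Qed.

Lemma cmxnorm_scalar1 (z : C) : nrm (z%:M : 'M[C]_1) = cmod z.
Proof. by rewrite /cmxnorm !big_ord1 mxE eqxx mulr1n. Qed.

Lemma cmod_i : cmod ('i%C : C) = 1.
Proof. by rewrite /= expr0n expr1n add0r sqrtr1. Qed.

(** The derivative i d e^{idy} has modulus at most |d| e^{|d|y}, the derivative of e^{|d|y}; the
    mean value inequality applies to 1 x 1 matrices with the identity gauge. *)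
Lemma cmod_cexpi_sub1 (d : C) (x : R) : 0 <= x ->
  cmod (cexpi d x - 1) <= expR (cmod d * x) - 1.
Proof.
move=> x0.
have h : nrm ((cexpi d x)%:M - (cexpi d 0)%:M : 'M[C]_1) <=
    expR (cmod d * x) - expR (cmod d * 0).
  apply: (ider_mean_value gauge_id (P := fun y => (cexpi d y)%:M)
    (phi := fun y => expR (cmod d * y)) (lexx _) x0) => y /andP[y0 yx].
  exists (fun s t => (t - s)%:C%C *: ('i%C * d * cexpi d y)%:M).
    exact: ider_cexpi gauge_id _ _ _ y0.
  move=> e e0.
  apply: filterS2 (near_straddles_order y)
    (is_derive_straddle gauge_id y0 (is_derive_expRM (cmod d) y) e0).
  move=> -[s t] /= [s0 /andP[sy yt]]; rewrite ler_norml => /andP[h _].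
  rewrite nrmZ cmod_real ger0_norm ?subr_ge0 ?(le_trans sy)// cmxnorm_scalar1.
  rewrite 2!cmodM cmod_i mul1r cmod_cexpi.
  apply: (@le_trans _ _ ((t - s) * (cmod d * expR (cmod d * y)))).
    rewrite ler_wpM2l ?subr_ge0 ?(le_trans sy)// ler_wpM2l ?cmod_ge0//.
    rewrite ler_expR ler_wpM2r// (le_trans _ (Im_le_cmod d))//.
    by rewrite -normrN ler_norm.
  move: h; set a := (t - s) * _; set b := e * _; lra.
by move: h; rewrite cexpix0 mulr0 expR0 -raddfB /= cmxnorm_scalar1.
Qed.

(** With d = |k - l| and K = Im l, factoring out e^{ilx} leaves at most d x e^{dx}, where d <= K / 4
    and x <= (4 / K) e^{Kx/4}. The exponents - K + K / 4 + K / 4 add up to - K / 2. *)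
Lemma cmod_cexpiB (k l : C) (x : R) : 0 < complex.Im l ->
  cmod (k - l) <= complex.Im l / 4 -> 0 <= x ->
  cmod (cexpi k x - cexpi l x) <=
    4 / complex.Im l * cmod (k - l) * expR (- (complex.Im l / 2) * x).
Proof.
move=> kp kl x0.
have -> : cexpi k x - cexpi l x = cexpi l x * (cexpi (k - l) x - 1).
  by rewrite mulrBr mulr1 -cexpiD [l + _]addrC subrK.
rewrite cmodM cmod_cexpi.
apply: le_trans (ler_wpM2l (expR_ge0 _) (cmod_cexpi_sub1 (k - l) x0)) _.
have d0 := cmod_ge0 (k - l).
set d := cmod (k - l) in kl d0 *; set K := complex.Im l in kp kl *.
have e1 : expR (d * x) - 1 <= d * x * expR (d * x).
  have := expR_ge1Dx (- (d * x)).
  rewrite -(ler_pM2r (expR_gt0 (d * x))) -expRD addNr expR0 => h; lra.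
have e2 : K / 4 * x <= expR (K / 4 * x).
  by apply: le_trans (expR_ge1Dx _); rewrite lerDr.
have e3 : x <= 4 / K * expR (K / 4 * x).
  apply: (@le_trans _ _ (4 / K * (K / 4 * x))); last by rewrite ler_pM2l ?divr_gt0.
  by rewrite mulrA mulrA divfK ?gt_eqF// divff// mul1r.
apply: le_trans (ler_wpM2l (expR_ge0 _) e1) _.
have -> : expR (- K * x) * (d * x * expR (d * x)) = d * (x * expR (- K * x + d * x)).
  by rewrite expRD; ring.
rewrite [4 / K * d]mulrC -(mulrA d); apply: ler_wpM2l => //.
apply: le_trans (ler_wpM2r (expR_ge0 _) e3) _.
rewrite -(mulrA (4 / K)) -expRD; apply: ler_wpM2l; first by rewrite divr_ge0// ltW.
rewrite ler_expR.
have : d * x <= K / 4 * x by exact: ler_wpM2r.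
set y := d * x; lra.
Qed.

End ExponentialDifference.

(** * A priori bounds on the half-line *)

Section IncrementalSolutions.
Variables (R : realType) (n : nat).
Local Notation C := R[i].
Local Notation nrm := (@cmxnorm R _ _).
Variable nu : R -> R.
Hypothesis nuP : gauge nu.

Lemma ider_cexpiZ q (l : C) (P : R -> 'M[C]_(n, q)) L x : 0 <= x -> ider nu P L x ->
  ider nu (fun y => cexpi l y *: P y)
    (fun s t => (t - s)%:C%C *: (('i%C * l * cexpi l x) *: P x) + cexpi l x *: L s t) x.
Proof.
move=> x0 dP; have := iderM nuP x0 (ider_cexpi nuP n l x0) dP.
have -> : (fun y => (cexpi l y)%:M *m P y) = (fun y => cexpi l y *: P y).
  by apply/funext => y; rewrite mul_scalar_mx.
by apply: ider_ext => s t; rewrite -scalemxAl !mul_scalar_mx.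
Qed.

(** An incremental derivative gives continuity, so the extreme value theorem covers the compact
    interval left over by the bound near infinity. *)
Lemma ider_bounded p q (P : R -> 'M[C]_(p, q)) :
  (forall x, 0 <= x -> exists L, ider nu P L x) ->
  (exists X B, forall x, X <= x -> nrm (P x) <= B) ->
  exists2 M, 0 <= M & forall x, 0 <= x -> nrm (P x) <= M.
Proof.
move=> dP [X [B hB]].
have cP : continuous (fun y : R => nrm (P (Num.max 0 y)) : R).
  move=> x; apply/cvgrPdist_le => e e0.
  have x0 : 0 <= Num.max 0 x by rewrite le_max lexx.
  have [L dL] := dP _ x0.
  have [K K0 lip] := ider_lipschitz nuP dL.
  have e'0 : 0 < e / (K + 1) by rewrite divr_gt0//; lra.
  case: (nuP) => /(_ _ x0 _ e'0) cnu _.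
  have small : \forall st \near straddles (Num.max 0 x), nrm (P st.2 - P st.1) <= e.
    apply: filterS2 lip cnu => -[s t] /= [h1 _] h2; apply: le_trans h1 _.
    have : (K + 1) * (nu t - nu s) <= e by rewrite mulrC -ler_pdivlMr ?ltW//; lra.
    have : K * (nu t - nu s) <= K * (e / (K + 1)) by rewrite ler_wpM2l// ltW.
    have : K * (e / (K + 1)) <= e by rewrite mulrCA ger_pMr// ler_pdivrMr ?mul1r; lra.
    lra.
  have [d d0 h] := (near_straddlesP (Num.max 0 x) (fun s t => nrm (P t - P s) <= e)).1 small.
  apply/nbhs_ballP; exists d => // y; rewrite /ball /= => yx.
  have y0 : 0 <= Num.max 0 y by rewrite le_max lexx.
  have yxd : `|Num.max 0 x - Num.max 0 y| < d.
    apply: le_lt_trans yx; case: (leP 0 x) => h1; case: (leP 0 y) => h2 //.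
    - by rewrite !ger0_norm; lra.
    - by rewrite !ler0_norm; lra.
    - by rewrite subrr normr0.
  have bd : nrm (P (Num.max 0 x) - P (Num.max 0 y)) <= e.
    case: (leP (Num.max 0 y) (Num.max 0 x)) => yx'; [|rewrite nrmBC]; apply: h => //;
      move: yxd; rewrite ltr_norml => /andP[]; lra.
  apply: le_trans bd.
  have t1 := nrmD (P (Num.max 0 x) - P (Num.max 0 y)) (P (Num.max 0 y)).
  have t2 := nrmD (P (Num.max 0 y) - P (Num.max 0 x)) (P (Num.max 0 x)).
  rewrite subrK in t1; rewrite subrK nrmBC in t2.
  move: t1 t2; set a := nrm _; set b := nrm (_ - _); set c := nrm _ => t1 t2.
  by rewrite ler_norml; apply/andP; split; lra.
pose X' := Num.max 0 X.
have X'0 : 0 <= X' by rewrite le_max lexx.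
have [c _ hc] := EVT_max X'0 (continuous_subspaceT cP).
exists (Num.max (Num.max B 0) (nrm (P (Num.max 0 c)))); first by rewrite !le_max lexx orbT.
move=> x x0; case: (leP x X') => xX; rewrite !le_max.
  by apply/orP; right; have := hc x; rewrite in_itv /= x0 xX max_r// => /(_ isT).
by rewrite hB//; apply: ltW; move: xX; rewrite gt_max => /andP[].
Qed.

End IncrementalSolutions.

Section Adjoint.
Variable R : realType.
Local Notation C := R[i].

Lemma adjmxB p q (A B : 'M[C]_(p, q)) : adjmx (A - B) = adjmx A - adjmx B.
Proof. by apply/matrixP => i j; rewrite !mxE rmorphB. Qed.

Lemma adjmxD p q (A B : 'M[C]_(p, q)) : adjmx (A + B) = adjmx A + adjmx B.
Proof. by apply/matrixP => i j; rewrite !mxE rmorphD. Qed.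

Lemma adjmxZ p q (a : C) (A : 'M[C]_(p, q)) : adjmx (a *: A) = conjc a *: adjmx A.
Proof. by apply/matrixP => i j; rewrite !mxE rmorphM. Qed.

Lemma adjmxM p q r (A : 'M[C]_(p, q)) (B : 'M[C]_(q, r)) :
  adjmx (A *m B) = adjmx B *m adjmx A.
Proof.
apply/matrixP => i j; rewrite !mxE rmorph_sum; apply: eq_bigr => l _.
by rewrite !mxE rmorphM mulrC.
Qed.

Lemma adjmxK p q (A : 'M[C]_(p, q)) : adjmx (adjmx A) = A.
Proof. by apply/matrixP => i j; rewrite !mxE; case: (A i j) => a b /=; rewrite opprK. Qed.

(** Interval functions matter on straddling pairs only; this admits identities such as the
    selfadjointness of [qinc], which holds for 0 <= s. *)
Lemma ider_near_ext (nu : R -> R) p q (P : R -> 'M[C]_(p, q)) L L' (x : R) :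
  (\forall st \near straddles x, L st.1 st.2 = L' st.1 st.2) -> ider nu P L x -> ider nu P L' x.
Proof.
move=> LL' [[K bL] dL]; split; first by exists K; apply: filterS2 LL' bL => st ->.
by move=> e /dL; apply: filterS2 LL' => st ->.
Qed.

Lemma Re_gram_ge n (y : 'cV[C]_n) i :
  cmod (y i 0) ^+ 2 <= complex.Re ((adjmx y *m y) 0 0).
Proof.
have -> : complex.Re ((adjmx y *m y) 0 0) = \sum_j cmod (y j 0) ^+ 2.
  rewrite mxE (big_morph (@complex.Re R) (@ReD R) (erefl _)); apply: eq_bigr => j _.
  by rewrite cmod_sqr !mxE; case: (y j 0) => a b /=; ring.
by rewrite (bigD1 i)//= lerDl sumr_ge0// => j _; rewrite sqr_ge0.
Qed.

Lemma Re_entryB_le (A B D : 'M[C]_1) :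
  complex.Re (A 0 0) - complex.Re (B 0 0) - complex.Re (D 0 0) <= cmxnorm (A - B - D).
Proof.
apply: le_trans (nrm_entry _ 0 0); apply: le_trans (Re_le_cmod _).
apply: le_trans (ler_norm _); rewrite !mxE.
by case: (A 0 0) (B 0 0) (D 0 0) => x1 y1 [x2 y2] [x3 y3].
Qed.

End Adjoint.

(** * Jost solutions and their dependence on the spectral parameter *)

Section JostSolution.
Variables (R : realType) (n : nat).
Local Notation C := R[i].
Local Notation nrm := (@cmxnorm R _ _).
Variables (nu qm : R -> R) (qB : R) (qinc : R -> R -> 'M[C]_n).
Hypothesis nuP : gauge nu.
Hypothesis qm_le : forall s t, 0 <= s -> s <= t -> qm s <= qm t.
Hypothesis qm_ge0 : forall x, 0 <= qm x.
Hypothesis qm_bd : forall x, 0 <= x -> qm x <= qB.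
Hypothesis qm_nu : forall s t, 0 <= s -> s <= t -> qm t - qm s <= nu t - nu s.
Hypothesis qinc_le : forall s t, 0 <= s -> s <= t -> nrm (qinc s t) <= qm t - qm s.

(** The total mass, taken as a supremum so that smallness of the tails of the monotone [qm] is
    immediate. *)
Definition qoo := sup [set qm x | x in [set x | 0 <= x]].

Let qrange_sup : has_sup [set qm x | x in [set x | 0 <= x]].
Proof.
split; first by exists (qm 0); exists 0 => //=.
by exists qB => _ [x /= x0 <-]; exact: qm_bd.
Qed.

Lemma qm_leoo x : 0 <= x -> qm x <= qoo.
Proof. by move=> x0; apply: ub_le_sup; [case: qrange_sup|exists x]. Qed.

Lemma qoo_ge0 : 0 <= qoo.
Proof. exact: le_trans (qm_ge0 0) (qm_leoo (lexx 0)). Qed.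

Lemma qm_tail e : 0 < e -> exists2 X, 0 <= X & forall x, X <= x -> qoo - qm x <= e.
Proof.
move=> e0; have [_ [X /= X0 <-] h] := sup_adherent e0 qrange_sup.
by exists X => // x /(qm_le X0); rewrite -/qoo in h; lra.
Qed.

Lemma ider_qm_bound p q (P : R -> 'M[C]_(p, q)) a b B : 0 <= a -> a <= b ->
  (forall x, a <= x -> x <= b -> exists2 L, ider nu P L x &
    \forall st \near straddles x, nrm (L st.1 st.2) <= B * (qm st.2 - qm st.1)) ->
  nrm (P b - P a) <= B * (qm b - qm a).
Proof.
move=> a0 ab h; rewrite mulrBr.
apply: (ider_mean_value nuP (phi := fun x => B * qm x) a0 ab) => x /andP[ax xb].
have [L dL bL] := h x ax xb; exists L => // e e0.
apply: filterS2 (near_straddles_order x) bL => -[s t] /= [s0 /andP[sx xt]] /le_trans; apply.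
by rewrite mulrBr lerDl mulr_ge0 ?(ltW e0)// gauge_ge0// (le_trans sx).
Qed.

(** The Jost property in incremental form; from here on the potential is present only through [qinc]
    and its mass [qm]. *)
Definition jost (k : C) (f f' : R -> 'M[C]_n) : Prop :=
  [/\ 0 < complex.Im k,
    forall x, 0 <= x -> ider nu f (fun s t => (t - s)%:C%C *: f' x) x,
    forall x, 0 <= x ->
      ider nu f' (fun s t => qinc s t *m f x - (t - s)%:C%C *: (k ^+ 2 *: f x)) x &
    forall e, 0 < e -> exists X, forall x, X <= x ->
      nrm (cexpi (- k) x *: f x - 1%:M) <= e].

Definition jnorm (k : C) (f : R -> 'M[C]_n) x := cexpi (- k) x *: f x.

(* f' - i l f is, up to the potential, an eigenfunction of d/dx when
   l ^+ 2 = k ^+ 2; multiplying by e^{ilx} leaves only the potential term. *)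
Definition jfactor (l : C) (f f' : R -> 'M[C]_n) x :=
  cexpi l x *: (f' x - ('i%C * l) *: f x).

(** * Asymptotics of a single Jost solution *)

Section Single.
Variables (k : C) (f f' : R -> 'M[C]_n).
Hypothesis J : jost k f f'.
Local Notation m := (jnorm k f).
Local Notation gam := (jfactor k f f').
Local Notation sig := (jfactor (- k) f f').
Local Notation K := (complex.Im k).

Lemma cexpiNK x : cexpi k x * cexpi (- k) x = 1.
Proof. by rewrite -cexpiD subrr cexpi0. Qed.

Lemma jnormK x : f x = cexpi k x *: m x.
Proof. by rewrite /jnorm scalerA cexpiNK scale1r. Qed.

Lemma ider_jfactor l x : l ^+ 2 = k ^+ 2 -> 0 <= x ->
  ider nu (jfactor l f f') (fun s t => cexpi l x *: (qinc s t *m f x)) x.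
Proof.
move=> lk x0; case: J => _ df df' _.
have := ider_cexpiZ nuP l x0 (iderB nuP x0 (df' x x0) (iderZ nuP ('i%C * l) x0 (df x x0))).
apply: ider_ext => s t; rewrite -lk.
have i2 : 'i%C * 'i%C = -1 :> C by rewrite -expr2 sqr_i.
apply/matrixP => i j; rewrite !mxE; move: (\sum_(j0 < n) _) => S.
by ring: i2.
Qed.

Lemma jnorm_bounded : exists2 M, 0 <= M & forall x, 0 <= x -> nrm (m x) <= M.
Proof.
case: (J) => kp df _ lim; apply: (ider_bounded nuP).
  move=> x x0; eexists; exact: (ider_cexpiZ nuP (- k) x0 (df x x0)).
have [X h] := lim 1 ltr01; exists X, (1 + nrm (1%:M : 'M[C]_n)) => x /h h1.
rewrite -[m x](subrK 1%:M); apply: le_trans (nrmD _ _) _.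
by rewrite lerD2r.
Qed.

(** [jost] prescribes no behaviour of f' at infinity, and this identity recovers it: [sig] has
    bounded variation, hence is bounded, and then [gam] decays like e^{-2 Im k x}. *)
Lemma jfactor_pm x : gam x = cexpi (2 * k) x *: (sig x - (2 * 'i%C * k) *: m x).
Proof.
rewrite /jfactor /jnorm.
have -> : cexpi (2 * k) x = cexpi k x * cexpi k x by rewrite mulr_natl mulr2n cexpiD.
have h := cexpiNK x.
by apply/matrixP => i j; rewrite !mxE; ring: h.
Qed.

Section Bounds.
Variable M : R.
Hypothesis M0 : 0 <= M.
Hypothesis mM : forall x, 0 <= x -> nrm (m x) <= M.

Lemma jsig_incr a b : 0 <= a -> a <= b -> nrm (sig b - sig a) <= M * (qm b - qm a).
Proof.
move=> a0 ab; apply: ider_qm_bound => // x ax xb; have x0 := le_trans a0 ax.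
exists (fun s t => cexpi (- k) x *: (qinc s t *m f x)).
  by apply: ider_jfactor => //; rewrite sqrrN.
apply: filterS (near_straddles_order x) => -[s t] /= [s0 /andP[sx xt]].
rewrite scalemxAr -/(jnorm k f x); apply: le_trans (nrmM _ _) _; rewrite mulrC.
by apply: ler_pM; rewrite ?nrm_ge0 ?mM// qinc_le// (le_trans sx).
Qed.

Lemma jgam_incr a b : 0 <= a -> a <= b ->
  nrm (gam b - gam a) <= expR (- (2 * K) * a) * M * (qm b - qm a).
Proof.
move=> a0 ab; apply: ider_qm_bound => // x ax xb; have x0 := le_trans a0 ax.
exists (fun s t => cexpi k x *: (qinc s t *m f x)); first exact: ider_jfactor.
case: J => kp _ _ _.
apply: filterS (near_straddles_order x) => -[s t] /= [s0 /andP[sx xt]].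
rewrite jnormK -scalemxAr scalerA nrmZ cmodM cmod_cexpi -expRD.
rewrite -mulrA; apply: ler_pM; rewrite ?expR_ge0 ?nrm_ge0//.
  rewrite ler_expR.
  have : K * a <= K * x by rewrite ler_pM2l.
  by rewrite !mulNr; lra.
apply: le_trans (nrmM _ _) _; rewrite mulrC.
by apply: ler_pM; rewrite ?nrm_ge0 ?mM// qinc_le// (le_trans sx).
Qed.

Lemma jsig_bounded x : 0 <= x -> nrm (sig x) <= nrm (sig 0) + M * qoo.
Proof.
move=> x0; have h := jsig_incr (lexx 0) x0.
rewrite -[sig x](subrK (sig 0)); apply: le_trans (nrmD _ _) _.
rewrite addrC lerD2l; apply: le_trans h _; apply: ler_wpM2l => //.
by have := qm_leoo x0; have := qm_ge0 0; lra.
Qed.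

Lemma jgam_decay x : 0 <= x ->
  nrm (gam x) <= expR (- (2 * K) * x) * (nrm (sig 0) + M * qoo + cmod (2 * 'i%C * k) * M).
Proof.
move=> x0; rewrite jfactor_pm nrmZ cmod_cexpi.
have -> : complex.Im (2 * k) = 2 * K by rewrite !mulr_natl !mulr2n ImD.
rewrite ler_wpM2l ?expR_ge0//; apply: le_trans (nrmD _ _) _; apply: lerD.
  exact: jsig_bounded.
by rewrite nrmN nrmZ ler_wpM2l ?cmod_ge0 ?mM.
Qed.

Lemma expR_tail (c B : R) : 0 < c -> 0 <= B -> forall e, 0 < e ->
  exists2 X, 0 <= X & forall x, X <= x -> expR (- c * x) * B <= e.
Proof.
move=> c0 B0 e e0; have ce : 0 < c * e by rewrite mulr_gt0.
have X0 : 0 <= B / (c * e) by apply: divr_ge0 => //; exact: ltW.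
exists (B / (c * e)) => // x Xx.
have h := expR_ge1Dx (c * x).
have x0 := le_trans X0 Xx.
rewrite mulNr expRN mulrC ler_pdivrMr ?expR_gt0//.
move: Xx; rewrite ler_pdivrMr// => h1.
have : e * (1 + c * x) <= e * expR (c * x) by rewrite ler_pM2l.
by rewrite mulrDr mulr1 mulrA [e * c]mulrC mulrC [_ * x]mulrC; lra.
Qed.

Lemma jgam_lim e : 0 < e -> exists2 X, 0 <= X & forall x, X <= x -> nrm (gam x) <= e.
Proof.
move=> e0; case: (J) => kp _ _ _.
have B0 : 0 <= nrm (sig 0) + M * qoo + cmod (2 * 'i%C * k) * M.
  by rewrite !addr_ge0 ?mulr_ge0 ?nrm_ge0 ?qoo_ge0 ?cmod_ge0.
have k20 : 0 < 2 * K by rewrite mulr_gt0.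
have [X X0 h] := expR_tail k20 B0 e0.
by exists X => // x Xx; apply: le_trans (jgam_decay (le_trans X0 Xx)) (h _ Xx).
Qed.

(** Once [gam] is known to vanish at infinity, its variation over [x, +oo[ bounds it. This improves
    [jgam_decay] by the factor qoo - qm x, which tends to 0. *)
Lemma jgam_small x : 0 <= x -> nrm (gam x) <= expR (- (2 * K) * x) * M * (qoo - qm x).
Proof.
move=> x0; apply/ler_addgt0Pr => e e0.
have [X X0 h] := jgam_lim e0.
pose y := Num.max x X.
have xy : x <= y by rewrite le_max lexx.
have Xy : X <= y by rewrite le_max lexx orbT.
have h1 := jgam_incr x0 xy.
rewrite -[gam x](subrK (gam y)); apply: le_trans (nrmD _ _) _; rewrite nrmBC.
apply: lerD (h _ Xy); apply: le_trans h1 _; apply: ler_wpM2l.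
  by rewrite mulr_ge0 ?expR_ge0.
by have := qm_leoo (le_trans x0 xy); lra.
Qed.

(** By [jfactor_pm], [sig] is 2ik times the normalized solution plus e^{-2ikx} [gam]. The growth of
    the exponential exactly cancels the decay of [gam], and the tail factor of [jgam_small] still
    tends to 0. *)
Lemma jsig_lim e : 0 < e -> exists2 X, 0 <= X & forall x, X <= x ->
  nrm (sig x - (2 * 'i%C * k)%:M) <= e.
Proof.
move=> e0; case: (J) => kp _ _ lim.
have c0 := cmod_ge0 (2 * 'i%C * k); set c := cmod _ in c0.
have e1 : 0 < e / 2 / (c + 1) by rewrite !divr_gt0//; lra.
have e2 : 0 < e / 2 / (M + 1) by rewrite !divr_gt0// ltr_wpDl.
have [X1 h1] := lim _ e1; have [X2 X20 h2] := qm_tail e2.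
exists (Num.max X1 X2); first by rewrite le_max X20 orbT.
move=> x; rewrite ge_max => /andP[X1x X2x].
have x0 := le_trans X20 X2x.
have -> : sig x - (2 * 'i%C * k)%:M =
    (2 * 'i%C * k) *: (m x - 1%:M) + cexpi (- (2 * k)) x *: gam x.
  rewrite jfactor_pm scalerA -cexpiD addNr cexpi0 scale1r scalerBr scale_scalar_mx mulr1.
  by rewrite [RHS]addrC subrKA.
apply: le_trans (nrmD _ _) _.
rewrite [nrm ((2 * _ * _) *: _)]nrmZ [nrm (cexpi _ _ *: jfactor _ _ _ _)]nrmZ -/c.
have b1 : c * nrm (m x - 1%:M) <= e / 2.
  apply: le_trans (ler_wpM2l c0 (h1 _ X1x)) _.
  by rewrite mulrCA ger_pMr ?divr_gt0// ler_pdivrMr ?mul1r; lra.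
have b2 : cmod (cexpi (- (2 * k)) x) * nrm (gam x) <= e / 2.
  apply: le_trans (ler_wpM2l (cmod_ge0 _) (jgam_small x0)) _.
  rewrite cmod_cexpi !mulrA -expRD.
  have -> : - complex.Im (- (2 * k)) * x + - (2 * K) * x = 0.
    by case: (k) => u v /=; ring.
  rewrite expR0 mul1r; apply: le_trans (ler_wpM2l M0 (h2 _ X2x)) _.
  by rewrite mulrCA ger_pMr ?divr_gt0// ler_pdivrMr ?mul1r ?lerDl// ltr_wpDl.
by rewrite [e]splitr; exact: lerD b1 b2.
Qed.

Lemma jost_bound x : 0 <= x -> nrm (f x) <= expR (- K * x) * M.
Proof.
by move=> x0; rewrite jnormK nrmZ cmod_cexpi ler_wpM2l ?expR_ge0 ?mM.
Qed.

(** Here f' = e^{-ikx} [gam] + i k f, and the decay e^{-2 Im k x} of [gam] outweighs the growing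
    exponential. *)
Lemma jost_deriv_bound x : 0 <= x ->
  nrm (f' x) <= expR (- K * x) * (M * qoo + cmod ('i%C * k) * M).
Proof.
move=> x0.
have -> : f' x = cexpi (- k) x *: gam x + ('i%C * k) *: f x.
  by rewrite /jfactor scalerA mulrC cexpiNK scale1r subrK.
apply: le_trans (nrmD _ _) _; rewrite mulrDr; apply: lerD; last first.
  by rewrite nrmZ mulrCA; apply: ler_wpM2l; [exact: cmod_ge0|exact: jost_bound].
rewrite nrmZ; apply: le_trans (ler_wpM2l (cmod_ge0 _) (jgam_small x0)) _.
rewrite cmod_cexpi !mulrA -expRD.
have -> : - complex.Im (- k) * x + - (2 * K) * x = - K * x.
  by case: (k) => u v /=; ring.
apply: ler_wpM2l; first by rewrite mulr_ge0 ?expR_ge0.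
by have := qm_ge0 x; lra.
Qed.

End Bounds.
End Single.

(* As t -> oo this tends to 2ik, while at t = x it is 2ik times the normalized
   solution: its variation is the Volterra equation of the Jost solution. *)
Definition jtheta (k : C) f f' x t := jfactor (- k) f f' t - cexpi (- (2 * k)) x *: jfactor k f f' t.

Lemma jtheta_diag k f f' x : jtheta k f f' x x = (2 * 'i%C * k) *: jnorm k f x.
Proof.
by rewrite /jtheta [jfactor k _ _ _]jfactor_pm scalerA -cexpiD addNr cexpi0 scale1r subKr.
Qed.

(** The factor 1 - e^{2ik(t - x)} is the Volterra kernel: it vanishes at t = x and has modulus at
    most 2 for t >= x. *)
Lemma ider_jtheta k f f' x t : jost k f f' -> 0 <= t ->
  ider nu (jtheta k f f' x)
    (fun s1 t1 => (1 - cexpi (2 * k) (t - x)) *: (qinc s1 t1 *m jnorm k f t)) t.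
Proof.
move=> J t0.
have d1 := ider_jfactor J (sqrrN k) t0.
have d2 := iderZ nuP (cexpi (- (2 * k)) x) t0 (ider_jfactor J (erefl (k ^+ 2)) t0).
have := iderB nuP t0 d1 d2; apply: ider_ext => s1 t1.
have h1 : cexpi (- k) t * cexpi k t = 1 by rewrite mulrC cexpiNK.
have h2 : cexpi k t * cexpi k t = cexpi (2 * k) t by rewrite mulr_natl mulr2n cexpiD.
have h3 : cexpi (2 * k) (t - x) = cexpi (2 * k) t * cexpi (- (2 * k)) x.
  by rewrite cexpixD cexpiNx.
rewrite (jnormK k f t); move: (jnorm k f t) => m.
rewrite -!scalemxAr !scalerA -scalerBl; congr (_ *: _).
by rewrite h1 -(mulrA (cexpi (- (2 * k)) x)) h2 h3 mulrC.
Qed.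

Lemma jtheta_lim k f f' x : jost k f f' -> 0 <= x -> forall e, 0 < e ->
  exists2 X, 0 <= X & forall t, X <= t -> nrm (jtheta k f f' x t - (2 * 'i%C * k)%:M) <= e.
Proof.
move=> J x0 e e0; have [M M0 mM] := jnorm_bounded J.
set c := cmod (cexpi (- (2 * k)) x).
have c0 : 0 <= c := cmod_ge0 _.
have e1 : 0 < e / 2 by rewrite divr_gt0.
have e2 : 0 < e / 2 / (c + 1) by rewrite !divr_gt0// ltr_wpDl.
have [X1 X10 h1] := jsig_lim J M0 mM e1; have [X2 X20 h2] := jgam_lim J M0 mM e2.
exists (Num.max X1 X2); first by rewrite le_max X10.
move=> t; rewrite ge_max => /andP[/h1 b1 /h2 b2].
rewrite /jtheta addrAC; apply: le_trans (nrmD _ _) _; rewrite nrmN nrmZ -/c [e]splitr.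
apply: lerD => //; apply: le_trans (ler_wpM2l c0 b2) _.
by rewrite mulrCA ger_pMr// ler_pdivrMr ?mul1r ?lerDl// ltr_wpDl.
Qed.

(* In the sup norm weighted by jweight (4 / Im l), the Volterra operator has
   norm at most 1/2 on the whole half-line. *)
Definition jweight (c x : R) := expR (c * (qoo - qm x)).

Lemma jweight_ge1 c x : 0 <= c -> 0 <= x -> 1 <= jweight c x.
Proof.
by move=> c0 x0; rewrite -[leLHS]expR0 ler_expR mulr_ge0// subr_ge0 qm_leoo.
Qed.

Lemma jweight_le c x : 0 <= c -> jweight c x <= expR (c * qoo).
Proof. by move=> c0; rewrite ler_expR ler_wpM2l// gerBl qm_ge0. Qed.

(** The weight W has derivative - c W with respect to [qm]. The inequality e^u >= 1 + u, used from t
    to s and from x to t, gives this up to a term quadratic in the mass of [s, t]. *)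
Lemma jweight_straddle c x : 0 <= c -> 0 <= x -> forall e, 0 < e ->
  \forall st \near straddles x,
    c * (qm st.2 - qm st.1) * jweight c x <=
    jweight c st.1 - jweight c st.2 + e * (nu st.2 - nu st.1).
Proof.
move=> c0 x0 e e0; set W := jweight c x.
have W0 : 0 < W := expR_gt0 _.
have kk : 0 <= c * (c * W) by rewrite !mulr_ge0// ltW.
have e1 : 0 < e / (c * (c * W) + 1) by rewrite divr_gt0// ltr_wpDl.
case: (nuP) => /(_ _ x0 _ e1) cnu _.
apply: filterS2 (near_straddles_order x) cnu => -[s t] /= [s0 /andP[sx xt]] small.
have st := le_trans sx xt.
have ratio (y z : R) : jweight c y = jweight c z * expR (c * (qm z - qm y)).
  by rewrite /jweight -expRD; congr expR; ring.
have q0 : 0 <= qm t - qm s by rewrite subr_ge0; exact: qm_le.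
have q1 : qm t - qm x <= qm t - qm s by rewrite lerD2l lerN2 qm_le.
have n1 := qm_nu s0 st.
have h1 : jweight c t * (1 + c * (qm t - qm s)) <= jweight c s.
  by rewrite (ratio s t) ler_pM2l ?expR_gt0// expR_ge1Dx.
have h2 : W * (1 + c * (qm x - qm t)) <= jweight c t.
  by rewrite (ratio t x) ler_pM2l ?expR_gt0// expR_ge1Dx.
set a := c * (qm t - qm s).
have a0 : 0 <= a by rewrite mulr_ge0.
have h3 : W * (1 - a) <= jweight c t.
  apply: le_trans h2; rewrite ler_pM2l// lerD2l -mulrN opprB.
  by rewrite ler_wpM2l// lerB// qm_le.
have h4 : a * (W * (1 - a)) <= a * jweight c t by rewrite ler_wpM2l.
(* In the quadratic remainder one factor qm t - qm s is small by continuity of the gauge, the other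
   is at most nu t - nu s. *)
have h5 : a * (W * a) <= e * (nu t - nu s).
  have nn : 0 <= nu t - nu s by apply: le_trans n1.
  rewrite /a (_ : _ * _ = c * (c * W) * (qm t - qm s) * (qm t - qm s)); last by ring.
  apply: (@le_trans _ _ (c * (c * W) * (e / (c * (c * W) + 1)) * (nu t - nu s))).
    apply: ler_pM => //; first by rewrite mulr_ge0.
    by rewrite ler_wpM2l// (le_trans n1)// ltW.
  apply: ler_wpM2r => //; rewrite mulrCA ger_pMr// ler_pdivrMr ?mul1r ?lerDl//.
  by rewrite ltr_wpDl.
move: h1 h4 h5; rewrite -/a; set w1 := jweight c s; set w2 := jweight c t; set E := e * _.
rewrite !mulrDr !mulr1 !mulrN; lra.
Qed.

(** A contraction without iteration: the infimum I of the admissible S satisfies I <= I / 2 + a. The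
    finite initial S makes the set nonempty, and its size leaves no trace in the conclusion. *)
Lemma halving_bound (D W : R -> R) a : (forall x, 0 <= x -> 0 < W x) ->
  (exists2 S, 0 <= S & forall x, 0 <= x -> D x <= S * W x) -> 0 <= a ->
  (forall S, 0 <= S -> (forall x, 0 <= x -> D x <= S * W x) ->
    forall x, 0 <= x -> D x <= (S / 2 + a) * W x) ->
  forall x, 0 <= x -> D x <= (2 * a) * W x.
Proof.
move=> W0 [S S0 hS] a0 step.
pose T := [set S | 0 <= S /\ forall x, 0 <= x -> D x <= S * W x].
have infT : has_inf T by split; [exists S|exists 0 => u []].
have T0 : 0 <= inf T by apply: lb_le_inf; [exists S|move=> u []].
have I2 : inf T <= 2 * a.
  apply/ler_addgt0Pr => e e0.
  have [u [u0 hu] uI] := inf_adherent e0 infT.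
  have : inf T <= u / 2 + a.
    apply: ge_inf; first by exists 0 => v [].
    by split; [rewrite addr_ge0// divr_ge0|exact: step].
  lra.
move=> x x0; apply: (@le_trans _ _ (inf T * W x)); last by rewrite ler_wpM2r// ltW// W0.
rewrite -ler_pdivrMr ?W0//; apply: lb_le_inf; first by exists S.
by move=> u [_ hu]; rewrite ler_pdivrMr ?W0// hu.
Qed.

(** * Lipschitz dependence on the spectral parameter at a fixed l *)

Section Pair.
Variables (l : C) (g g' : R -> 'M[C]_n) (M : R).
Hypothesis Jl : jost l g g'.
Hypothesis M0 : 0 <= M.
Hypothesis gM : forall x, 0 <= x -> nrm (jnorm l g x) <= M.
Local Notation K := (complex.Im l).

Let K0 : 0 < K. Proof. by case: Jl. Qed.

(** The factor 2 a of [halving_bound], divided by |k - l|, times the maximum of the weight. It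
    involves l, M and the total mass but not k, hence is uniform near l. *)
Definition jlip_normal : R :=
  2 * ((4 / K * M * qoo + 2 * nrm (1%:M : 'M[C]_n) + 2 * M) / K) * expR (4 / K * qoo).

(** The second term pays for e^{ikx} - e^{ilx} when the normalization is undone. *)
Definition jlip : R := jlip_normal + 4 / K * M.

Lemma jlip_normal_ge0 : 0 <= jlip_normal.
Proof.
by rewrite /jlip_normal !mulr_ge0 ?addr_ge0 ?mulr_ge0 ?invr_ge0 ?expR_ge0 ?nrm_ge0 ?qoo_ge0 ?(ltW K0).
Qed.

Lemma jlip_ge0 : 0 <= jlip.
Proof. by rewrite addr_ge0 ?jlip_normal_ge0// !mulr_ge0 ?invr_ge0 ?(ltW K0). Qed.

Variables (k : C) (f f' : R -> 'M[C]_n).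
Hypothesis J : jost k f f'.
Hypothesis kl : cmod (k - l) <= K / 4.
Local Notation d := (cmod (k - l)).

Let d0 : 0 <= d := cmod_ge0 _.

Lemma Im_close : 3 / 4 * K <= complex.Im k.
Proof.
have : complex.Im k = K + complex.Im (k - l) by rewrite -ImD addrC subrK.
have := Im_le_cmod (k - l); rewrite ler_norml => /andP[+ _] ->.
by move: kl; lra.
Qed.

Lemma cexpi2B x : 0 <= x -> cmod (cexpi (2 * k) x - cexpi (2 * l) x) <= 4 / K * d.
Proof.
move=> x0; have x20 : 0 <= 2 * x by rewrite mulr_ge0.
rewrite !cexpi2; apply: le_trans (cmod_cexpiB K0 kl x20) _.
rewrite ler_piMr//; first by rewrite mulr_ge0// divr_ge0// ltW.
rewrite -[leRHS]expR0 ler_expR; have : 0 <= K / 2 * (2 * x) by rewrite !mulr_ge0 ?invr_ge0 ?(ltW K0).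
by rewrite mulNr oppr_le0.
Qed.

Lemma cexpi2_le1 x : 0 <= x -> cmod (cexpi (2 * k) x) <= 1.
Proof.
move=> x0; rewrite cexpi2 cmod_cexpi -[leRHS]expR0 ler_expR mulNr oppr_le0 !mulr_ge0//.
by case: J => /ltW.
Qed.

(** The difference of the two Volterra integrands splits into the k-kernel acting on the difference
    of the solutions, at most 2 S W per unit mass, and the difference of kernels acting on the fixed
    solution, at most (4 / K) d M. *)
Lemma jtheta_close_incr S x b : 0 <= S ->
  (forall x, 0 <= x -> nrm (jnorm k f x - jnorm l g x) <= S * jweight (4 / K) x) ->
  0 <= x -> x <= b ->
  nrm ((jtheta k f f' x b - jtheta l g g' x b) - (jtheta k f f' x x - jtheta l g g' x x)) <=
  K / 2 * S * jweight (4 / K) x + 4 / K * M * qoo * d.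
Proof.
move=> S0 hS x0 xb; set c := 4 / K.
have c0 : 0 < c by rewrite divr_gt0.
(* With respect to [qm], this is an antiderivative of 2 S W + c d M; the weight turns the first part
   into 2 S / c = K S / 2. *)
pose phi (y : R) := - (2 * S / c) * jweight c y + c * d * M * qm y.
apply: (@le_trans _ _ (phi b - phi x)).
  apply: (ider_mean_value nuP (P := fun y => jtheta k f f' x y - jtheta l g g' x y)
    (phi := phi) x0 xb) => t /andP[xt tb].
  have t0 := le_trans x0 xt.
  exists (fun s1 t1 => (1 - cexpi (2 * k) (t - x)) *: (qinc s1 t1 *m jnorm k f t) -
     (1 - cexpi (2 * l) (t - x)) *: (qinc s1 t1 *m jnorm l g t)).
    by apply: iderB => //; apply: ider_jtheta.
  move=> e e0.
  have Sc0 : 0 <= 2 * S / c by apply: divr_ge0; [exact: mulr_ge0|exact: ltW].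
  have e1 : 0 < e / (2 * S / c + 1) by rewrite divr_gt0// ltr_wpDl.
  apply: filterS2 (near_straddles_order t) (jweight_straddle (ltW c0) t0 e1).
  move=> -[s1 t1] /= [s10 /andP[st tt1]] hw.
  have st1 := le_trans st tt1.
  have D0 := gauge_ge0 nuP s10 st1.
  have q0 : 0 <= qm t1 - qm s1 by rewrite subr_ge0; exact: qm_le.
  have tx : 0 <= t - x by rewrite subr_ge0.
  have qq := qinc_le s10 st1.
  have hd := hS t t0; have hg := gM t0.
  have -> : (1 - cexpi (2 * k) (t - x)) *: (qinc s1 t1 *m jnorm k f t) -
     (1 - cexpi (2 * l) (t - x)) *: (qinc s1 t1 *m jnorm l g t) =
     (1 - cexpi (2 * k) (t - x)) *: (qinc s1 t1 *m (jnorm k f t - jnorm l g t)) -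
     (cexpi (2 * k) (t - x) - cexpi (2 * l) (t - x)) *: (qinc s1 t1 *m jnorm l g t).
    rewrite mulmxBr; move: (qinc s1 t1 *m _) (qinc s1 t1 *m _) (cexpi _ _) (cexpi _ _) => X Y u v.
    by apply/matrixP => i j; rewrite !mxE; ring.
  apply: le_trans (nrmD _ _) _; rewrite nrmN !nrmZ.
  have b1 : cmod (1 - cexpi (2 * k) (t - x)) *
      nrm (qinc s1 t1 *m (jnorm k f t - jnorm l g t)) <=
      2 * ((qm t1 - qm s1) * (S * jweight c t)).
    apply: ler_pM; rewrite ?cmod_ge0 ?nrm_ge0//.
      apply: le_trans (cmodD _ _) _; rewrite cmodN (_ : 2 = 1 + 1 :> R)//.
      by apply: lerD; [rewrite normr1|exact: cexpi2_le1].
    apply: le_trans (nrmM _ _) _; apply: ler_pM; rewrite ?nrm_ge0//.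
  have b2 : cmod (cexpi (2 * k) (t - x) - cexpi (2 * l) (t - x)) *
      nrm (qinc s1 t1 *m jnorm l g t) <= c * d * ((qm t1 - qm s1) * M).
    apply: ler_pM; rewrite ?cmod_ge0 ?nrm_ge0//; first exact: cexpi2B.
    by apply: le_trans (nrmM _ _) _; apply: ler_pM; rewrite ?nrm_ge0.
  apply: le_trans (lerD b1 b2) _.
  have -> : phi t1 - phi s1 = 2 * S / c * (jweight c s1 - jweight c t1) +
      c * d * ((qm t1 - qm s1) * M) by rewrite /phi; ring.
  rewrite addrAC lerD2r.
  have -> : 2 * ((qm t1 - qm s1) * (S * jweight c t)) =
     2 * S / c * (c * (qm t1 - qm s1) * jweight c t) by field; rewrite gt_eqF.
  apply: le_trans (ler_wpM2l Sc0 hw) _; rewrite mulrDr lerD2l.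
  rewrite mulrA ler_wpM2r// mulrCA ger_pMr// ler_pdivrMr ?mul1r ?lerDl//.
  by rewrite ltr_wpDl.
have -> : phi b - phi x = 2 * S / c * jweight c x - 2 * S / c * jweight c b +
    c * d * M * (qm b - qm x) by rewrite /phi; ring.
apply: lerD.
  have -> : K / 2 * S = 2 * S / c by rewrite /c; field; rewrite gt_eqF.
  rewrite gerBl; apply: mulr_ge0; last exact: expR_ge0.
  by apply: divr_ge0; [exact: mulr_ge0|exact: ltW].
have -> : c * M * qoo * d = c * d * M * qoo by ring.
apply: ler_wpM2l; first by apply: mulr_ge0 => //; apply: mulr_ge0 => //; exact: ltW.
by have := qm_leoo (le_trans x0 xb); have := qm_ge0 x; lra.
Qed.

(** As b grows, the difference of the [jtheta] at b tends to 2i(k - l), while at x it is the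
    difference of 2ik and 2il times the normalized solutions. Dividing by 2|k| >= K turns K S / 2
    into S / 2. *)
Lemma jnorm_close_step S : 0 <= S ->
  (forall x, 0 <= x -> nrm (jnorm k f x - jnorm l g x) <= S * jweight (4 / K) x) ->
  forall x, 0 <= x -> nrm (jnorm k f x - jnorm l g x) <=
    (S / 2 + (4 / K * M * qoo + 2 * nrm (1%:M : 'M[C]_n) + 2 * M) / K * d) * jweight (4 / K) x.
Proof.
move=> S0 hS x x0.
set W := jweight (4 / K) x; set N := nrm (1%:M : 'M[C]_n).
have W1 : 1 <= W by rewrite jweight_ge1// divr_ge0// ltW.
have N0 : 0 <= N := nrm_ge0 _.
pose a := 4 / K * M * qoo + 2 * N + 2 * M.
have a0 : 0 <= a by rewrite !addr_ge0 ?mulr_ge0 ?invr_ge0 ?qoo_ge0 ?(ltW K0).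
have nik (z : C) : cmod (2 * 'i%C * z) = 2 * cmod z.
  by rewrite 2!cmodM cmod_i mulr1 -[2]/(2%:R) -(rmorph_nat (real_complex R)) cmod_real ger0_norm.
have h : 2 * cmod k * nrm (jnorm k f x - jnorm l g x) <= K / 2 * S * W + a * d.
  apply/ler_addgt0Pr => e e0.
  have e2 : 0 < e / 2 by rewrite divr_gt0.
  have [X1 X10 h1] := jtheta_lim J x0 e2; have [X2 X20 h2] := jtheta_lim Jl x0 e2.
  pose b := Num.max x (Num.max X1 X2).
  have xb : x <= b by rewrite le_max lexx.
  have X1b : X1 <= b by rewrite !le_max lexx orbT.
  have X2b : X2 <= b by rewrite !le_max lexx !orbT.
  pose T := jtheta k f f' x b - jtheta l g g' x b.
  pose T0 := jtheta k f f' x x - jtheta l g g' x x.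
  have inc : nrm (T - T0) <= K / 2 * S * W + 4 / K * M * qoo * d.
    exact: jtheta_close_incr S0 hS x0 xb.
  rewrite -nik -nrmZ.
  have -> : (2 * 'i%C * k) *: (jnorm k f x - jnorm l g x) =
      - (T - T0) + ((jtheta k f f' x b - (2 * 'i%C * k)%:M) -
      (jtheta l g g' x b - (2 * 'i%C * l)%:M) + ((2 * 'i%C * (k - l)) *: 1%:M -
       (2 * 'i%C * (k - l)) *: jnorm l g x)).
    rewrite /T /T0 !jtheta_diag.
    move: (jtheta k f f' x b) (jtheta l g g' x b) (jnorm k f x) (jnorm l g x) => A1 A2 A3 A4.
    rewrite -(scalemx1 n (2 * 'i%C * k)) -(scalemx1 n (2 * 'i%C * l)).
    move: (1%:M : 'M[C]_n) => I1.
    by apply/matrixP => i j; rewrite !mxE; ring.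
  apply: le_trans (nrmD _ _) _; rewrite nrmN.
  have t1 : nrm ((jtheta k f f' x b - (2 * 'i%C * k)%:M) -
      (jtheta l g g' x b - (2 * 'i%C * l)%:M)) <= e.
    apply: le_trans (nrmD _ _) _; rewrite nrmN [e]splitr.
    exact: lerD (h1 _ X1b) (h2 _ X2b).
  have t2 : nrm ((2 * 'i%C * (k - l)) *: (1%:M : 'M[C]_n) -
       (2 * 'i%C * (k - l)) *: jnorm l g x) <= 2 * d * N + 2 * d * M.
    apply: le_trans (nrmD _ _) _; rewrite nrmN [nrm (_ *: 1%:M)]nrmZ [nrm (_ *: jnorm _ _ _)]nrmZ !nik.
    by apply: lerD => //; apply: ler_wpM2l; [rewrite mulr_ge0|exact: gM].
  apply: le_trans (lerD inc (le_trans (nrmD _ _) (lerD t1 t2))) _.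
  rewrite /a; set u := K / 2 * S * W; set v := 4 / K * M * qoo.
  by rewrite le_eqVlt; apply/orP; left; apply/eqP; ring.
have k2 : K <= 2 * cmod k.
  have : complex.Im k <= cmod k by apply: le_trans (Im_le_cmod k); exact: ler_norm.
  by have := Im_close; have := K0; lra.
have h' : K * nrm (jnorm k f x - jnorm l g x) <= K / 2 * S * W + a * d.
  by apply: le_trans h; apply: ler_wpM2r => //; exact: nrm_ge0.
rewrite -(ler_pM2l K0); apply: le_trans h' _.
have -> : K * ((S / 2 + a / K * d) * W) = K / 2 * S * W + a * d * W.
  by field; rewrite gt_eqF.
by rewrite lerD2l ler_peMr// mulr_ge0.
Qed.

Lemma jnorm_close x : 0 <= x -> nrm (jnorm k f x - jnorm l g x) <= jlip_normal * d.
Proof.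
move=> x0; have [M' M'0 fM] := jnorm_bounded J.
have c0 : 0 <= 4 / K by rewrite divr_ge0// ltW.
set a := (4 / K * M * qoo + 2 * nrm (1%:M : 'M[C]_n) + 2 * M) / K * d.
have a0 : 0 <= a.
  by rewrite !mulr_ge0 ?addr_ge0 ?mulr_ge0 ?invr_ge0 ?nrm_ge0 ?qoo_ge0 ?(ltW K0).
have b : nrm (jnorm k f x - jnorm l g x) <= 2 * a * jweight (4 / K) x.
  apply: (@halving_bound (fun x => nrm (jnorm k f x - jnorm l g x)) (jweight (4 / K)) a) x0.
  - by move=> y _; exact: expR_gt0.
  (* The bound M' depends on k in an uncontrolled way; it only starts the halving. *)
  - exists (M' + M); first exact: addr_ge0.
    move=> y y0; apply: (@le_trans _ _ (M' + M)).
      by apply: le_trans (nrmD _ _) _; rewrite nrmN; apply: lerD; [exact: fM|exact: gM].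
    by rewrite ler_peMr ?addr_ge0// jweight_ge1.
  - exact: a0.
  - by move=> S S0 hS y y0; exact: jnorm_close_step.
apply: le_trans b _; apply: (@le_trans _ _ (2 * a * expR (4 / K * qoo))).
  by apply: ler_wpM2l; [exact: mulr_ge0|exact: jweight_le].
rewrite /jlip_normal /a le_eqVlt; apply/orP; left; apply/eqP.
by move: (_ / K) (expR _) (cmod _) => u v w; ring.
Qed.

(** Undoing the normalization keeps half of the decay, since Im k >= 3 K / 4 and [cmod_cexpiB]
    retains e^{-Kx/2}; this makes products with f - g integrable. *)
Lemma jost_close x : 0 <= x -> nrm (f x - g x) <= jlip * d * expR (- (K / 2) * x).
Proof.
move=> x0.
have -> : f x - g x = cexpi k x *: (jnorm k f x - jnorm l g x) +
    (cexpi k x - cexpi l x) *: jnorm l g x.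
  by rewrite scalerBr scalerBl -!jnormK addrA subrK.
apply: le_trans (nrmD _ _) _.
rewrite [nrm (_ *: (_ - _))]nrmZ [nrm ((_ - _) *: _)]nrmZ /jlip mulrDl mulrDl; apply: lerD.
  rewrite mulrC; apply: ler_pM; rewrite ?cmod_ge0 ?nrm_ge0// ?jnorm_close//.
  rewrite cmod_cexpi ler_expR ler_wpM2r// lerN2.
  by have := Im_close; have := K0; lra.
have -> : 4 / K * M * d * expR (- (K / 2) * x) = 4 / K * d * expR (- (K / 2) * x) * M by ring.
apply: ler_pM; rewrite ?cmod_ge0 ?nrm_ge0 ?gM//.
exact: cmod_cexpiB.
Qed.

(** Both factors vanish at infinity, so their difference at 0 is the total variation of the
    difference, which [jnorm_close] controls. Closeness of f' at 0 follows from this. *)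
Lemma jgam0_close : nrm (jfactor k f f' 0 - jfactor l g g' 0) <= jlip * qoo * d.
Proof.
have [M' M'0 fM] := jnorm_bounded J.
apply/ler_addgt0Pr => e e0; have e2 : 0 < e / 2 by rewrite divr_gt0.
have [X1 X10 h1] := jgam_lim J M'0 fM e2; have [X2 X20 h2] := jgam_lim Jl M0 gM e2.
pose b := Num.max X1 X2.
have X1b : X1 <= b by rewrite le_max lexx.
have X2b : X2 <= b by rewrite le_max lexx orbT.
have b0 := le_trans X10 X1b.
have inc : nrm ((jfactor k f f' b - jfactor l g g' b) - (jfactor k f f' 0 - jfactor l g g' 0)) <=
    jlip * d * (qm b - qm 0).
  apply: (@ider_qm_bound _ _ (fun y => jfactor k f f' y - jfactor l g g' y)) => // t t0 tb.
  exists (fun s1 t1 => cexpi k t *: (qinc s1 t1 *m f t) - cexpi l t *: (qinc s1 t1 *m g t)).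
    exact: (iderB nuP t0 (ider_jfactor J (erefl _) t0) (ider_jfactor Jl (erefl _) t0)).
  apply: filterS (near_straddles_order t) => -[s1 t1] /= [s10 /andP[st tt1]].
  have st1 := le_trans st tt1; have qq := qinc_le s10 st1.
  have q0 : 0 <= qm t1 - qm s1 by rewrite subr_ge0; exact: qm_le.
  have sq (z : C) : cexpi z t * cexpi z t = cexpi (2 * z) t by rewrite mulr_natl mulr2n cexpiD.
  have c2 := cexpi2B t0; have c3 := cexpi2_le1 t0.
  move: (jnormK k f t) (jnormK l g t) (jnorm_close t0) (gM t0).
  move: (jnorm k f t) (jnorm l g t) => mk ml -> -> hd hg.
  rewrite -!scalemxAr !scalerA !sq.
  have -> : cexpi (2 * k) t *: (qinc s1 t1 *m mk) - cexpi (2 * l) t *: (qinc s1 t1 *m ml) =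
      cexpi (2 * k) t *: (qinc s1 t1 *m (mk - ml)) +
      (cexpi (2 * k) t - cexpi (2 * l) t) *: (qinc s1 t1 *m ml).
    by rewrite mulmxBr scalerBr scalerBl addrA subrK.
  have -> : jlip * d * (qm t1 - qm s1) = jlip_normal * d * (qm t1 - qm s1) +
      4 / K * M * d * (qm t1 - qm s1) by rewrite /jlip; ring.
  apply: le_trans (nrmD _ _) _; rewrite !nrmZ; apply: lerD.
    rewrite -[leRHS]mul1r; apply: ler_pM; rewrite ?cmod_ge0 ?nrm_ge0//.
    apply: le_trans (nrmM _ _) _; rewrite mulrC.
    by apply: ler_pM; rewrite ?nrm_ge0.
  have -> : 4 / K * M * d * (qm t1 - qm s1) = 4 / K * d * ((qm t1 - qm s1) * M) by ring.
  apply: ler_pM; rewrite ?cmod_ge0 ?nrm_ge0//.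
  by apply: le_trans (nrmM _ _) _; apply: ler_pM; rewrite ?nrm_ge0.
pose T := jfactor k f f' b - jfactor l g g' b.
pose T0 := jfactor k f f' 0 - jfactor l g g' 0.
change (nrm T0 <= jlip * qoo * d + e).
rewrite -[T0](subKr T).
apply: le_trans (nrmD _ _) _; rewrite nrmN addrC; apply: lerD.
  apply: le_trans inc _.
  have -> : jlip * qoo * d = jlip * d * qoo by ring.
  apply: ler_wpM2l; first by rewrite mulr_ge0 ?jlip_ge0.
  by have := qm_leoo b0; have := qm_ge0 0; lra.
apply: le_trans (nrmD _ _) _; rewrite nrmN [e]splitr.
exact: lerD (h1 _ X1b) (h2 _ X2b).
Qed.

Lemma jost_deriv0_close : nrm (f' 0 - g' 0) <=
  (jlip * qoo + (cmod l + K / 4) * jlip + M) * d.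
Proof.
have E z h h' : h' 0 = jfactor z h h' 0 + ('i%C * z) *: h 0.
  by rewrite /jfactor cexpix0 scale1r subrK.
rewrite (E k f f') (E l g g').
have -> : jfactor k f f' 0 + ('i%C * k) *: f 0 - (jfactor l g g' 0 + ('i%C * l) *: g 0) =
    (jfactor k f f' 0 - jfactor l g g' 0) + (('i%C * k) *: (f 0 - g 0) +
    ('i%C * (k - l)) *: g 0).
  move: (jfactor _ _ _ _) (jfactor _ _ _ _) => A1 A2.
  by apply/matrixP => i j; rewrite !mxE; ring.
apply: le_trans (nrmD _ _) _; rewrite mulrDl mulrDl -addrA; apply: lerD jgam0_close _.
apply: le_trans (nrmD _ _) _; rewrite !nrmZ !cmodM cmod_i !mul1r; apply: lerD.
  rewrite -mulrA; apply: ler_pM; rewrite ?cmod_ge0 ?nrm_ge0//.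
    by rewrite -[k](subrK l) addrC; apply: le_trans (cmodD _ _) _; rewrite lerD2l.
  by have := jost_close (lexx 0); rewrite mulr0 expR0 mulr1.
rewrite mulrC; apply: ler_wpM2r => //.
by have := gM (lexx 0); rewrite /jnorm cexpix0 scale1r.
Qed.

End Pair.

(** * The Wronskian identity *)

Section Wronskian.
Hypothesis qinc_adj : forall s t, 0 <= s -> adjmx (qinc s t) = qinc s t.
Variables (l : C) (g g' : R -> 'M[C]_n) (M : R).
Hypothesis Jl : jost l g g'.
Hypothesis M0 : 0 <= M.
Hypothesis gM : forall x, 0 <= x -> nrm (jnorm l g x) <= M.
Local Notation K := (complex.Im l).

Let K0 : 0 < K. Proof. by case: Jl. Qed.

Definition jwron (f f' : R -> 'M[C]_n) x := adjmx (f x) *m g' x - adjmx (f' x) *m g x.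

(** The potential contributes twice with opposite signs because [qinc] is selfadjoint; only the
    difference of the spectral parameters survives. *)
Lemma ider_jwron k f f' x : jost k f f' -> 0 <= x ->
  ider nu (jwron f f') (fun s t => (t - s)%:C%C *:
    ((conjc k ^+ 2 - l ^+ 2) *: (adjmx (f x) *m g x))) x.
Proof.
move=> [_ df df' _] x0; case: Jl => _ dg dg' _.
have d1 := iderM nuP x0 (ider_adj (df x x0)) (dg' x x0).
have d2 := iderM nuP x0 (ider_adj (df' x x0)) (dg x x0).
apply: ider_near_ext (iderB nuP x0 d1 d2).
apply: filterS (near_straddles_order x) => -[s t] /= [s0 /andP[sx xt]].
have r : conjc (t - s)%:C%C = (t - s)%:C%C :> C by rewrite /= oppr0.
rewrite adjmxZ adjmxB adjmxM !adjmxZ qinc_adj// r rmorphXn /=.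
move: (t - s)%:C%C (conjc k) (adjmx (f x)) (adjmx (f' x)) => a k' A A'.
rewrite !mulmxBr !mulmxBl -!scalemxAr -!scalemxAl !mulmxA.
move: (A' *m g' x) (A *m qinc s t *m g x) (A *m g x) => X Y Z.
by apply/matrixP => i j; rewrite !mxE; ring.
Qed.

(* Since jwron tends to 0 at infinity, this is the integral of f^* g over
   [x, +oo[. *)
Definition jgram (k : C) f f' x := (- (conjc k ^+ 2 - l ^+ 2)^-1) *: jwron f f' x.

Lemma ider_jgram k f f' x : jost k f f' -> conjc k ^+ 2 != l ^+ 2 -> 0 <= x ->
  ider nu (jgram k f f') (fun s t => - ((t - s)%:C%C *: (adjmx (f x) *m g x))) x.
Proof.
move=> J kl x0.
have := iderZ nuP (- (conjc k ^+ 2 - l ^+ 2)^-1) x0 (ider_jwron J x0).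
apply: ider_ext => s t; rewrite [in LHS]scalerA [in LHS]scalerA.
by rewrite mulrAC mulNr mulVf ?subr_eq0// mulN1r scaleNr.
Qed.

(** The decay of g and g' meets bounds on f and f'; the vanishing limit identifies [jgram] with a
    tail integral. *)
Lemma jgram_lim k f f' : jost k f f' -> forall e, 0 < e ->
  exists2 X, 0 <= X & forall x, X <= x -> nrm (jgram k f f' x) <= e.
Proof.
move=> J e e0; have [M' M'0 fM] := jnorm_bounded J.
have kp : 0 < complex.Im k by case: J.
set c := - (conjc k ^+ 2 - l ^+ 2)^-1.
pose B := M' * (M * qoo + cmod ('i%C * l) * M) + (M' * qoo + cmod ('i%C * k) * M') * M.
have B0 : 0 <= B by rewrite !addr_ge0 ?mulr_ge0 ?addr_ge0 ?mulr_ge0 ?qoo_ge0 ?cmod_ge0.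
have [X X0 h] := expR_tail K0 (mulr_ge0 (cmod_ge0 c) B0) e0.
exists X => // x Xx; apply: le_trans (h _ Xx); have x0 := le_trans X0 Xx.
rewrite /jgram nrmZ -/c mulrCA; apply: ler_wpM2l; first exact: cmod_ge0.
have e1 : expR (- complex.Im k * x) <= 1.
  by rewrite -[leRHS]expR0 ler_expR mulNr oppr_le0 mulr_ge0// ltW.
have f1 : nrm (f x) <= M'.
  by apply: le_trans (jost_bound fM x0) _; rewrite ler_piMl.
have f2 : nrm (f' x) <= M' * qoo + cmod ('i%C * k) * M'.
  apply: le_trans (jost_deriv_bound J M'0 fM x0) _; rewrite ler_piMl//.
  by rewrite !addr_ge0 ?mulr_ge0 ?qoo_ge0 ?cmod_ge0.
have g1 := jost_bound gM x0; have g2 := jost_deriv_bound Jl M0 gM x0.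
have -> : expR (- K * x) * B = M' * (expR (- K * x) * (M * qoo + cmod ('i%C * l) * M)) +
    (M' * qoo + cmod ('i%C * k) * M') * (expR (- K * x) * M) by rewrite /B; ring.
apply: le_trans (nrmD _ _) _; rewrite nrmN; apply: lerD;
  apply: le_trans (nrmM _ _) _; rewrite nrm_adj; apply: ler_pM; by rewrite ?nrm_ge0.
Qed.

Lemma jost_le x : 0 <= x -> nrm (g x) <= M.
Proof.
move=> x0; apply: le_trans (jost_bound gM x0) _; rewrite ler_piMl//.
by rewrite -[leRHS]expR0 ler_expR mulNr oppr_le0 mulr_ge0// ltW.
Qed.

Local Notation close k f f' :=
  [/\ jost k f f', cmod (k - l) <= K / 4 & conjc k ^+ 2 != l ^+ 2].

Local Notation LL := (jlip l M).

(** An antiderivative of B e^{-Kx/2}, used as an explicit bound in mean value arguments. *)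
Definition decay_primitive (B x : R) := - (B * (2 / K)) * expR (- (K / 2) * x).

Lemma decay_primitive_straddle B x : 0 <= B -> 0 <= x -> forall e, 0 < e ->
  \forall st \near straddles x, (st.2 - st.1) * (B * expR (- (K / 2) * x)) <=
    decay_primitive B st.2 - decay_primitive B st.1 + e * (nu st.2 - nu st.1).
Proof.
move=> B0 x0 e e0.
have C0 : 0 <= B * (2 / K) by rewrite !mulr_ge0 ?invr_ge0 ?(ltW K0).
have e1 : 0 < e / (B * (2 / K) + 1) by rewrite divr_gt0// ltr_wpDl.
apply: filterS2 (near_straddles_order x)
  (is_derive_straddle nuP x0 (is_derive_expRM (- (K / 2)) x) e1).
move=> -[s t] /= [s0 /andP[sx xt]]; rewrite ler_norml => /andP[_ h].
have D0 := gauge_ge0 nuP s0 (le_trans sx xt).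
have := ler_wpM2l C0 h.
have hh : B * (2 / K) * (e / (B * (2 / K) + 1) * (nu t - nu s)) <= e * (nu t - nu s).
  rewrite mulrA ler_wpM2r// mulrCA ger_pMr// ler_pdivrMr ?mul1r ?lerDl//.
  by rewrite ltr_wpDl.
move=> h2; have := le_trans h2 hh.
rewrite /decay_primitive; move: (expR (- (K / 2) * t)) (expR (- (K / 2) * s)) (expR (- (K / 2) * x)).
move=> E1 E2 E3.
have -> : B * (2 / K) * (E1 - E2 - (t - s) * (- (K / 2) * E3)) =
   B * (2 / K) * (E1 - E2) + (t - s) * (B * E3) by field; rewrite gt_eqF.
set u := B * (2 / K); rewrite mulrBr !mulNr opprK; move: (u * E1) (u * E2) (_ * (B * _)) (e * _) => *.
lra.
Qed.

Lemma decay_primitive_incr B a b : 0 <= B -> a <= b -> 0 <= a ->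
  decay_primitive B b - decay_primitive B a <= B * (2 / K).
Proof.
move=> B0 ab a0; rewrite /decay_primitive !mulNr opprK.
have C0 : 0 <= B * (2 / K) by rewrite !mulr_ge0 ?invr_ge0 ?(ltW K0).
have h1 : expR (- (K / 2 * a)) <= 1.
  by rewrite -[leRHS]expR0 ler_expR oppr_le0 !mulr_ge0 ?invr_ge0 ?(ltW K0).
have h2 := expR_ge0 (- (K / 2 * b)).
have := ler_wpM2l C0 h1; have := mulr_ge0 C0 h2; rewrite mulr1; lra.
Qed.

(** At l itself the quotient may be 0/0, so two nearby parameters are compared: the difference has
    the adjoint of f2 - f1 times g as derivative, and f1, f2 are both Lipschitz-close to g. *)
Lemma jgram_cauchy k1 f1 f1' k2 f2 f2' : close k1 f1 f1' -> close k2 f2 f2' ->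
  nrm (jgram k1 f1 f1' 0 - jgram k2 f2 f2' 0) <=
  LL * (cmod (k1 - l) + cmod (k2 - l)) * M * (2 / K).
Proof.
move=> [J1 c1 n1] [J2 c2 n2].
have LL0 : 0 <= LL by exact: (jlip_ge0 Jl M0).
set B := LL * (cmod (k1 - l) + cmod (k2 - l)) * M.
have B0 : 0 <= B.
  by apply: mulr_ge0 => //; apply: mulr_ge0 => //; apply: addr_ge0; exact: cmod_ge0.
pose P x := jgram k1 f1 f1' x - jgram k2 f2 f2' x.
apply/ler_addgt0Pr => e e0; have e2 : 0 < e / 2 by rewrite divr_gt0.
have [X1 X10 h1] := jgram_lim J1 e2; have [X2 X20 h2] := jgram_lim J2 e2.
pose b := Num.max X1 X2.
have X1b : X1 <= b by rewrite le_max lexx.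
have X2b : X2 <= b by rewrite le_max lexx orbT.
have b0 := le_trans X10 X1b.
have inc : nrm (P b - P 0) <= decay_primitive B b - decay_primitive B 0.
  apply: (ider_mean_value nuP (lexx 0) b0) => x /andP[x0 xb].
  exists (fun s t => - ((t - s)%:C%C *: (adjmx (f1 x) *m g x)) -
     - ((t - s)%:C%C *: (adjmx (f2 x) *m g x))).
    by apply: iderB => //; apply: ider_jgram.
  move=> e' e'0; apply: filterS2 (near_straddles_order x) (decay_primitive_straddle B0 x0 e'0).
  move=> -[s t] /= [s0 /andP[sx xt]]; apply: le_trans.
  have -> : - ((t - s)%:C%C *: (adjmx (f1 x) *m g x)) - - ((t - s)%:C%C *: (adjmx (f2 x) *m g x)) =
     (t - s)%:C%C *: (adjmx ((f2 x - g x) - (f1 x - g x)) *m g x).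
    by rewrite opprK addrC -scalerBr -mulmxBl -adjmxB opprB addrA subrK.
  rewrite nrmZ cmod_real ger0_norm ?subr_ge0 ?(le_trans sx)//.
  apply: ler_wpM2l; first by rewrite subr_ge0 (le_trans sx).
  apply: le_trans (nrmM _ _) _; rewrite nrm_adj.
  rewrite /B [_ * M * _]mulrAC; apply: ler_pM; rewrite ?nrm_ge0 ?jost_le//.
  apply: le_trans (nrmD _ _) _; rewrite nrmN addrC.
  have -> : LL * (cmod (k1 - l) + cmod (k2 - l)) * expR (- (K / 2) * x) =
    LL * cmod (k1 - l) * expR (- (K / 2) * x) + LL * cmod (k2 - l) * expR (- (K / 2) * x) by ring.
  exact: lerD (jost_close Jl M0 gM J1 c1 x0) (jost_close Jl M0 gM J2 c2 x0).
rewrite -/(P 0) -[P 0](subKr (P b)); apply: le_trans (nrmD _ _) _; rewrite nrmN addrC; apply: lerD.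
  by apply: le_trans inc _; exact: decay_primitive_incr.
apply: le_trans (nrmD _ _) _; rewrite nrmN [e]splitr.
exact: lerD (h1 _ X1b) (h2 _ X2b).
Qed.

(** The normalized solution tends to the identity, so a coordinate with u_i nonzero keeps at least
    half its modulus from some X on. An interval of unit length then bounds the integral of |g u|^2
    below by r ^ 2. *)
Lemma jost_lower_bound (u : 'cV[C]_n) : u != 0 -> exists i, exists2 r, 0 < r & exists2 X, 0 <= X &
  forall x, X <= x -> x <= X + 1 -> r <= cmod ((g x *m u) i 0).
Proof.
move=> u0; have [i ui] : exists i, u i 0 != 0.
  apply/existsP; rewrite -negb_forall; apply: contra u0 => /forallP h.
  by apply/eqP/matrixP => i j; rewrite mxE (ord1 j); apply/eqP/h.
have a0 := cmod_gt0 ui; set a := cmod _ in a0.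
have N0 := nrm_ge0 u; set N := nrm u in N0.
have e0 : 0 < a / 2 / (N + 1) by rewrite !divr_gt0// ltr_wpDl.
case: Jl => _ _ _ /(_ _ e0)[X0 h].
pose X := Num.max 0 X0.
have X'0 : 0 <= X by rewrite le_max lexx.
exists i, (expR (- K * (X + 1)) * (a / 2)); first by rewrite mulr_gt0 ?expR_gt0 ?divr_gt0.
exists X => // x Xx xX; have X0x : X0 <= x by apply: le_trans Xx; rewrite le_max lexx orbT.
rewrite (jnormK l g x) -scalemxAl mxE cmodM cmod_cexpi; apply: ler_pM.
- exact: expR_ge0.
- by rewrite divr_ge0 ?ltW.
- by rewrite ler_expR !mulNr lerN2 ler_wpM2l// ltW.
have h1 : cmod (((jnorm l g x - 1%:M) *m u) i 0) <= a / 2.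
  apply: le_trans (nrm_entry _ _ _) _; apply: le_trans (nrmM _ _) _; rewrite -/N.
  apply: le_trans (ler_wpM2r N0 (h _ X0x)) _.
  rewrite mulrAC ler_pdivrMr ?ltr_wpDl//; apply: ler_wpM2l; last by rewrite lerDl.
  by apply: divr_ge0 => //; exact: ltW.
have h2 : a <= cmod ((jnorm l g x *m u) i 0) + cmod (((jnorm l g x - 1%:M) *m u) i 0).
  rewrite -[cmod (((_ - _) *m u) i 0)]cmodN; apply: le_trans (cmodD _ _).
  by rewrite mulmxBl mul1mx !mxE opprB addrC subrK.
by move: h1 h2; move: (cmod _) (cmod _) => *; lra.
Qed.

(** Writing f = g + (f - g), the form at u is the integral of |g u|^2, at least r ^ 2, plus a term
    of size O(|k - l|) by [jost_close]. *)
Lemma jgram_pos (u : 'cV[C]_n) : u != 0 -> exists2 r, 0 < r & exists B,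
  forall k f f', close k f f' ->
    r - B * cmod (k - l) <= complex.Re ((adjmx u *m jgram k f f' 0 *m u) 0 0).
Proof.
move=> u0; have [i [r r0 [X X0 hr]]] := jost_lower_bound u0.
have LL0 : 0 <= LL by exact: (jlip_ge0 Jl M0).
exists (r ^+ 2); first by rewrite exprn_gt0.
(* The half-line is cut into [0, X], [X, X + 1] and the rest; on each piece f - g costs at most B *
   (2 / K). *)
exists (nrm u * LL * M * nrm u * (3 * (2 / K))) => k f f' [J c n0].
set d := cmod (k - l).
have d0 : 0 <= d := cmod_ge0 _.
pose B := nrm u * LL * M * nrm u * d.
have B0 : 0 <= B.
  have N0 := nrm_ge0 u.
  by apply: mulr_ge0 => //; apply: mulr_ge0 => //; apply: mulr_ge0 => //; apply: mulr_ge0.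
have [G GE] : exists G : R -> 'M[C]_1, forall x, G x = adjmx u *m jgram k f f' x *m u.
  by eexists.
have dG x : 0 <= x -> ider nu G
    (fun s t => adjmx u *m - ((t - s)%:C%C *: (adjmx (f x) *m g x)) *m u) x.
  move=> x0; rewrite (_ : G = fun x => adjmx u *m jgram k f f' x *m u); last exact/funext.
  exact: (iderMr nuP u x0 (iderMl nuP (adjmx u) x0 (ider_jgram J n0 x0))).
have [p pE] : exists p : R -> R, forall x, p x = complex.Re (G x 0 0) by eexists.
rewrite -GE -pE.
(* The lower bound q on the chosen coordinate of g u is r on the middle piece and 0 on the other
   two. *)
have step a b q : 0 <= a -> a <= b -> 0 <= q ->
    (forall x, a <= x -> x <= b -> q <= cmod ((g x *m u) i 0)) ->
    p b + q ^+ 2 * (b - a) - B * (2 / K) <= p a.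
  move=> a0 ab q0 hq.
  suff : p b + q ^+ 2 * b - decay_primitive B b <= p a + q ^+ 2 * a - decay_primitive B a.
    have := decay_primitive_incr B0 ab a0.
    move: (decay_primitive B a) (decay_primitive B b) (B * (2 / K)) (q ^+ 2) => D1 D2 B2 q2 h1 h2.
    by rewrite mulrBr; lra.
  apply: (local_le_global nuP (p := fun x => p x + q ^+ 2 * x - decay_primitive B x) a0 ab).
  move=> x /andP[ax xb] e e0; have x0 := le_trans a0 ax; have e2 : 0 < e / 2 by rewrite divr_gt0.
  have [_ /(_ _ e2) hd] := dG x x0.
  apply: filterS3 (near_straddles_order x) hd (decay_primitive_straddle B0 x0 e2).
  move=> -[s t] /= [s0 /andP[sx xt]].
  set L := adjmx u *m _ *m u => h1 h2.
  have h3 : p t - p s - complex.Re (L 0 0) <= e / 2 * (nu t - nu s).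
    by rewrite !pE; apply: le_trans h1; exact: Re_entryB_le.
  have h4 : complex.Re (L 0 0) <= - (t - s) * q ^+ 2 + (t - s) * (B * expR (- (K / 2) * x)).
    pose y := g x *m u; pose z := (f x - g x) *m u.
    have -> : L = - ((t - s)%:C%C *: (adjmx y *m y + adjmx z *m y)).
      rewrite /L /y /z -mulmxDl -adjmxD -mulmxDl [g x + _]addrC subrK adjmxM.
      by rewrite mulmxN mulNmx -scalemxAr -scalemxAl !mulmxA.
    have yq : q ^+ 2 <= complex.Re ((adjmx y *m y) 0 0).
      by apply: le_trans (Re_gram_ge y i); rewrite lerXn2r ?nnegrE ?cmod_ge0// hq.
    have zy : - (B * expR (- (K / 2) * x)) <= complex.Re ((adjmx z *m y) 0 0).
      rewrite lerNl; apply: le_trans (ler_norm _) _; rewrite normrN.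
      apply: le_trans (Re_le_cmod _) _; apply: le_trans (nrm_entry _ _ _) _.
      apply: le_trans (nrmM _ _) _; rewrite nrm_adj.
      have -> : B * expR (- (K / 2) * x) =
        (LL * d * expR (- (K / 2) * x) * nrm u) * (M * nrm u) by rewrite /B; ring.
      apply: ler_pM; rewrite ?nrm_ge0//; apply: le_trans (nrmM _ _) _;
        apply: ler_pM; rewrite ?nrm_ge0//; [exact: (jost_close Jl M0 gM J c x0)|exact: jost_le].
    have ts : 0 <= t - s by rewrite subr_ge0 (le_trans sx).
    have -> : complex.Re ((- ((t - s)%:C%C *: (adjmx y *m y + adjmx z *m y))) 0 0) =
        - ((t - s) * (complex.Re ((adjmx y *m y) 0 0) + complex.Re ((adjmx z *m y) 0 0))).
      rewrite -ReD; have -> : (- ((t - s)%:C%C *: (adjmx y *m y + adjmx z *m y))) 0 0 =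
        - ((t - s)%:C%C * ((adjmx y *m y) 0 0 + (adjmx z *m y) 0 0)) by rewrite !mxE.
      by case: ((adjmx y *m y) 0 0 + (adjmx z *m y) 0 0) => v w /=; rewrite mul0r subr0.
    rewrite (_ : - (t - s) * q ^+ 2 + (t - s) * (B * expR (- (K / 2) * x)) =
      - ((t - s) * (q ^+ 2 + - (B * expR (- (K / 2) * x))))); last by ring.
    by rewrite lerN2; apply: ler_wpM2l => //; exact: lerD.
  move: h2 h3 h4; rewrite mulNr; move: (nu t - nu s) (decay_primitive B t) (decay_primitive B s).
  move: ((t - s) * (B * _)) (complex.Re _) (q ^+ 2) (p t) (p s) => E1 E2 E3 E4 E5 D1 D2 D3.
  by lra.
have step0 a b : 0 <= a -> a <= b -> p b - B * (2 / K) <= p a.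
  by move=> a0 ab; have := step a b 0 a0 ab (lexx 0); rewrite expr0n mul0r addr0; apply=> *; exact: cmod_ge0.
have main e : 0 < e -> r ^+ 2 - B * (3 * (2 / K)) - e <= p 0.
  move=> e0; have N0 := nrm_ge0 u.
  have e1 : 0 < e / (nrm u * nrm u + 1) by rewrite divr_gt0// ltr_wpDl// mulr_ge0.
  have [X' X'0 h'] := jgram_lim J e1.
  pose b := Num.max (X + 1) X'.
  have Xb : X + 1 <= b by rewrite le_max lexx.
  have X'b : X' <= b by rewrite le_max lexx orbT.
  have X1 : X <= X + 1 by rewrite lerDl.
  have s1 := step0 0 X (lexx 0) X0.
  have s2 := step X (X + 1) r X0 X1 (ltW r0) hr.
  have s3 := step0 (X + 1) b (le_trans X0 X1) Xb.
  have s4 : - e <= p b.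
    rewrite lerNl pE GE; apply: le_trans (ler_norm _) _; rewrite normrN.
    apply: le_trans (Re_le_cmod _) _; apply: le_trans (nrm_entry _ _ _) _.
    apply: le_trans (nrmM _ _) _; apply: le_trans (ler_wpM2r N0 (nrmM _ _)) _; rewrite nrm_adj.
    rewrite mulrAC; apply: le_trans (ler_wpM2l (mulr_ge0 N0 N0) (h' _ X'b)) _.
    rewrite mulrCA ger_pMr// ler_pdivrMr ?mul1r ?lerDl//.
    by rewrite ltr_wpDl// mulr_ge0.
  have e1' : X + 1 - X = 1 by rewrite addrC addKr.
  rewrite e1' mulr1 in s2.
  move: s1 s2 s3 s4; rewrite mulrCA; move: (B * (2 / K)) (r ^+ 2) => *; lra.
have -> : nrm u * LL * M * nrm u * (3 * (2 / K)) * d = B * (3 * (2 / K)) by rewrite /B; ring.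
by apply/ler_addgt0Pr => e /main; rewrite -lerBlDr.
Qed.

End Wronskian.

End JostSolution.

(** * Laurent expansion of the inverse *)

Section MatrixLimits.
Variable R : realType.
Local Notation C := R[i].
Local Notation nrm := (@cmxnorm R _ _).

Lemma near_cmod (k0 : C) (e : R) : 0 < e -> \forall k \near k0^', cmod (k - k0) < e.
Proof.
move=> e0; have eC : (0 : C) < e%:C%C by rewrite ltcR.
apply: nbhs_dnbhs; apply/nbhs_ballP; exists e%:C%C => // k.
by rewrite -ball_normE /= distrC -cmodE ltcR.
Qed.

(** Substituting v <= u + y gives u <= z + u / 2 + y w, and the term u / 2 is absorbed on the
    left. *)
Lemma absorb_lt (u v w y z e : R) : u <= z + v * w -> v <= u + y ->
  w < 1 / 2 -> w < e / 4 / (y + 1) -> z < e / 4 -> 0 <= u -> 0 <= w -> 0 <= y -> u < e.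
Proof.
move=> a1 a2 h1 h2 h3 u0 w0 y0.
have D1 : w * (y + 1) < e / 4 by rewrite -ltr_pdivlMr// ltr_wpDl.
have b1 : v * w <= (u + y) * w by rewrite ler_wpM2r.
have b2 : u * w <= u * (1 / 2) by rewrite ler_wpM2l// ltW.
lra.
Qed.

Lemma lipschitz_cvg p q (P : C -> 'M[C]_(p, q)) (P0 : 'M[C]_(p, q)) (k0 : C) (A : R) :
  (\forall k \near k0^', nrm (P k - P0) <= A * cmod (k - k0)) -> P @ k0^' --> P0.
Proof.
move=> lip; apply/cvg_nrmP => e e0.
have e1 : 0 < e / (`|A| + 1) by rewrite divr_gt0// ltr_wpDl.
apply: filterS2 lip (near_cmod k0 e1) => k h1 h2; apply: le_lt_trans h1 _.
apply: (@le_lt_trans _ _ (`|A| * cmod (k - k0))).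
  by apply: ler_wpM2r; [exact: cmod_ge0|exact: ler_norm].
apply: (@le_lt_trans _ _ (`|A| * (e / (`|A| + 1)))).
  by apply: ler_wpM2l => //; exact: ltW.
by rewrite mulrCA gtr_pMr// ltr_pdivrMr ?mul1r ?ltrDl// ltr_wpDl.
Qed.

Section Filtered.
Variables (T : Type) (F : set_system T).
Context {FF : Filter F}.

Lemma cvg_mulmx p q r (P : T -> 'M[C]_(p, q)) (P' : T -> 'M[C]_(q, r))
    (A : 'M[C]_(p, q)) (A' : 'M[C]_(q, r)) :
  P @ F --> A -> P' @ F --> A' -> (fun k => P k *m P' k) @ F --> A *m A'.
Proof.
move=> /cvg_nrmP hP /cvg_nrmP hP'; apply/cvg_nrmP => e e0.
have N0 := nrm_ge0 A; have N0' := nrm_ge0 A'.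
have e1 : 0 < Num.min 1 (e / 2 / (nrm A + 1)).
  by rewrite lt_min ltr01 /= divr_gt0 ?divr_gt0// ltr_wpDl.
have e2 : 0 < e / 2 / (nrm A' + 1) by rewrite !divr_gt0// ltr_wpDl.
apply: filterS2 (hP _ e2) (hP' _ e1) => k h1; rewrite lt_min => /andP[h2 h3].
have -> : P k *m P' k - A *m A' = (P k - A) *m P' k + A *m (P' k - A').
  by rewrite mulmxBl mulmxBr addrA subrK.
apply: le_lt_trans (nrmD _ _) _.
have h4 : nrm (P' k) <= nrm A' + 1.
  rewrite -[P' k](subrK A'); apply: le_trans (nrmD _ _) _.
  by rewrite addrC lerD2l ltW.
have b1 : nrm ((P k - A) *m P' k) < e / 2.
  apply: le_lt_trans (nrmM _ _) _.
  apply: (@le_lt_trans _ _ (nrm (P k - A) * (nrm A' + 1))).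
    by apply: ler_wpM2l => //; exact: nrm_ge0.
  by rewrite -ltr_pdivlMr// ltr_wpDl.
have b2 : nrm (A *m (P' k - A')) <= e / 2.
  apply: le_trans (nrmM _ _) _.
  apply: (@le_trans _ _ ((nrm A + 1) * nrm (P' k - A'))).
    by apply: ler_wpM2r; [exact: nrm_ge0|rewrite lerDl].
  by rewrite mulrC -ler_pdivlMr ?ltr_wpDl// ltW.
by rewrite [e]splitr; exact: ltr_leD.
Qed.

Lemma cvg_cstmx p q (A : 'M[C]_(p, q)) : (fun _ : T => A) @ F --> A.
Proof.
by apply/cvg_nrmP => e e0; apply: nearW => k; rewrite subrr nrm0.
Qed.

Lemma cvg_mxB p q (P P' : T -> 'M[C]_(p, q)) (A A' : 'M[C]_(p, q)) :
  P @ F --> A -> P' @ F --> A' -> (fun k => P k - P' k) @ F --> A - A'.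
Proof.
move=> /cvg_nrmP hP /cvg_nrmP hP'; apply/cvg_nrmP => e e0.
have e2 : 0 < e / 2 by rewrite divr_gt0.
apply: filterS2 (hP _ e2) (hP' _ e2) => k h1 h2.
have -> : P k - P' k - (A - A') = (P k - A) - (P' k - A').
  by rewrite !opprB addrACA [- P' k + _]addrC addrACA [A' + _]addrC.
apply: le_lt_trans (nrmD _ _) _; rewrite nrmN [e]splitr; exact: ltrD.
Qed.

Lemma cvg_mxZ p q (a : T -> C) (P : T -> 'M[C]_(p, q)) (a0 : C) (A : 'M[C]_(p, q)) :
  a @ F --> a0 -> P @ F --> A -> (fun k => a k *: P k) @ F --> a0 *: A.
Proof.
move=> ha hP.
have ha' : (fun k => (a k)%:M : 'M[C]_p) @ F --> (a0%:M : 'M[C]_p).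
  apply/cvg_nrmP => e e0.
  have N0 := nrm_ge0 (1%:M : 'M[C]_p).
  have e1 : 0 < e / (nrm (1%:M : 'M[C]_p) + 1) by rewrite divr_gt0// ltr_wpDl.
  have eC : (0 : C) < (e / (nrm (1%:M : 'M[C]_p) + 1))%:C%C by rewrite ltcR.
  move/cvgrPdist_lt: ha => /(_ _ eC); apply: filterS => k; rewrite distrC -cmodE ltcR => h.
  rewrite -raddfB /= -scalemx1 nrmZ.
  apply: (@le_lt_trans _ _ (cmod (a k - a0) * (nrm (1%:M : 'M[C]_p) + 1))).
    by apply: ler_wpM2l; [exact: cmod_ge0|rewrite lerDl].
  by rewrite -ltr_pdivlMr// ltr_wpDl.
have := cvg_mulmx ha' hP; rewrite mul_scalar_mx.
by under eq_fun do rewrite mul_scalar_mx.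
Qed.

End Filtered.
Arguments cvg_cstmx {T F FF p q} A.

Lemma cvg_mx_unique p q (T : Type) (F : set_system T) {PF : ProperFilter F}
    (P : T -> 'M[C]_(p, q)) (A A' : 'M[C]_(p, q)) :
  P @ F --> A -> P @ F --> A' -> A = A'.
Proof.
move=> /cvg_nrmP hA /cvg_nrmP hA'; apply/eqP; rewrite -subr_eq0; apply/eqP/nrm_eq0/le_anti.
rewrite nrm_ge0 andbT; apply/ler_addgt0Pr => e e0; rewrite add0r.
have e2 : 0 < e / 2 by rewrite divr_gt0.
have [k [h1 h2]] := filter_ex (filterI (hA _ e2) (hA' _ e2)).
rewrite /= in h1 h2.
rewrite [A - A'](_ : _ = (P k - A') - (P k - A)); last by rewrite opprB [RHS]addrC subrKA.
apply: le_trans (nrmD _ _) _; rewrite nrmN [e]splitr; apply: ltW; exact: ltrD.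
Qed.

Section Inverse.
Variables (n : nat) (k0 : C) (M : C -> 'M[C]_n) (M0 : 'M[C]_n).
Hypothesis M_lim : M @ k0^' --> M0.
Hypothesis M_unit : \forall k \near k0^', M k \in unitmx.

(** In M^-1 = M0^-1 - M^-1 (M - M0) M0^-1 the last term is at most half of nrm (M^-1) near k0. A
    pole therefore forces a singular limit. *)
Lemma bounded_inv_of_unit_limit : M0 \in unitmx ->
  exists c : R, \forall k \near k0^', forall i j, cmod (invmx (M k) i j) <= c.
Proof.
move=> uM0; exists (2 * nrm (invmx M0)).
have N0 := nrm_ge0 (invmx M0).
have e0 : 0 < (2 * (nrm (invmx M0) + 1))^-1 by rewrite invr_gt0 mulr_gt0// ltr_wpDl.
have /cvg_nrmP/(_ _ e0) h := M_lim.
apply: filterS2 M_unit h => k uM hk i j; apply: le_trans (nrm_entry _ _ _) _.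
have E : invmx (M k) = invmx M0 - invmx (M k) *m ((M k - M0) *m invmx M0).
  by rewrite mulmxBl mulmxV// mulmxBr mulmx1 mulmxA mulVmx// mul1mx subKr.
have b : nrm ((M k - M0) *m invmx M0) <= 1 / 2.
  apply: le_trans (nrmM _ _) _.
  apply: le_trans (ler_pM (nrm_ge0 _) N0 (ltW hk) (lexx _)) _.
  by rewrite mulrC ler_pdivrMr ?mulr_gt0 ?ltr_wpDl//; lra.
have : nrm (invmx (M k)) <= nrm (invmx M0) + nrm (invmx (M k)) * (1 / 2).
  rewrite {1}E; apply: le_trans (nrmD _ _) _; rewrite nrmN lerD2l.
  by apply: le_trans (nrmM _ _) _; apply: ler_wpM2l => //; exact: nrm_ge0.
by move: (nrm _) (nrm _) => x y; lra.
Qed.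

(* [M0 H0] is right invertible, while (k - k0) M^-1 [M H] = [k - k0, Cc];
   multiplying by the right inverse gives the limit of (k - k0) M^-1. *)
Lemma simple_pole_criterion (H : C -> 'M[C]_n) (H0 Cc : 'M[C]_n) :
  H @ k0^' --> H0 ->
  (\forall k \near k0^', M k *m Cc = (k - k0) *: H k) ->
  (forall Z : 'M[C]_n, Z *m M0 = 0 -> Z *m H0 = 0 -> Z = 0) ->
  M0 \notin unitmx ->
  exists N : 'M[C]_n, N != 0 /\ (fun k => (k - k0) *: invmx (M k)) @ k0^' --> N.
Proof.
move=> H_lim MC free sing.
(* The hypothesis [free] says that the block row has trivial left kernel, hence a right inverse. *)
have /row_freeP[E ME] : row_free (row_mx M0 H0).
  rewrite -kermx_eq0; apply/eqP.
  have := mulmx_ker (row_mx M0 H0); rewrite mul_mx_row => /eqP.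
  by rewrite -[0](@row_mx0) => /eqP/eq_row_mx[h1 h2]; exact: free.
rewrite -[E]vsubmxK mul_row_col in ME.
set E1 := usubmx E in ME; set E2 := dsubmx E in ME.
pose X k := (k - k0) *: invmx (M k).
(* This is M E1 + H E2 - 1, the defect of the right inverse of [M0 H0] when applied at k. *)
pose D k := (M k - M0) *m E1 - (H0 - H k) *m E2.
have XE : \forall k \near k0^', X k - Cc *m E2 = (k - k0) *: E1 - X k *m D k /\ X k *m H k = Cc.
  apply: filterS2 M_unit MC => k uM MCk.
  have XH : X k *m H k = Cc.
    by rewrite /X -scalemxAl scalemxAr -MCk mulKmx.
  have XM : X k *m M k = (k - k0)%:M by rewrite /X -scalemxAl mulVmx// scalemx1.
  split; last exact: XH.
  have DE : D k = M k *m E1 + H k *m E2 - 1%:M.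
    by rewrite /D !mulmxBl opprB -ME opprD addrACA.
  have -> : X k *m D k = (k - k0) *: E1 + Cc *m E2 - X k.
    by rewrite DE mulmxBr mulmx1 mulmxDr !mulmxA XM XH mul_scalar_mx.
  by rewrite opprB addrCA opprD addNKr.
have D_lim : D @ k0^' --> (0 : 'M[C]_n).
  have z : (M0 - M0) *m E1 - (H0 - H0) *m E2 = 0 by rewrite !subrr !mul0mx subrr.
  have := cvg_mxB (cvg_mulmx (cvg_mxB M_lim (cvg_cstmx M0)) (cvg_cstmx E1))
    (cvg_mulmx (cvg_mxB (cvg_cstmx H0) H_lim) (cvg_cstmx E2)).
  by rewrite z; apply.
have d_lim : (fun k => (k - k0) *: E1) @ k0^' --> (0 : 'M[C]_n).
  by apply: (@lipschitz_cvg _ _ _ _ _ (nrm E1)); apply: nearW => k; rewrite subr0 nrmZ mulrC.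
set N := Cc *m E2 in XE.
have N0 := nrm_ge0 N.
have X_lim : X @ k0^' --> N.
  apply/cvg_nrmP => e e0.
  have e1 : 0 < Num.min (1 / 2) (e / 4 / (nrm N + 1)).
    by rewrite lt_min !divr_gt0// ltr_wpDl.
  have e2 : 0 < Num.min 1 (e / 4) by rewrite lt_min ltr01 divr_gt0.
  move/cvg_nrmP: D_lim => /(_ _ e1) D_lim; move/cvg_nrmP: d_lim => /(_ _ e2) d_lim.
  apply: filterS3 XE D_lim d_lim => k [XEk _]; rewrite !subr0 !lt_min => /andP[h1 h2] /andP[h3 h4].
  have a1 : nrm (X k - N) <= nrm ((k - k0) *: E1) + nrm (X k) * nrm (D k).
    by rewrite XEk; apply: le_trans (nrmD _ _) _; rewrite nrmN lerD2l nrmM.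
  have a2 : nrm (X k) <= nrm (X k - N) + nrm N.
    by rewrite -{1}[X k](subrK N); exact: nrmD.
  exact: absorb_lt a1 a2 h1 h2 h4 (nrm_ge0 _) (nrm_ge0 _) N0.
(* If N = 0, then X H tends to 0; being constantly [Cc], it gives Cc = 0. Hence H vanishes near k0
   and H0 = 0, and [free] makes M0 invertible. *)
exists N; split=> //; apply/eqP => N_eq0; move/negP: sing; apply.
have Cc0 : Cc = 0.
  have XH_lim : (fun k => X k *m H k) @ k0^' --> (0 : 'M[C]_n).
    by have := cvg_mulmx X_lim H_lim; rewrite N_eq0 mul0mx; apply.
  have XH' : (fun k => X k *m H k) @ k0^' --> Cc.
    by apply/cvg_nrmP => e e0; apply: filterS XE => k [_ ->]; rewrite subrr nrm0.
  exact: (cvg_mx_unique XH' XH_lim).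
have H00 : H0 = 0.
  apply: (cvg_mx_unique H_lim); apply/cvg_nrmP => e e0.
  have neq : \forall k \near k0^', k != k0 by exact: nbhs_dnbhs_neq.
  apply: filterS2 neq MC => k kk0; rewrite Cc0 mulmx0 => /esym/eqP.
  by rewrite scaler_eq0 subr_eq0 (negPf kk0) /= => /eqP ->; rewrite subr0 nrm0.
rewrite -row_free_unit -kermx_eq0; apply/eqP; apply: free; first exact: mulmx_ker.
by rewrite H00 mulmx0.
Qed.

End Inverse.
End MatrixLimits.

Arguments cvg_cstmx {R T F FF p q} A.

(** * Limits of Cauchy families, with a rate *)

Section CauchyFamilies.
Variable R : realType.
Local Notation C := R[i].
Local Notation nrm := (@cmxnorm R _ _).

(** By hypothesis every phi a - A d a lies below every phi b + A d b; the supremum of the lower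
    values separates the two families. *)
Lemma cauchy_family_real (T : Type) (S : T -> Prop) (phi d : T -> R) A :
  (forall a b, S a -> S b -> phi a - phi b <= A * (d a + d b)) ->
  exists L, forall a, S a -> `|phi a - L| <= A * d a.
Proof.
move=> h; have [[a0 Sa0]|noS] := pselect (exists a, S a); last first.
  by exists 0 => a Sa; exfalso; apply: noS; exists a.
pose E := [set phi a - A * d a | a in [set a | S a]].
have ubE b : S b -> ubound E (phi b + A * d b).
  by move=> Sb _ [a /= Sa <-]; have := h a b Sa Sb; rewrite mulrDr; lra.
have supE : has_sup E by split; [exists (phi a0 - A * d a0), a0|exists (phi a0 + A * d a0); exact: ubE].
exists (sup E) => a Sa; rewrite ler_norml; apply/andP; split.
  have : sup E <= phi a + A * d a by apply: ge_sup; [case: supE|exact: ubE].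
  lra.
have : phi a - A * d a <= sup E by apply: ub_le_sup; [case: supE|exists a].
lra.
Qed.

Lemma cauchy_family_mx (T : Type) (S : T -> Prop) p q (P : T -> 'M[C]_(p, q)) (d : T -> R) A :
  (forall a b, S a -> S b -> nrm (P a - P b) <= A * (d a + d b)) ->
  exists L : 'M[C]_(p, q), exists B, forall a, S a -> nrm (P a - L) <= B * d a.
Proof.
move=> h.
have ent a b i j : S a -> S b -> cmod (P a i j - P b i j) <= A * (d a + d b).
  move=> Sa Sb; apply: le_trans (h a b Sa Sb).
  by have := nrm_entry (P a - P b) i j; rewrite !mxE.
have hre (ij : 'I_p * 'I_q) : exists L, forall a, S a ->
    `|complex.Re (P a ij.1 ij.2) - L| <= A * d a.
  apply: cauchy_family_real => a b Sa Sb; apply: le_trans (ent a b ij.1 ij.2 Sa Sb).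
  apply: le_trans (Re_le_cmod _); apply: le_trans (ler_norm _).
  by case: (P a _ _) (P b _ _) => x y [].
have him (ij : 'I_p * 'I_q) : exists L, forall a, S a ->
    `|complex.Im (P a ij.1 ij.2) - L| <= A * d a.
  apply: cauchy_family_real => a b Sa Sb; apply: le_trans (ent a b ij.1 ij.2 Sa Sb).
  apply: le_trans (Im_le_cmod _); apply: le_trans (ler_norm _).
  by case: (P a _ _) (P b _ _) => x y [].
have [re hre'] := choice hre; have [im him'] := choice him.
exists (\matrix_(i, j) Complex (re (i, j)) (im (i, j))), ((p * q)%:R * (2 * A)) => a Sa.
rewrite -!mulrA; apply: nrm_le_sum => i j; rewrite !mxE.
apply: le_trans (cmod_le _) _; rewrite mulr_natl mulr2n.
have := lerD (hre' (i, j) a Sa) (him' (i, j) a Sa).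
by case: (P a i j) => x y.
Qed.

End CauchyFamilies.

(** * The boundary condition in symplectic coordinates *)

Section BoundaryAlgebra.
Variables (R : realType) (n : nat) (U : 'M[R[i]]_n).
Local Notation C := R[i].
Hypothesis UU : U *m adjmx U = 1%:M.

Lemma adjmx1 : adjmx (1%:M : 'M[C]_n) = 1%:M.
Proof.
by apply/matrixP => i j; rewrite !mxE eq_sym; case: eqP => _ /=; rewrite ?mulr1n ?mulr0n /= oppr0.
Qed.

Lemma adjmx_Amx : adjmx (Amx U) = (2%:R^-1 : C) *: (adjmx U + 1%:M).
Proof. by rewrite /Amx adjmxZ adjmxD adjmx1 fmorphV rmorph_nat. Qed.

Lemma adjmx_Bmx : adjmx (Bmx U) = - ('i%C / 2%:R : C) *: (adjmx U - 1%:M).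
Proof.
rewrite /Bmx adjmxZ adjmxB adjmx1 rmorphM fmorphV rmorph_nat /=.
by congr (_ *: _); rewrite -mulNr; congr (_ * _); apply: complex_ext; rewrite /= ?oppr0.
Qed.

(** Together with [Amx_Bmx_sym], this expresses through the unitarity of U that the boundary
    condition is Lagrangian for the Wronskian form. *)
Lemma Amx_Bmx_sqr : Amx U *m adjmx (Amx U) + Bmx U *m adjmx (Bmx U) = 1%:M.
Proof.
rewrite adjmx_Amx adjmx_Bmx /Amx /Bmx -!scalemxAl -!scalemxAr !scalerA.
rewrite !(mulmxDl, mulmxDr) !(mulNmx, mulmxN) UU !mul1mx !mulmx1.
have i2 : 'i%C * 'i%C = -1 :> C by rewrite -expr2 sqr_i.
move: (adjmx U) (1%:M : 'M[C]_n) => U' I1; apply/matrixP => i j; rewrite !mxE.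
by field: i2.
Qed.

Lemma Amx_Bmx_sym : Amx U *m adjmx (Bmx U) = Bmx U *m adjmx (Amx U).
Proof.
rewrite adjmx_Amx adjmx_Bmx /Amx /Bmx -!scalemxAl -!scalemxAr !scalerA.
rewrite !(mulmxDl, mulmxDr) !(mulNmx, mulmxN) UU !mul1mx !mulmx1.
move: (adjmx U) (1%:M : 'M[C]_n) => U' I1; apply/matrixP => i j; rewrite !mxE.
by field.
Qed.

(** The Wronskian form keeps its shape, up to sign, in the boundary coordinates given by A and B;
    its first coordinate becomes the boundary form of the problem. *)
Lemma symplectic_change (p p' q q' A B As Bs : 'M[C]_n) :
  A *m As + B *m Bs = 1%:M -> A *m Bs = B *m As ->
  p *m q' - p' *m q =
  (p *m B - p' *m A) *m (As *m q + Bs *m q') - (p *m A + p' *m B) *m (Bs *m q - As *m q').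
Proof.
move=> sqr sym.
have e1 : p *m q' = p *m A *m As *m q' + p *m B *m Bs *m q'.
  by rewrite -mulmxDl -!(mulmxA p) -mulmxDr sqr mulmx1.
have e2 : p' *m q = p' *m A *m As *m q + p' *m B *m Bs *m q.
  by rewrite -mulmxDl -!(mulmxA p') -mulmxDr sqr mulmx1.
have e3 : p *m A *m Bs *m q = p *m B *m As *m q by rewrite -!(mulmxA p) sym.
have e4 : p' *m A *m Bs *m q' = p' *m B *m As *m q' by rewrite -!(mulmxA p') sym.
rewrite e1 e2 !(mulmxDl, mulmxDr, mulNmx, mulmxN) !mulmxA e3 e4.
move: (p *m A *m As *m q') (p *m B *m Bs *m q') (p' *m A *m As *m q) (p' *m B *m Bs *m q).
move: (p *m B *m As *m q) (p' *m B *m As *m q') => X1 X2 X3 X4 X5 X6.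
by apply/matrixP => i j; rewrite !mxE; ring.
Qed.

Lemma wronskian_boundary (f f' g g' : 'M[C]_n) :
  adjmx f *m g' - adjmx f' *m g =
  (adjmx f *m Bmx U - adjmx f' *m Amx U) *m adjmx (adjmx g *m Amx U + adjmx g' *m Bmx U) -
  (adjmx f *m Amx U + adjmx f' *m Bmx U) *m adjmx (adjmx g *m Bmx U - adjmx g' *m Amx U).
Proof.
have := Amx_Bmx_sym; have := Amx_Bmx_sqr; move: (Amx U) (Bmx U) => A B sqr sym.
by rewrite adjmxD adjmxB !adjmxM (adjmxK g) (adjmxK g'); exact: symplectic_change.
Qed.

(** The adjoint of V times the boundary form of g kills the second term of [wronskian_boundary];
    what remains has the boundary form of f as left factor. *)
Lemma wronskian_kernel (f f' g g' V : 'M[C]_n) :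
  V *m (adjmx g *m Bmx U - adjmx g' *m Amx U) = 0 ->
  (adjmx f *m g' - adjmx f' *m g) *m adjmx V =
  (adjmx f *m Bmx U - adjmx f' *m Amx U) *m
    (adjmx (adjmx g *m Amx U + adjmx g' *m Bmx U) *m adjmx V).
Proof.
move=> V0.
have z : adjmx (adjmx g *m Bmx U - adjmx g' *m Amx U) *m adjmx V = 0.
  by rewrite -adjmxM V0; apply/matrixP => i j; rewrite !mxE conjc0.
rewrite (wronskian_boundary f f' g g') mulmxBl.
rewrite -(mulmxA (adjmx f *m Amx U + adjmx f' *m Bmx U)) z mulmx0 subr0.
by rewrite mulmxA.
Qed.

End BoundaryAlgebra.

(** * Continuity of the Jost data and of the Gram matrix at a point *)

Section JostFunctionLimits.
Variables (R : realType) (n : nat) (Q : R -> 'M[R[i]]_n) (F Fx : R -> R[i] -> 'M[R[i]]_n).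
Local Notation C := R[i].
Local Notation nrm := (@cmxnorm R _ _).
Hypothesis Qherm : forall t : R, 0 <= t -> adjmx (Q t) = Q t.
Hypothesis QRe : forall i j,
  measurable_fun (`[0%R, +oo[ : set R) (fun t : R => complex.Re (Q t i j)).
Hypothesis QIm : forall i j,
  measurable_fun (`[0%R, +oo[ : set R) (fun t : R => complex.Im (Q t i j)).
Hypothesis Qint :
  (\int[lebesgue_measure]_(t in `[0%R, +oo[) ((1 + t) * cmxnorm (Q t))%:E < +oo)%E.
Hypothesis FJ : jost_solution Q F Fx.

Let refl (k : C) : C := - conjc k.

Lemma Im_refl k : complex.Im (refl k) = complex.Im k.
Proof. by case: k => a b /=; rewrite opprK. Qed.

Lemma cmod_refl k l : cmod (refl k - refl l) = cmod (k - l).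
Proof. by rewrite /refl -opprD cmodN -rmorphB cmod_conj. Qed.

Lemma jost_of_solution k : 0 < complex.Im k ->
  jost (qgauge Q) (qinc Q) k (F^~ k) (Fx^~ k).
Proof.
move=> kp; have [sol lim] := FJ kp; split=> //.
- by move=> x x0; case: (solves_half_ider QRe QIm Qint sol x0).
- by move=> x x0; case: (solves_half_ider QRe QIm Qint sol x0).
- move=> e e0; move/cvg_nrmP: lim => /(_ _ e0)[X [_ hX]].
  by exists (X + 1) => x Xx; apply/ltW/hX; apply: lt_le_trans Xx; rewrite ltrDl.
Qed.

(** The estimates are centred at l = refl kl and carried over by [refl], which preserves distances
    and imaginary parts. The Wronskian identity is the definition of [jgram] with the denominator
    cleared. *)
Lemma jost_limits kl : 0 < complex.Im kl ->
  exists (G : C -> 'M[C]_n) (G0 : 'M[C]_n),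
  [/\ (fun k => F 0 (- conjc k)) @ kl^' --> F 0 (- conjc kl),
      (fun k => Fx 0 (- conjc k)) @ kl^' --> Fx 0 (- conjc kl),
      G @ kl^' --> G0,
      \forall k \near kl^',
        adjmx (F 0 (- conjc k)) *m Fx 0 (- conjc kl) -
        adjmx (Fx 0 (- conjc k)) *m F 0 (- conjc kl) =
        (conjc kl ^+ 2 - k ^+ 2) *: G k &
      forall u : 'cV[C]_n, u != 0 -> (adjmx u *m G0 *m u) 0 0 != 0].
Proof.
move=> klp; pose l := refl kl.
have lp : 0 < complex.Im l by rewrite Im_refl.
have Jl := jost_of_solution lp.
have qnu s t : 0 <= s -> s <= t -> qmass Q t - qmass Q s <= qgauge Q t - qgauge Q s.
  by move=> s0 st; rewrite /qgauge opprD addrACA lerDr subr_ge0.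
have nuP := qgaugeP QRe QIm Qint.
have qle := qmass_le QRe QIm Qint.
have q0 := qmass_ge0 Q.
have qbd := qmass_leoo QRe QIm Qint.
have qi := nrm_qinc QRe QIm Qint.
have qadj s t := qinc_adj Qherm QRe QIm Qint (s := s) t.
have [M M0 gM] := jnorm_bounded nuP Jl.
have closeJ k : cmod (k - kl) <= complex.Im kl / 4 ->
    jost (qgauge Q) (qinc Q) (refl k) (F^~ (refl k)) (Fx^~ (refl k)) /\
    cmod (refl k - l) <= complex.Im l / 4.
  move=> kkl; split; last by rewrite cmod_refl Im_refl.
  apply: jost_of_solution; rewrite Im_refl.
  have : complex.Im k = complex.Im kl + complex.Im (k - kl) by rewrite -ImD addrC subrK.
  have := Im_le_cmod (k - kl); rewrite ler_norml => /andP[+ _] ->.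
  by move: kkl klp; lra.
have near4 : \forall k \near kl^', cmod (k - kl) <= complex.Im kl / 4.
  have e0 : 0 < complex.Im kl / 4 by rewrite divr_gt0.
  by apply: filterS (near_cmod kl e0) => k /ltW.
have conj_refl k : conjc (refl k) ^+ 2 = k ^+ 2.
  by case: k => a b; rewrite /refl /= opprK -sqrrN; congr (_ ^+ 2); apply: complex_ext => /=; rewrite opprK.
have l2 : l ^+ 2 = conjc kl ^+ 2 by rewrite /l /refl sqrrN.
(* Equality means k = conj kl, which lies in the lower half-plane, or k = - conj kl, which is either
   the removed point kl or at positive distance from it. *)
have near_neq : \forall k \near kl^', k ^+ 2 != conjc kl ^+ 2.
  have kk : \forall k \near kl^', k != - conjc kl.
    have [e|ne] := eqVneq kl (- conjc kl); first by rewrite -e; exact: nbhs_dnbhs_neq.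
    have d0 : 0 < cmod (- conjc kl - kl) by rewrite cmod_gt0// subr_eq0 eq_sym.
    apply: filterS (near_cmod kl d0) => k; apply: contraTneq => ->.
    by rewrite ltxx.
  apply: filterS2 kk near4 => k k1 k2.
  have [[kp _ _ _] _] := closeJ k k2; rewrite Im_refl in kp.
  rewrite -subr_eq0 subr_sqr mulf_neq0 ?addr_eq0//; apply/eqP => /(congr1 (@complex.Im R)).
  by move: kp klp; case: (k) (kl) => a b [c d] /= ? ? ?; lra.
pose close k := [/\ jost (qgauge Q) (qinc Q) (refl k) (F^~ (refl k)) (Fx^~ (refl k)),
  cmod (refl k - l) <= complex.Im l / 4 & conjc (refl k) ^+ 2 != l ^+ 2].
have near_close : \forall k \near kl^', close k.
  apply: filterS2 near4 near_neq => k /closeJ[j1 j2] j3.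
  by split=> //; rewrite conj_refl l2.
pose G k := jgram l (F^~ l) (Fx^~ l) (refl k) (F^~ (refl k)) (Fx^~ (refl k)) 0.
have [G0 [B GB]] : exists L : 'M[C]_n, exists B, forall a, close a ->
    nrm (G a - L) <= B * cmod (a - kl).
  apply: (@cauchy_family_mx _ _ close _ _ G (fun a => cmod (a - kl))
    (jlip n (qmass Q) l M * M * (2 / complex.Im l))).
  move=> a b ca cb; apply: le_trans (jgram_cauchy nuP qle q0 qbd qnu qi qadj Jl M0 gM ca cb) _.
  rewrite !cmod_refl le_eqVlt; apply/orP; left; apply/eqP.
  by move: (jlip _ _ _ _) (2 / _) (cmod _) (cmod _) => *; ring.
exists G, G0; split.
- apply: (@lipschitz_cvg _ _ _ _ _ _ (jlip n (qmass Q) l M)).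
  apply: filterS near4 => k /closeJ[j1 j2].
  have := jost_close nuP qle q0 qbd qnu qi Jl M0 gM j1 j2 (lexx 0).
  by rewrite mulr0 expR0 mulr1 cmod_refl.
- apply: lipschitz_cvg; apply: filterS near4 => k /closeJ[j1 j2].
  have := jost_deriv0_close nuP qle q0 qbd qnu qi Jl M0 gM j1 j2.
  by rewrite cmod_refl; exact.
- apply: lipschitz_cvg; apply: filterS near_close => k; exact: GB.
- apply: filterS near_close => k [_ _ c0].
  rewrite /G /jgram scalerA conj_refl l2 in c0 *.
  rewrite mulrN -mulNr opprB mulfV ?scale1r//.
  by rewrite subr_eq0.
- move=> u u0; have [r r0 [B' h]] := jgram_pos nuP qle q0 qbd qnu qi qadj Jl M0 gM u0.
  apply/eqP => z.
  have N0 := nrm_ge0 u.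
  (* If the form of G0 vanished at u, then r <= (|B'| + |B| |u|^2) d at distance d from kl, which
     fails for d < r / A; the + 1 keeps A positive. *)
  pose A := `|B'| + `|B| * (nrm u * nrm u) + 1.
  have A0 : 0 < A by rewrite ltr_wpDl// addr_ge0// !mulr_ge0.
  have e0 : 0 < r / A by rewrite divr_gt0.
  have [k [ck dk]] := filter_ex (filterI near_close (near_cmod kl e0)).
  have := h _ _ _ ck; rewrite cmod_refl -/(G k) => lower.
  have d0 := cmod_ge0 (k - kl).
  have upper : complex.Re ((adjmx u *m G k *m u) 0 0) <= `|B| * cmod (k - kl) * (nrm u * nrm u).
    have -> : (adjmx u *m G k *m u) 0 0 = (adjmx u *m (G k - G0) *m u) 0 0.
      rewrite mulmxBr mulmxBl; move: (adjmx u *m G k *m u) (adjmx u *m G0 *m u) z => X Y zY.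
      by rewrite !mxE zY subr0.
    apply: le_trans (ler_norm _) _; apply: le_trans (Re_le_cmod _) _.
    apply: le_trans (nrm_entry _ _ _) _; apply: le_trans (nrmM _ _) _.
    apply: le_trans (ler_wpM2r N0 (nrmM _ _)) _; rewrite nrm_adj.
    rewrite mulrAC mulrC; apply: ler_wpM2r; first exact: mulr_ge0.
    apply: le_trans (GB _ ck) _; apply: ler_wpM2r => //; exact: ler_norm.
  have b1 : B' * cmod (k - kl) <= `|B'| * cmod (k - kl) by apply: ler_wpM2r => //; exact: ler_norm.
  have b2 : A * cmod (k - kl) < r by rewrite mulrC -ltr_pdivlMr.
  move: (le_trans lower upper) b1 b2; rewrite /A !mulrDl mul1r.
  rewrite [`|B| * (nrm u * nrm u) * _]mulrAC.
  move: d0; move: (cmod _) (`|B'| * _) (B' * _) (`|B| * _ * _) => d X1 X2 X3 *; lra.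
Qed.

End JostFunctionLimits.

Section DefiniteForms.
Variables (R : realType) (n : nat) (G : 'M[R[i]]_n).
Local Notation C := R[i].
Hypothesis definite : forall u : 'cV[C]_n, u != 0 -> (adjmx u *m G *m u) 0 0 != 0.

(** The diagonal entries of Z G adjmx Z are the values of the form on the adjoint rows of Z. *)
Lemma definite_mx_eq0 (Z : 'M[C]_n) : Z *m G *m adjmx Z = 0 -> Z = 0.
Proof.
move=> Z0; apply/row_matrixP => i; rewrite row0.
have [u0|/definite/eqP[]] := eqVneq (adjmx (row i Z)) 0.
  by rewrite -[row i Z]adjmxK u0; apply/matrixP => a b; rewrite !mxE conjc0.
rewrite adjmxK -row_mul.
have -> : (row i (Z *m G) *m adjmx (row i Z)) 0 0 = (Z *m G *m adjmx Z) i i.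
  by rewrite !mxE; apply: eq_bigr => j _; rewrite !mxE.
by rewrite Z0 mxE.
Qed.

End DefiniteForms.

(** * Simplicity of the poles *)

Theorem theorem4 (R : realType) (n : nat) (Q : R -> 'M[R[i]]_n)
  (U : 'M[R[i]]_n) (F Fx : R -> R[i] -> 'M[R[i]]_n) :
  (0 < n)%N ->
  (forall t : R, 0 <= t -> adjmx (Q t) = Q t) ->
  (forall i j, measurable_fun (`[0%R, +oo[ : set R) (fun t : R => complex.Re (Q t i j))) ->
  (forall i j, measurable_fun (`[0%R, +oo[ : set R) (fun t : R => complex.Im (Q t i j))) ->
  (\int[lebesgue_measure]_(t in `[0%R, +oo[) ((1 + t) * cmxnorm (Q t))%:E < +oo)%E ->
  U *m adjmx U = 1%:M ->
  ~ zero_virtual_level Q U ->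
  jost_solution Q F Fx ->
  forall kl : R[i], 0 < complex.Im kl ->
    pole_of_inv (Mminus U F Fx) kl ->
    exists N : 'M[R[i]]_n, N != 0 /\
      (fun k => (k - kl) *: invmx (Mminus U F Fx k)) @ kl^' --> N.
Proof.
move=> _ Qherm QRe QIm Qint UU _ FJ kl klp [M_unit unbounded].
have [G [G0 [f_lim f'_lim G_lim wron definite]]] := jost_limits Qherm QRe QIm Qint FJ klp.
pose f k := F 0 (- conjc k); pose f' k := Fx 0 (- conjc k).
pose J k := adjmx (f k) *m Bmx U - adjmx (f' k) *m Amx U.
pose a (k : R[i]) : R[i] := - (2%:R * 'i%C * k)^-1.
(* The rows of [V] span the left kernel of [J kl], so a single matrix [Cc] serves all null vectors
   at once. *)
pose V := kermx (J kl).
pose Cc := adjmx (adjmx (f kl) *m Amx U + adjmx (f' kl) *m Bmx U) *m adjmx V.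
have kl0 : kl != 0 by apply: contraTneq klp => ->; rewrite /= ltxx.
have a0 : a kl != 0.
  rewrite oppr_eq0 invr_eq0 !mulf_neq0 ?pnatr_eq0//.
  by apply/eqP => /(congr1 (@complex.Im R)) /= /eqP; rewrite oner_eq0.
have a_lim : a @ kl^' --> a kl.
  apply: cvgN; apply: cvgV; first by rewrite -oppr_eq0 -[X in - X]invrK oppr_eq0 invr_eq0 -oppr_eq0.
  by apply: cvgM; [exact: cvg_cst|exact: nbhs_dnbhs].
have adj_lim (P : R[i] -> 'M[R[i]]_n) (P0 : 'M[R[i]]_n) : P @ kl^' --> P0 ->
    (fun k => adjmx (P k)) @ kl^' --> adjmx P0.
  move=> /cvg_nrmP h; apply/cvg_nrmP => e /h; apply: filterS => k.
  by rewrite -adjmxB nrm_adj.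
have J_lim : J @ kl^' --> J kl.
  by have := cvg_mxB (cvg_mulmx (adj_lim _ _ f_lim) (cvg_cstmx (Bmx U)))
    (cvg_mulmx (adj_lim _ _ f'_lim) (cvg_cstmx (Amx U))); apply.
have M_lim : Mminus U F Fx @ kl^' --> a kl *: J kl.
  by have := cvg_mxZ a_lim J_lim; apply.
have singular : a kl *: J kl \notin unitmx.
  by apply/negP => u; apply: unbounded; exact: (bounded_inv_of_unit_limit M_lim M_unit u).
have VJ : V *m J kl = 0 := mulmx_ker _.
have JC : \forall k \near kl^', J k *m Cc = (conjc kl ^+ 2 - k ^+ 2) *: (G k *m adjmx V).
  apply: filterS wron => k wronk; rewrite scalemxAl -wronk.
  exact/esym/(wronskian_kernel UU (f k) (f' k) VJ).
(* A matrix Z killing [J kl] factors as D *m V, so the second condition makes Z G0 adjmx Z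
   vanish. *)
have kernel_free (Z : 'M[R[i]]_n) : Z *m J kl = 0 -> Z *m (G0 *m adjmx V) = 0 -> Z = 0.
  move=> /sub_kermxP/submxP[D ->] Z0; apply: (definite_mx_eq0 definite).
  by rewrite adjmxM mulmxA -[_ *m G0 *m adjmx _]mulmxA Z0 mul0mx.
have GV_lim : (fun k => G k *m adjmx V) @ kl^' --> G0 *m adjmx V.
  by have := cvg_mulmx G_lim (cvg_cstmx (adjmx V)); apply.
have id_lim : (fun k : R[i] => k) @ kl^' --> kl by exact: nbhs_dnbhs.
(* The case [real] places k_l on the imaginary axis, where k_l ^ 2 is real and the Wronskian factor
   vanishes at k_l. *)
have [real|nonreal] := eqVneq (conjc kl) (- kl).
(* On the axis, conj k_l ^ 2 - k ^ 2 = - (k - k_l) (k + k_l); [h] is what remains beside k - k_l,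
   including the scalar of [Mminus]. *)
- pose h k := - a k * (k + kl).
  have h0 : h kl != 0.
    have -> : h kl = - a kl * (2%:R * kl) by rewrite /h mulr_natl mulr2n.
    apply: mulf_neq0; first by rewrite oppr_eq0.
    by apply: mulf_neq0 => //; rewrite pnatr_eq0.
  have h_lim : h @ kl^' --> h kl.
    have h1 : (fun k => - a k) @ kl^' --> - a kl by exact: (cvgN a_lim).
    have h2 : (fun k : R[i] => k + kl) @ kl^' --> kl + kl by exact: (cvgD id_lim (cvg_cst kl)).
    by have := cvgM h1 h2; apply.
  have H_lim : (fun k => h k *: (G k *m adjmx V)) @ kl^' --> h kl *: (G0 *m adjmx V).
    by have := cvg_mxZ h_lim GV_lim; apply.
  have MC : \forall k \near kl^',
      Mminus U F Fx k *m Cc = (k - kl) *: (h k *: (G k *m adjmx V)).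
    apply: filterS JC => k JCk.
    have -> : Mminus U F Fx k = a k *: J k by [].
    rewrite -scalemxAl JCk scalerA [RHS]scalerA; congr (_ *: _).
    by rewrite real sqrrN /h; ring.
  have free (Z : 'M[R[i]]_n) : Z *m (a kl *: J kl) = 0 ->
      Z *m (h kl *: (G0 *m adjmx V)) = 0 -> Z = 0.
    rewrite -!scalemxAr => /eqP; rewrite scaler_eq0 (negPf a0) /= => /eqP Z1 /eqP.
    by rewrite scaler_eq0 (negPf h0) /= => /eqP; exact: kernel_free.
  exact: (simple_pole_criterion M_lim M_unit H_lim MC free singular).
(* Off the axis, [JC] passes to the limit with a nonzero factor, so the left kernel of [J kl] also
   annihilates the limit of G k *m adjmx V and is trivial by [kernel_free]. *)
- exfalso; move/negP: singular; apply.
  have c0 : conjc kl ^+ 2 - kl ^+ 2 != 0.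
    rewrite subr_sqr mulf_neq0//.
      apply/eqP => /(congr1 (@complex.Im R)) /eqP.
      move: klp; case: (kl) => x y /= yp.
      by rewrite -opprD oppr_eq0 gt_eqF// addr_gt0.
    by rewrite addr_eq0.
  rewrite -row_free_unit -kermx_eq0; apply/eqP; apply: kernel_free.
    have /eqP := mulmx_ker (a kl *: J kl).
    by rewrite -scalemxAr scaler_eq0 (negPf a0) /= => /eqP.
  have JCl : J kl *m Cc = (conjc kl ^+ 2 - kl ^+ 2) *: (G0 *m adjmx V).
    have lim1 : (fun k => J k *m Cc) @ kl^' --> J kl *m Cc.
      by have := cvg_mulmx J_lim (cvg_cstmx Cc); apply.
    have c_lim : (fun k => conjc kl ^+ 2 - k ^+ 2) @ kl^' --> conjc kl ^+ 2 - kl ^+ 2.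
      by apply: cvgB; [exact: cvg_cst|exact: cvgM].
    have lim2 : (fun k => J k *m Cc) @ kl^' --> (conjc kl ^+ 2 - kl ^+ 2) *: (G0 *m adjmx V).
      have lim3 : (fun k => (conjc kl ^+ 2 - k ^+ 2) *: (G k *m adjmx V)) @ kl^' -->
          (conjc kl ^+ 2 - kl ^+ 2) *: (G0 *m adjmx V).
        by have := cvg_mxZ c_lim GV_lim; apply.
      apply/cvg_nrmP => e e0; move/cvg_nrmP: lim3 => /(_ e e0).
      by apply: filterS2 JC => k ->.
    exact: (cvg_mx_unique lim1 lim2).
  have /eqP := mulmx_ker (a kl *: J kl).
  rewrite -scalemxAr scaler_eq0 (negPf a0) /= => /eqP ZJ.
  have /eqP : kermx (a kl *: J kl) *m (J kl *m Cc) = 0 by rewrite mulmxA ZJ mul0mx.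
  by rewrite JCl -scalemxAr scaler_eq0 (negPf c0) /= => /eqP.
Qed.
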